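(* Let $1\le p<\infty$ and let $\Omega$ be a bounded domain in $\mathbb{C}^n$. Assume that for every sequence $\{w_k\}$ in $\Omega$ without an accumulation point in $\Omega$, $$\lim_{k\to\infty}\frac{m_p(z,w_k)}{m_p(w_k)}=0\quad\text{for every } z\in\Omega.$$ Then $\Omega$ is $p$-Skwarczyński complete.
   Context: For a bounded domain $\Omega\subset\mathbb{C}^n$ and $1\le p<\infty$, the $p$-Bergman space is $\mathcal{A}^p(\Omega)=\{f\in L^p(\Omega): f \text{ is holomorphic in }\Omega\}$, with the $L^p(\Omega)$ norm $\|\cdot\|_p$ (Lebesgue measure). For $z\in\Omega$ put $m_p(z)=\inf\{\|f\|_p: f\in\mathcal{A}^p(\Omega),\ f(z)=1\}$. It is known that there is a unique $f\in\mathcal{A}^p(\Omega)$ with $f(z)=1$ attaining this infimum; it is denoted $m_p(\cdot,z)$, so $m_p(\zeta,z)$ is its value at $\zeta\in\Omega$. The $p$-Skwarczyński distance on $\Omega$ is $$\rho_p(z,w)=\min_{t\in[0,2\pi]}\left\|e^{it}\frac{m_p(\cdot,z)}{m_p(z)}-\frac{m_p(\cdot,w)}{m_p(w)}\right\|_p .$$ It is a distance, since it is known that $m_p(\cdot,z)$ is not a constant multiple of $m_p(\cdot,w)$ when $z\ne w$. $\Omega$ is called $p$-Skwarczyński complete if every $\rho_p$-Cauchy sequence in $\Omega$ converges with respect to $\rho_p$ to a point of $\Omega$. *)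

(* Defs.v *)
From HB Require Import structures.
From mathcomp Require Import all_boot all_order all_algebra.
From mathcomp Require Import all_classical all_reals all_analysis.
From mathcomp Require Import complex.

Set Implicit Arguments.
Unset Strict Implicit.
Unset Printing Implicit Defensive.

Import Order.TTheory GRing.Theory Num.Theory.
Import numFieldNormedType.Exports.

Local Open Scope classical_set_scope.
Local Open Scope complex_scope.
Local Open Scope ring_scope.

(* The topology and normed-module structure that the library puts on every
   [numClosedFieldType], made inferable for the carrier [R[i]]; in particular
   [differentiable] at ['rV[R[i]]_n -> R[i]] is complex differentiability. *)
HB.instance Definition _ (R : realType) :=
  NormedModule.copy R[i] (R[i] : numClosedFieldType)^o.

(* A copy of the library's product measure on which sigma-finiteness is
   inferable for abstract factors: for [_ \x _] itself, canonical structure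
   inference only finds the instance for subprobabilities. *)
Section sigma_finite_product.
Context d1 d2 (T1 : measurableType d1) (T2 : measurableType d2) (R : realType).
Variable mu : {sigma_finite_measure set T1 -> \bar R}.
Variable nu : {sigma_finite_measure set T2 -> \bar R}.

Definition prod_measure : set (T1 * T2) -> \bar R := (mu \x nu)%E.

HB.instance Definition _ := Measure.copy prod_measure (mu \x nu)%E.

Let prod_measure_sigma_finite : sigma_finite setT prod_measure.
Proof.
have /sigma_finiteP[F [TF ndF Foo]] := sigma_finiteT mu.
have /sigma_finiteP[G [TG ndG Goo]] := sigma_finiteT nu.
exists (fun i => F i `*` G i).
  rewrite -setXTT TF TG predeqE => -[x y]; split.
    move=> [/= [i _ Fi] [k _ Gky]]; exists (maxn i k) => //; split.
    - by move: x Fi; exact/subsetPset/ndF/leq_maxl.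
    - by move: y Gky; exact/subsetPset/ndG/leq_maxr.
  by move=> [i _ []/= ? ?]; split; exists i.
move=> k; have [? ?] := Foo k; have [? ?] := Goo k.
split; first exact: measurableX.
by rewrite /prod_measure product_measure1E// lte_mul_pinfty// ge0_fin_numE.
Qed.

HB.instance Definition _ := Measure_isSigmaFinite.Build _ _ _ prod_measure
  prod_measure_sigma_finite.

End sigma_finite_product.

(* The n-fold product measure on n-tuples. *)
Section power_measure.
Context d (T : measurableType d) (R : realType).

Definition tcons n (x : T * n.-tuple T) : n.+1.-tuple T :=
  [tuple of x.1 :: x.2].

Lemma measurable_tcons n : measurable_fun setT (@tcons n).
Proof.
exact: measurable_cons measurable_fst measurable_snd.
Qed.

Definition tuncons n (t : n.+1.-tuple T) : T * n.-tuple T :=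
  (thead t, [tuple of behead t]).

Lemma measurable_tuncons n : measurable_fun setT (@tuncons n).
Proof.
apply/measurable_fun_pairP; split; first exact: measurable_tnth.
exact: measurable_behead.
Qed.

Lemma tconsK n : cancel (@tcons n) (@tuncons n).
Proof. by case=> x t; congr pair; apply/val_inj. Qed.

Lemma tunconsK n : cancel (@tuncons n) (@tcons n).
Proof. by move=> t; rewrite [RHS]tuple_eta. Qed.

Section step.
Variables (n : nat) (mu : {sigma_finite_measure set T -> \bar R}).
Variable nu : {sigma_finite_measure set (n.-tuple T) -> \bar R}.

Definition cons_measure : set (n.+1.-tuple T) -> \bar R :=
  pushforward (prod_measure mu nu) (@tcons n).

Let cons_measure0 : cons_measure set0 = 0%E.
Proof. by rewrite /cons_measure /pushforward preimage_set0 measure0. Qed.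

Let cons_measure_ge0 A : (0 <= cons_measure A)%E.
Proof. by rewrite /cons_measure /pushforward; exact: measure_ge0. Qed.

Let cons_measure_sigma_additive : semi_sigma_additive cons_measure.
Proof.
move=> F mF tF mUF; rewrite /cons_measure /pushforward preimage_bigcup.
apply: measure_semi_sigma_additive.
- by move=> i; rewrite -[X in measurable X]setTI; exact: measurable_tcons.
- apply/trivIsetP => /= i j _ _ ij; rewrite -preimage_setI.
  by move/trivIsetP : tF => /(_ _ _ _ _ ij) ->//; rewrite preimage_set0.
- by rewrite -preimage_bigcup -[X in measurable X]setTI; exact: measurable_tcons.
Qed.

HB.instance Definition _ := isMeasure.Build _ _ _ cons_measure
  cons_measure0 cons_measure_ge0 cons_measure_sigma_additive.

Let cons_measure_sigma_finite : sigma_finite setT cons_measure.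
Proof.
have [F FT Foo] : sigma_finite setT (prod_measure mu nu).
  exact: sigma_finiteT.
exists (fun i => @tuncons n @^-1` F i).
  by rewrite -preimage_bigcup -FT preimage_setT.
move=> i; have [mF Fi] := Foo i; split.
  by rewrite -[X in measurable X]setTI; exact: measurable_tuncons.
rewrite /cons_measure /pushforward -comp_preimage.
rewrite (_ : _ \o _ = id) ?preimage_id//.
by apply/funext => x; exact: tconsK.
Qed.

HB.instance Definition _ := Measure_isSigmaFinite.Build _ _ _ cons_measure
  cons_measure_sigma_finite.

End step.

Fixpoint power_measure (mu : {sigma_finite_measure set T -> \bar R}) n :
    {sigma_finite_measure set (n.-tuple T) -> \bar R} :=
  if n is n'.+1 then cons_measure mu (power_measure mu n')
  else \d_([tuple] : 0.-tuple T).

End power_measure.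

Section skwarczynski.
Context (R : realType) (n : nat).
Local Notation C := R[i].
Local Notation M := (measurableTypeR R).
Implicit Types (p : R) (Omega : set 'rV[C]_n) (f : 'rV[C]_n -> C).
Implicit Types (z w : 'rV[C]_n).

Definition bounded_domain Omega :=
  [/\ Omega !=set0, open Omega, connected Omega & bounded_set Omega].

(* The identification of (R^2)^n with C^n, through which Lebesgue measure and
   measurability on C^n are expressed. *)
Definition of_real_coord (t : n.-tuple (M * M)) : 'rV[C]_n :=
  \row_j ((tnth t j).1 +i* (tnth t j).2).

Definition lebesgue_Cn :
    {sigma_finite_measure set (n.-tuple (M * M)) -> \bar R} :=
  power_measure (prod_measure (@lebesgue_measure R) (@lebesgue_measure R)) n.

Definition Lp_norm p Omega f : \bar R :=
  Lnorm lebesgue_Cn p%:E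
    (EFin \o ((@Normc.normc R \o f \o of_real_coord)
                \_ (of_real_coord @^-1` Omega))).

Definition Lp p Omega : set ('rV[C]_n -> C) :=
  [set f : 'rV[C]_n -> C | let U := of_real_coord @^-1` Omega in
    [/\ measurable_fun U (@complex.Re R \o f \o of_real_coord : _ -> M),
        measurable_fun U (@complex.Im R \o f \o of_real_coord : _ -> M) &
        (Lp_norm p Omega f < +oo)%E]].

Definition holomorphic Omega f := forall z, Omega z -> differentiable f z.

Definition bergman p Omega : set ('rV[C]_n -> C) :=
  Lp p Omega `&` holomorphic Omega.

Definition bergman_norm p Omega f : R := fine (Lp_norm p Omega f).

Definition min_norm p Omega z : R :=
  inf [set bergman_norm p Omega f
      | f in bergman p Omega `&` [set f : 'rV[C]_n -> C | f z = 1]].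

(* The value [minimizer p Omega z x] is m_p(x, z). The minimizer exists and is
   unique as a function on Omega; its values outside Omega are irrelevant. *)
Definition minimizer p Omega z : 'rV[C]_n -> C :=
  xget (fun=> 0) [set f : 'rV[C]_n -> C |
    [/\ bergman p Omega f, f z = 1 &
        bergman_norm p Omega f = min_norm p Omega z]].

Definition normalized_minimizer p Omega z : 'rV[C]_n -> C :=
  fun x => minimizer p Omega z x / (min_norm p Omega z)%:C.

(* The minimum over t of the L^p distances, written as an infimum: the norm is
   continuous in t, so it is attained on [0, 2 pi]. *)
Definition skwarczynski_dist p Omega z w : R :=
  inf [set bergman_norm p Omega (fun x =>
             (cos t +i* sin t) * normalized_minimizer p Omega z x
             - normalized_minimizer p Omega w x)
      | t in `[0, 2 * pi]].

Definition skwarczynski_cauchy p Omega (u : nat -> 'rV[C]_n) :=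
  forall e : R, 0 < e -> exists N, forall j k, (N <= j)%N -> (N <= k)%N ->
    skwarczynski_dist p Omega (u j) (u k) < e.

Definition skwarczynski_complete p Omega :=
  forall u : nat -> 'rV[C]_n, (forall k, Omega (u k)) ->
    skwarczynski_cauchy p Omega u ->
    exists2 w, Omega w & skwarczynski_dist p Omega (u k) w @[k --> \oo] --> 0.

End skwarczynski.

(* Main.v *)
Require Import Defs.
From HB Require Import structures.
From mathcomp Require Import all_boot all_order all_algebra.
From mathcomp Require Import all_classical all_reals all_analysis.
From mathcomp Require Import measurable_realfun.
From mathcomp Require Import complex ring lra.

Set Implicit Arguments.
Unset Strict Implicit.
Unset Printing Implicit Defensive.

Import Order.TTheory GRing.Theory Num.Theory.
Import numFieldNormedType.Exports.

Local Open Scope classical_set_scope.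
Local Open Scope complex_scope.
Local Open Scope ring_scope.

(* Write F_w = m_p(., w) / m_p(w), a unit vector of the Bergman space. Evaluation
   at a point is bounded on the Bergman space, locally uniformly, so Montel's
   theorem and Fatou's lemma provide minimizers. Two minimizers f, g for the same
   point satisfy |f + g| = |f| + |g|, since their half-sum is also admissible; so
   f / g is real wherever g does not vanish, hence constant, and f = g.

   Let u be a Cauchy sequence. If u has no cluster point in Omega, then F_(u k)
   tends to 0 pointwise; for some N and unimodular c_k the functions
   c_k F_(u k) - F_(u N), k >= N, have norm less than 1/2 and tend pointwise to
   - F_(u N), which has norm 1, contradicting Fatou's lemma. Otherwise a
   subsequence converges to some w in Omega. Any locally uniform limit G of the
   corresponding F_(u k) has norm at most 1 and G w >= 1 / m_p(w), so G = F_w by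
   uniqueness; as the norms agree, the convergence holds in L^p by Riesz's
   theorem, and the Cauchy property carries it over to the whole sequence. *)

(** * Real-valued norms over C and complex differentiability *)

(** All estimates come from one complex variable. Restriction to complex lines reduces a function on
    C^n to one on a disc; there Goursat's theorem, applied on a rectangle whose coordinates are
    log-radius and angle, gives the mean value property, and from it follow a Cauchy estimate for
    the first derivative and the propagation of zeros. Complex integrals are bounded through real
    and imaginary parts, so the constants are far from sharp; what matters is that they do not
    depend on the function. For p = 1 the norm is not strictly convex, so uniqueness of minimizers
    has to come from holomorphy and not from the geometry of L^p. The inequality G w >= 1 / m_p(w)
    expresses semicontinuity of the minimal norm: if F is the minimizer at w, then F / F(v) is
    admissible at v whenever F(v) is nonzero, so m_p(v) <= m_p(w) / |F(v)|, and F(v) tends to 1 as v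
    tends to w. No phases occur in this limit because F_v(v) is positive; they enter only through
    the Cauchy condition. *)

Section cnorm.
Context {R : realType}.
Local Notation C := R[i].

(** Over [R[i]] the library norm is itself a complex number. Its real part moves all estimates into
    the ordered field [R], where suprema and [lra] are available. *)
Definition cnorm {V : normedModType C} (x : V) : R := complex.Re `|x|.

Lemma cnormE (V : normedModType C) (x : V) : (cnorm x)%:C = `|x|.
Proof. by rewrite /cnorm RRe_real ?ger0_real ?normr_ge0. Qed.

Lemma cnorm_ge0 (V : normedModType C) (x : V) : 0 <= cnorm x.
Proof. by rewrite -ler0c cnormE normr_ge0. Qed.

Lemma cnormD (V : normedModType C) (x y : V) : cnorm (x + y) <= cnorm x + cnorm y.
Proof. by rewrite -lecR rmorphD/= !cnormE ler_normD. Qed.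

Lemma cnormN (V : normedModType C) (x : V) : cnorm (- x) = cnorm x.
Proof. by rewrite /cnorm normrN. Qed.

Lemma cnormB (V : normedModType C) (x y : V) : cnorm (x - y) <= cnorm x + cnorm y.
Proof. by rewrite -[cnorm y]cnormN cnormD. Qed.

Lemma cnorm_distC (V : normedModType C) (x y : V) : cnorm (x - y) = cnorm (y - x).
Proof. by rewrite -cnormN opprB. Qed.

Lemma cnorm_dist (V : normedModType C) (x y z : V) :
  cnorm (x - y) <= cnorm (x - z) + cnorm (z - y).
Proof. by rewrite (le_trans _ (cnormD _ _))// addrA subrK. Qed.

Lemma cnorm0 (V : normedModType C) : cnorm (0 : V) = 0.
Proof. by rewrite /cnorm normr0. Qed.

Lemma cnorm0_eq0 (V : normedModType C) (x : V) : cnorm x = 0 -> x = 0.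
Proof. by move=> h; apply/eqP; rewrite -normr_eq0 -cnormE h. Qed.

Lemma cnorm_gt0 (V : normedModType C) (x : V) : (0 < cnorm x) = (x != 0).
Proof. by rewrite -ltcR cnormE normr_gt0. Qed.

Lemma cnormZ (V : normedModType C) (a : C) (x : V) :
  cnorm (a *: x) = cnorm a * cnorm x.
Proof. by apply: complexI; rewrite rmorphM/= !cnormE normrZ. Qed.

Lemma cnormM (x y : C) : cnorm (x * y) = cnorm x * cnorm y.
Proof. exact: Normc.normcM. Qed.

Lemma cnormV (x : C) : cnorm x^-1 = (cnorm x)^-1.
Proof. exact: Normc.normcV. Qed.

Lemma cnormX (x : C) k : cnorm (x ^+ k) = cnorm x ^+ k.
Proof.
by elim: k => [|k ih]; [exact: Normc.normc1|rewrite !exprS cnormM ih].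
Qed.

Lemma cnorm_real (x : R) : cnorm x%:C = `|x|.
Proof. by rewrite /cnorm normc_def/= expr0n addr0 sqrtr_sqr. Qed.

Lemma cnorm1 : cnorm (1 : C) = 1.
Proof. exact: Normc.normc1. Qed.

Lemma cnormi : cnorm ('i%C : C) = 1.
Proof. by rewrite /cnorm normc_def/= expr0n add0r expr1n sqrtr1. Qed.

Lemma cnorm_Re (x : C) : `|complex.Re x| <= cnorm x.
Proof. by rewrite -lecR cnormE normc_ge_Re. Qed.

Lemma cnorm_Im (x : C) : `|complex.Im x| <= cnorm x.
Proof.
by rewrite /cnorm normc_def/= -sqrtr_sqr ler_wsqrtr// lerDr sqr_ge0.
Qed.

Lemma cnorm_ReIm (x : C) : cnorm x <= `|complex.Re x| + `|complex.Im x|.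
Proof.
rewrite {1}(complexE x) (le_trans (cnormD _ _))// cnormM cnormi mul1r.
by rewrite !cnorm_real.
Qed.

Lemma cnorm_nbhs (V : normedModType C) (x : V) (A : set V) :
  nbhs x A <-> exists2 e : R, 0 < e & forall y, cnorm (y - x) < e -> A y.
Proof.
split=> [/nbhs_normP[e /= e0 eA]|[e e0 eA]].
  exists (complex.Re e); first by move: e0; rewrite ltcE/= => /andP[].
  move=> y ye; apply: eA => /=; rewrite distrC -cnormE.
  by rewrite ltcE/= ye andbT; move: e0; rewrite ltcE/= => /andP[].
apply/nbhs_normP; exists e%:C => /=; first by rewrite ltcR.
by move=> y /=; rewrite distrC -cnormE ltcR; exact: eA.
Qed.

Lemma cnorm_open (V : normedModType C) (A : set V) x : open A -> A x ->
  exists2 e : R, 0 < e & forall y, cnorm (y - x) < e -> A y.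
Proof. by move=> oA Ax; apply/cnorm_nbhs; exact: open_nbhs_nbhs. Qed.

Lemma cnorm_continuous (V W : normedModType C) (f : V -> W) (x : V) :
  {for x, continuous f} <-> forall e : R, 0 < e ->
    exists2 d : R, 0 < d & forall y, cnorm (y - x) < d -> cnorm (f y - f x) < e.
Proof.
split=> [cf e e0|cf A /cnorm_nbhs[e e0 eA]].
  have /cf : nbhs (f x) [set y | cnorm (y - f x) < e] by apply/cnorm_nbhs; exists e.
  by move/cnorm_nbhs.
by have [d d0 dA] := cf _ e0; apply/cnorm_nbhs; exists d => // y /dA /eA.
Qed.

Lemma diff_cnorm (V W : normedModType C) (f : V -> W) (x : V) :
  differentiable f x -> forall e : R, 0 < e ->
  exists2 d : R, 0 < d & forall h, cnorm h < d ->
    cnorm (f (x + h) - f x - 'd f x h) <= e * cnorm h.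
Proof.
move=> df e e0.
have /eqaddoP/(_ e%:C) := diff_locally df; rewrite ltcR => /(_ e0).
move=> /cnorm_nbhs[d d0 dH]; exists d => // h hd.
have := dH h; rewrite subr0 => /(_ hd) /=.
rewrite -lecR rmorphM/= !cnormE.
rewrite -[X in `|X| <= _ -> _]/(f (h + x) - (f x + 'd f x h)).
by rewrite [h + x]addrC opprD addrA.
Qed.

(** The bound by [K] supplies the continuity of the linear map that a differential must have. *)
Lemma cnorm_diff (V W : normedModType C) (f : V -> W) (x : V)
    (L : {linear V -> W}) (K : R) :
  (forall h, cnorm (L h) <= K * cnorm h) ->
  (forall e : R, 0 < e -> exists2 d : R, 0 < d & forall h, cnorm h < d ->
    cnorm (f (x + h) - f x - L h) <= e * cnorm h) ->
  is_diff x f L.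
Proof.
move=> LK Lf.
have cL : continuous L.
  move=> y; apply/cnorm_continuous => e e0.
  exists (e / (`|K| + 1)) => [|z]; first by rewrite divr_gt0// ltr_wpDl.
  rewrite ltr_pdivlMr ?ltr_wpDl// => zy; rewrite -linearB (le_lt_trans (LK _))//.
  rewrite (le_lt_trans _ zy)// mulrC ler_wpM2l ?cnorm_ge0//.
  by rewrite (le_trans (ler_norm _))// lerDl.
have Lo : f \o shift x = cst (f x) + L +o_ (0 : V) id.
  apply/eqaddoP => e' e0.
  have ee : e' = (complex.Re e')%:C by rewrite RRe_real// gtr0_real.
  move: e0; rewrite ee ltcR => e0; have [d d0 dH] := Lf _ e0.
  apply/cnorm_nbhs; exists d => // h; rewrite subr0 => /dH.
  rewrite -lecR rmorphM/= !cnormE [x + h]addrC.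
  rewrite -[X in _ -> `|X| <= _]/(f (h + x) - (f x + L h)).
  by rewrite opprD addrA.
have dL := diff_unique cL Lo; apply: DiffDef => //.
by apply/diff_locallyP; rewrite dL.
Qed.

(** Differentiability depends only on the germ; this handles functions defined by cases or by
    division. *)
Lemma nbhs_diff (V W : normedModType C) (f g : V -> W) (x : V) :
  {near x, f =1 g} -> differentiable f x -> differentiable g x.
Proof.
move=> fg df; have fgx : f x = g x by exact: (nbhs_singleton fg).
apply/diff_locallyP.
have E : g \o shift x = cst (g x) + 'd f x +o_ (0 : V) id.
  apply/eqaddoP => e e0; have /eqaddoP/(_ e e0) := diff_locally df.
  move: fg => /cnorm_nbhs[r r0 rfg] /cnorm_nbhs[d d0 dH].
  apply/cnorm_nbhs; exists (Num.min r d) => [|h]; first by rewrite lt_min r0.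
  rewrite lt_min => /andP[hr hd]; move: (dH _ hd).
  rewrite -[X in `|X| <= _ -> _]/(f (h + x) - (f x + 'd f x h)).
  rewrite -[X in _ -> `|X| <= _]/(g (h + x) - (g x + 'd f x h)).
  by rewrite rfg ?fgx// addrK; rewrite subr0 in hr.
by have -> := diff_unique (diff_continuous df) E; split => //; exact: diff_continuous.
Qed.

End cnorm.

(** * Goursat's theorem and the mean value property *)

Section path_integral.
Context {R : realType}.
Local Notation C := R[i].
Local Notation mu := (@lebesgue_measure R).
Local Notation Re := (@complex.Re R).
Local Notation Im := (@complex.Im R).
Implicit Types (f g : R -> C) (a b c : R).

Definition cintegrable a b f :=
  mu.-integrable `[a, b] (EFin \o (Re \o f)) /\
  mu.-integrable `[a, b] (EFin \o (Im \o f)).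

(** An unoriented integral over a set, which vanishes for [b < a]; orientation is expressed by signs
    where paths are assembled. *)
Definition cint f a b : C :=
  (\int[mu]_(t in `[a, b]) Re (f t)) +i* (\int[mu]_(t in `[a, b]) Im (f t)).

Lemma cintegrable_continuous a b f :
  (forall t, t \in `[a, b]%R -> forall e, 0 < e -> exists2 d, 0 < d &
    forall s, `|s - t| < d -> cnorm (f s - f t) < e) -> cintegrable a b f.
Proof.
move=> cf; split; (apply: continuous_compact_integrable;
  [exact: segment_compact|apply: continuous_in_subspaceT => t /set_mem/= tab]);
  apply/cvgrPdist_lt => e e0; have [d d0 dH] := cf _ tab _ e0;
  (near=> s; rewrite distrC /= -raddfB/=; apply: le_lt_trans (dH s _)).
- exact: cnorm_Re.
- by rewrite distrC; near: s; apply/nbhs_normP; exists d => //= y.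
- exact: cnorm_Im.
- by rewrite distrC; near: s; apply/nbhs_normP; exists d => //= y.
Unshelve. all: by end_near. Qed.

Lemma eq_cint a b f g : (forall t, t \in `[a, b]%R -> f t = g t) ->
  cint f a b = cint g a b.
Proof.
by move=> fg; rewrite /cint; congr (_ +i* _); apply: eq_Rintegral => t /set_mem tab;
  rewrite fg.
Qed.

Lemma cintegrableB a b f g : cintegrable a b f -> cintegrable a b g ->
  cintegrable a b (fun t => f t - g t).
Proof.
move=> [rf jf] [rg jg]; split.
  rewrite (_ : _ \o _ = (EFin \o (Re \o f)) \- (EFin \o (Re \o g)))%E.
    exact: integrableB.
  by apply/funext => t /=; rewrite raddfB.
rewrite (_ : _ \o _ = (EFin \o (Im \o f)) \- (EFin \o (Im \o g)))%E.
  exact: integrableB.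
by apply/funext => t /=; rewrite raddfB.
Qed.

Lemma cintB a b f g : cintegrable a b f -> cintegrable a b g ->
  cint (fun t => f t - g t) a b = cint f a b - cint g a b.
Proof.
move=> [rf jf] [rg jg]; rewrite /cint.
under eq_Rintegral do rewrite raddfB/=.
rewrite RintegralB//; congr (_ +i* _).
by under eq_Rintegral do rewrite raddfB/=; rewrite RintegralB.
Qed.

Lemma Rintegral_itv_split a b c (f : R -> R) : a <= c -> c <= b ->
  mu.-integrable `[a, b] (EFin \o f) ->
  \int[mu]_(t in `[a, b]) f t =
  \int[mu]_(t in `[a, c]) f t + \int[mu]_(t in `[c, b]) f t.
Proof.
move=> ac cb fi; have E := @Rintegral_itvB R f (BLeft a) (BRight b) c fi ac cb.
apply/eqP; rewrite addrC -subr_eq E; apply/eqP/Rintegral_itv_obnd_cbnd.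
apply: integrableS fi => // x /=; rewrite !in_itv/= => /andP[cx ->].
by rewrite andbT; lra.
Qed.

Lemma cint_split a b c f : a <= c -> c <= b -> cintegrable a b f ->
  cint f a b = cint f a c + cint f c b.
Proof.
move=> ac cb [rf jf]; rewrite /cint (Rintegral_itv_split ac cb rf).
by rewrite (Rintegral_itv_split ac cb jf).
Qed.

Lemma Rintegral_bound a b (f : R -> R) M : a <= b ->
  mu.-integrable `[a, b] (EFin \o f) ->
  (forall t, t \in `[a, b]%R -> `|f t| <= M) ->
  `|\int[mu]_(t in `[a, b]) f t| <= M * (b - a).
Proof.
move=> ab fi fM; apply: le_trans (le_normr_Rintegral _ fi) _ => //.
have E : \int[mu]_(t in `[a, b]) M = M * (b - a).
  rewrite Rintegral_cst//= lebesgue_measure_itv/= lte_fin.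
  by case: ltP => //= ba; rewrite (_ : b - a = 0)//; lra.
rewrite -E; apply: le_Rintegral => //.
- by have := integrable_norm fi.
- apply: continuous_compact_integrable; first exact: segment_compact.
  by apply: continuous_subspaceT => x; exact: cst_continuous.
Qed.

(* The factor 2 comes from estimating real and imaginary parts separately. *)
Lemma cint_bound a b f M : a <= b -> cintegrable a b f ->
  (forall t, t \in `[a, b]%R -> cnorm (f t) <= M) ->
  cnorm (cint f a b) <= 2 * (M * (b - a)).
Proof.
move=> ab [rf jf] fM; rewrite (le_trans (cnorm_ReIm _))//= mulr_natl mulr2n.
apply: lerD; apply: Rintegral_bound => // t /fM; apply: le_trans.
  exact: cnorm_Re.
exact: cnorm_Im.
Qed.

Lemma cintegrable_lipschitz a b f K :
  (forall s t, cnorm (f s - f t) <= K * `|s - t|) -> cintegrable a b f.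
Proof.
move=> fK; apply: cintegrable_continuous => t _ e e0.
exists (e / (`|K| + 1)) => [|s]; first by rewrite divr_gt0// ltr_wpDl.
rewrite ltr_pdivlMr ?ltr_wpDl// => st; apply: le_lt_trans (fK _ _) _.
apply: le_lt_trans st; rewrite mulrC ler_wpM2l// (le_trans (ler_norm _))//.
by rewrite lerDl.
Qed.

Lemma Rintegral_affine (p q : R) a b : a <= b ->
  \int[mu]_(t in `[a, b]) (p + q * t) = p * (b - a) + q * ((b ^+ 2 - a ^+ 2) / 2).
Proof.
rewrite le_eqVlt => /predU1P[<-|ab].
  by rewrite set_itv1 Rintegral_set1 !subrr; lra.
pose F x := p * x + q / 2 * x ^+ 2.
have dF (x : R) : is_derive x (1 : R) F (p + q * x).
  rewrite /F; apply: is_derive_eq; rewrite /GRing.scale/=.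
  by field.
rewrite /Rintegral (@continuous_FTC2 _ _ F)//=; first by rewrite /F; field.
- apply: continuous_subspaceT => x.
  by apply: cvgD; [exact: cvg_cst|apply: cvgM; [exact: cvg_cst|exact: cvg_id]].
- have cF x : F y @[y --> x] --> F x.
    by apply: differentiable_continuous; apply/derivable1_diffP; case: (dF x).
  split; [by move=> x _; case: (dF x)| |]; exact/cvg_at_right_filter/cF || exact/cvg_at_left_filter/cF.
- by move=> x _; rewrite derive1E; case: (dF x).
Qed.

Lemma cint_affine (p q : C) a b : a <= b ->
  cint (fun t => p + q * t%:C) a b =
  p * (b - a)%:C + q * ((b ^+ 2 - a ^+ 2) / 2)%:C.
Proof.
move=> ab; rewrite /cint; case: p q => [p1 p2] [q1 q2].
transitivity ((\int[mu]_(t in `[a, b]) (p1 + q1 * t)) +i*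
              (\int[mu]_(t in `[a, b]) (p2 + q2 * t))).
  by congr (_ +i* _); apply: eq_Rintegral => t _ /=; lra.
rewrite !Rintegral_affine//.
by apply/eqP; rewrite eq_complex/=; apply/andP; split; apply/eqP; lra.
Qed.

End path_integral.

(** * Goursat's theorem for rectangles *)

Section goursat.
Context {R : realType}.
Local Notation C := R[i].
Implicit Types (g : C -> C) (x y h k : R).

(** The counterclockwise contour integral of [g]; ['i%C] is the velocity along the vertical
    sides. *)
Definition rectangle_integral g x1 x2 y1 y2 : C :=
  cint (fun t => g (t +i* y1)) x1 x2 - cint (fun t => g (t +i* y2)) x1 x2 +
  'i%C * (cint (fun t => g (x2 +i* t)) y1 y2 - cint (fun t => g (x1 +i* t)) y1 y2).

Definition in_rectangle x1 x2 y1 y2 (s : C) :=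
  x1 <= complex.Re s <= x2 /\ y1 <= complex.Im s <= y2.

Lemma cintegrable_path g (p : R -> C) a b :
  (forall s t, cnorm (p s - p t) <= `|s - t|) ->
  (forall t, t \in `[a, b]%R -> {for p t, continuous g}) ->
  cintegrable a b (g \o p).
Proof.
move=> p1 gc; apply: cintegrable_continuous => t tab e e0.
have [d d0 dH] := (cnorm_continuous _ _).1 (gc _ tab) _ e0.
by exists d => // s sd; apply: dH; apply: le_lt_trans sd.
Qed.

Lemma cintegrable_horizontal g y a b :
  (forall t, t \in `[a, b]%R -> {for t +i* y, continuous g}) ->
  cintegrable a b (fun t => g (t +i* y)).
Proof.
apply: cintegrable_path => s t.
by rewrite (_ : _ - _ = (s - t)%:C) ?cnorm_real// /GRing.add/= /GRing.opp/= subrr.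
Qed.

Lemma cintegrable_vertical g x a b :
  (forall t, t \in `[a, b]%R -> {for x +i* t, continuous g}) ->
  cintegrable a b (fun t => g (x +i* t)).
Proof.
apply: (@cintegrable_path g (fun t => x +i* t)) => s t.
rewrite (_ : _ - _ = 'i%C * (s - t)%:C); last by simpc.
by rewrite cnormM cnormi mul1r cnorm_real.
Qed.

Section fixed_rectangle.
Variables (g : C -> C) (x1 x2 y1 y2 : R).
Hypothesis gc : forall s, in_rectangle x1 x2 y1 y2 s -> {for s, continuous g}.

Lemma rectangle_cintegrable_h a b y : x1 <= a -> b <= x2 -> y1 <= y <= y2 ->
  cintegrable a b (fun t => g (t +i* y)).
Proof.
move=> xa bx y12; apply: cintegrable_horizontal => t.
by rewrite in_itv/= => /andP[at_ tb]; apply: gc; split => //=; apply/andP; split; lra.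
Qed.

Lemma rectangle_cintegrable_v a b x : y1 <= a -> b <= y2 -> x1 <= x <= x2 ->
  cintegrable a b (fun t => g (x +i* t)).
Proof.
move=> xa bx y12; apply: cintegrable_vertical => t.
by rewrite in_itv/= => /andP[at_ tb]; apply: gc; split => //=; apply/andP; split; lra.
Qed.

Lemma rectangle_integral_split_h c : x1 <= c <= x2 -> y1 <= y2 ->
  rectangle_integral g x1 x2 y1 y2 =
  rectangle_integral g x1 c y1 y2 + rectangle_integral g c x2 y1 y2.
Proof.
move=> /andP[xc cx] y12; rewrite /rectangle_integral.
rewrite (@cint_split _ x1 x2 c (fun t => g (t +i* y1)))//; last first.
  by apply: rectangle_cintegrable_h; rewrite ?lexx.
rewrite (@cint_split _ x1 x2 c (fun t => g (t +i* y2)))//; last first.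
  by apply: rectangle_cintegrable_h; rewrite ?lexx ?andbT.
ring.
Qed.

Lemma rectangle_integral_split_v c : y1 <= c <= y2 -> x1 <= x2 ->
  rectangle_integral g x1 x2 y1 y2 =
  rectangle_integral g x1 x2 y1 c + rectangle_integral g x1 x2 c y2.
Proof.
move=> /andP[xc cx] y12; rewrite /rectangle_integral.
rewrite (@cint_split _ y1 y2 c (fun t => g (x1 +i* t)))//; last first.
  by apply: rectangle_cintegrable_v; rewrite ?lexx.
rewrite (@cint_split _ y1 y2 c (fun t => g (x2 +i* t)))//; last first.
  by apply: rectangle_cintegrable_v; rewrite ?lexx ?andbT.
ring.
Qed.

Lemma rectangle_integral_bound M : x1 <= x2 -> y1 <= y2 ->
  (forall s, in_rectangle x1 x2 y1 y2 s -> cnorm (g s) <= M) ->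
  cnorm (rectangle_integral g x1 x2 y1 y2) <= 4 * M * (x2 - x1 + (y2 - y1)).
Proof.
move=> x12 y12 gM; rewrite /rectangle_integral.
have ny y : y1 <= y <= y2 ->
    cnorm (cint (fun t => g (t +i* y)) x1 x2) <= 2 * (M * (x2 - x1)).
  by move=> yy; apply: cint_bound => // [|t]; [exact: rectangle_cintegrable_h|
    rewrite in_itv/= => tt; exact: gM].
have nx x : x1 <= x <= x2 ->
    cnorm (cint (fun t => g (x +i* t)) y1 y2) <= 2 * (M * (y2 - y1)).
  by move=> xx; apply: cint_bound => // [|t]; [exact: rectangle_cintegrable_v|
    rewrite in_itv/= => tt; exact: gM].
have := ny y1; have := ny y2; have := nx x1; have := nx x2.
rewrite !lexx x12 y12 => /(_ erefl) a1 /(_ erefl) a2 /(_ erefl) a3 /(_ erefl) a4.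
rewrite (le_trans (cnormD _ _))// cnormM cnormi mul1r.
have := cnormB (cint (fun t => g (t +i* y1)) x1 x2) (cint (fun t => g (t +i* y2)) x1 x2).
have := cnormB (cint (fun t => g (x2 +i* t)) y1 y2) (cint (fun t => g (x1 +i* t)) y1 y2).
lra.
Qed.

End fixed_rectangle.

Lemma rectangle_integral_affine (p q : C) x1 x2 y1 y2 : x1 <= x2 -> y1 <= y2 ->
  rectangle_integral (fun s => p + q * s) x1 x2 y1 y2 = 0.
Proof.
move=> x12 y12; rewrite /rectangle_integral.
have H y : cint (fun t => p + q * (t +i* y)) x1 x2 =
    cint (fun t => (p + q * ('i%C * y%:C)) + q * t%:C) x1 x2.
  apply: eq_cint => t _; have -> : t +i* y = t%:C + 'i%C * y%:C by exact: complexE.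
  ring.
have V x : cint (fun t => p + q * (x +i* t)) y1 y2 =
    cint (fun t => (p + q * x%:C) + (q * 'i%C) * t%:C) y1 y2.
  apply: eq_cint => t _; have -> : x +i* t = x%:C + 'i%C * t%:C by exact: complexE.
  ring.
rewrite !H !V !cint_affine// !rmorphB/=.
have ii : 'i%C * 'i%C = -1 :> C by rewrite -expr2 sqr_i.
ring: ii.
Qed.

Lemma diff_scalar g (s h : C) : 'd g s h = 'd g s 1 * h.
Proof.
by rewrite -[h in LHS]mulr1 -[LHS]/('d g s (h *: (1 : C))) linearZ/= mulrC.
Qed.

(** Subtracting the first-order approximation at [z] does not change the integral, as affine
    functions integrate to 0. The remainder is at most [e] times the half-perimeter, and integrating
    it contributes the half-perimeter once more. *)
Lemma goursat_local g (z : C) (e : R) : 0 < e -> differentiable g z ->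
  exists2 d, 0 < d & forall x1 x2 y1 y2, x1 <= x2 -> y1 <= y2 ->
    in_rectangle x1 x2 y1 y2 z ->
    (forall s, in_rectangle x1 x2 y1 y2 s -> {for s, continuous g}) ->
    x2 - x1 + (y2 - y1) < d ->
    cnorm (rectangle_integral g x1 x2 y1 y2) <=
      4 * e * (x2 - x1 + (y2 - y1)) ^+ 2.
Proof.
move=> e0 dg; have [d d0 dH] := diff_cnorm dg e0.
exists d => // x1 x2 y1 y2 x12 y12 [z1 z2] gc small.
set D := _ + _ in small *.
pose c := 'd g z 1; pose A s := (g z - c * z) + c * s; pose B s := g s - A s.
have Ac s : {for s, continuous A}.
  apply: differentiable_continuous.
  apply: differentiableD; first exact: differentiable_cst.
  by apply: differentiableM; [exact: differentiable_cst|exact: ex_diff].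
have gAc s : in_rectangle x1 x2 y1 y2 s -> {for s, continuous B}.
  by move=> sin; apply: (@continuousB _ _ _ g A); [exact: gc|exact: Ac].
have -> : rectangle_integral g x1 x2 y1 y2 = rectangle_integral B x1 x2 y1 y2.
  have xx1 : x1 <= x1 <= x2 by rewrite lexx.
  have xx2 : x1 <= x2 <= x2 by rewrite lexx andbT.
  have yy1 : y1 <= y1 <= y2 by rewrite lexx.
  have yy2 : y1 <= y2 <= y2 by rewrite lexx andbT.
  rewrite -[RHS]addr0 -(rectangle_integral_affine (g z - c * z) c x12 y12) -/A.
  have H y : y1 <= y <= y2 -> cint (fun t => B (t +i* y)) x1 x2 =
      cint (fun t => g (t +i* y)) x1 x2 - cint (fun t => A (t +i* y)) x1 x2.
    move=> yy; apply: (@cintB _ _ _ (fun t => g (t +i* y)) (fun t => A (t +i* y))).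
      by apply: (rectangle_cintegrable_h gc).
    by apply: (@rectangle_cintegrable_h A x1 x2 y1 y2 (fun s _ => Ac s)).
  have V x : x1 <= x <= x2 -> cint (fun t => B (x +i* t)) y1 y2 =
      cint (fun t => g (x +i* t)) y1 y2 - cint (fun t => A (x +i* t)) y1 y2.
    move=> yy; apply: (@cintB _ _ _ (fun t => g (x +i* t)) (fun t => A (x +i* t))).
      by apply: (rectangle_cintegrable_v gc).
    by apply: (@rectangle_cintegrable_v A x1 x2 y1 y2 (fun s _ => Ac s)).
  rewrite /rectangle_integral !H// !V//.
  rewrite -/(A _); ring.
rewrite expr2 mulrA -(mulrA 4 e D); apply: rectangle_integral_bound => // s [s1 s2].
have szD : cnorm (s - z) <= D.
  rewrite (le_trans (cnorm_ReIm _))//= !raddfB/= /D lerD// ler_norml;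
  apply/andP; split; lra.
have := dH (s - z) (le_lt_trans szD small).
rewrite (addrC z) subrK diff_scalar -/c => h.
rewrite (_ : B s = g s - g z - c * (s - z)); last first.
  by rewrite /B /A; ring.
by rewrite (le_trans h)// ler_wpM2l// ltW.
Qed.

(** The four quarter integrals add up to the whole one, so one of them has at least a quarter of its
    modulus. *)
Lemma rectangle_integral_quarter g x y h k : 0 <= h -> 0 <= k ->
  (forall s, in_rectangle x (x + h + h) y (y + k + k) s -> {for s, continuous g}) ->
  exists q : R * R, [/\ x <= q.1 <= x + h, y <= q.2 <= y + k &
    cnorm (rectangle_integral g x (x + h + h) y (y + k + k)) <=
    4 * cnorm (rectangle_integral g q.1 (q.1 + h) q.2 (q.2 + k))].
Proof.
move=> h0 k0 gc; pose ri q : C := rectangle_integral g q.1 (q.1 + h) q.2 (q.2 + k).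
have gc1 s : in_rectangle x (x + h + h) y (y + k) s -> {for s, continuous g}.
  by move=> [s1 s2]; apply: gc; split => //; clear -s2 k0; apply/andP; split; lra.
have gc2 s : in_rectangle x (x + h + h) (y + k) (y + k + k) s -> {for s, continuous g}.
  by move=> [s1 s2]; apply: gc; split => //; clear -s2 k0; apply/andP; split; lra.
have riE : rectangle_integral g x (x + h + h) y (y + k + k) =
    ri (x, y) + ri (x + h, y) + (ri (x, y + k) + ri (x + h, y + k)).
  rewrite (@rectangle_integral_split_v _ _ _ _ _ gc (y + k)) ?lerDl ?h0 ?k0 ?andbT//;
    last by rewrite -addrA lerDl addr_ge0.
  by rewrite (@rectangle_integral_split_h _ _ _ _ _ gc1 (x + h)) ?lerDl ?h0 ?k0//
    (@rectangle_integral_split_h _ _ _ _ _ gc2 (x + h)) ?lerDl ?h0 ?k0.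
rewrite riE.
have : cnorm (ri (x, y) + ri (x + h, y) + (ri (x, y + k) + ri (x + h, y + k))) <=
    cnorm (ri (x, y)) + cnorm (ri (x + h, y)) +
    (cnorm (ri (x, y + k)) + cnorm (ri (x + h, y + k))).
  by rewrite (le_trans (cnormD _ _))// lerD ?cnormD.
have xx : x <= x <= x + h by rewrite lexx lerDl.
have xh : x <= x + h <= x + h by rewrite lexx lerDl h0.
have yy : y <= y <= y + k by rewrite lexx lerDl.
have yk : y <= y + k <= y + k by rewrite lexx lerDl k0.
move: (cnorm (ri (x, y) + _ + _)) => S.
have max4 (a b c d : R) : S <= a + b + (c + d) ->
    [\/ S <= 4 * a, S <= 4 * b, S <= 4 * c | S <= 4 * d].
  move=> H; have [?|i1] := leP S (4 * a); first by constructor 1.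
  have [?|i2] := leP S (4 * b); first by constructor 2.
  have [?|i3] := leP S (4 * c); first by constructor 3.
  by constructor 4; clear -H i1 i2 i3; lra.
by move=> /max4[] HS; [exists (x, y)|exists (x + h, y)|exists (x, y + k)|
  exists (x + h, y + k)].
Qed.

Lemma halve_half (a : R) n : a / 2 ^+ n = a / 2 ^+ n.+1 + a / 2 ^+ n.+1.
Proof. by rewrite exprSr invfM !mulrA -splitr. Qed.

(** Dependent choice followed by the nested interval principle in both coordinates. [P] is left
    abstract so that the selection criterion plays no part in the limit argument. *)
Lemma nested_quarters (P : nat -> R * R -> Prop) (p0 : R * R) h k :
  0 <= h -> 0 <= k -> P 0 p0 ->
  (forall n p, P n p -> exists q, [/\ P n.+1 q,
    p.1 <= q.1 <= p.1 + h / 2 ^+ n.+1 & p.2 <= q.2 <= p.2 + k / 2 ^+ n.+1]) ->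
  exists XY : R * R, forall n, exists p, [/\ P n p,
    p.1 <= XY.1 <= p.1 + h / 2 ^+ n & p.2 <= XY.2 <= p.2 + k / 2 ^+ n].
Proof.
move=> h0 k0 P0 step.
have hn0 n : 0 <= h / 2 ^+ n by rewrite divr_ge0// exprn_ge0.
have kn0 n : 0 <= k / 2 ^+ n by rewrite divr_ge0// exprn_ge0.
(* Moving [P] into the conclusion makes the step total on pairs, the form that [choice] accepts. *)
have {}step (np : nat * (R * R)) : exists q : R * R, P np.1 np.2 ->
    [/\ P np.1.+1 q, np.2.1 <= q.1 <= np.2.1 + h / 2 ^+ np.1.+1
     & np.2.2 <= q.2 <= np.2.2 + k / 2 ^+ np.1.+1].
  have [/step[q qP]|nP] := pselect (P np.1 np.2); first by exists q.
  by exists 0 => /nP.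
have [F FP] := choice step.
pose u := fix u n := if n is n'.+1 then F (n', u n') else p0.
have uP n : P n (u n).
  by elim: n => [//|n ih]; have [] := FP (n, u n) ih.
have uQ n : [/\ (u n).1 <= (u n.+1).1 <= (u n).1 + h / 2 ^+ n.+1
     & (u n).2 <= (u n.+1).2 <= (u n).2 + k / 2 ^+ n.+1].
  by have [] := FP (n, u n) (uP n).
move: u uP uQ => u uP uQ {F FP step P0}.
have mono n m : [/\ (u n).1 <= (u (n + m)%N).1,
    (u (n + m)%N).1 + h / 2 ^+ (n + m)%N <= (u n).1 + h / 2 ^+ n,
    (u n).2 <= (u (n + m)%N).2 &
    (u (n + m)%N).2 + k / 2 ^+ (n + m)%N <= (u n).2 + k / 2 ^+ n].
  elim: m => [|m [i1 i2 i3 i4]]; first by rewrite addn0.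
  rewrite addnS; have [/andP[j1 j2] /andP[j3 j4]] := uQ (n + m)%N.
  rewrite (halve_half h (n + m)) in i2; rewrite (halve_half k (n + m)) in i4.
  split.
  - exact: le_trans i1 j1.
  - by apply: le_trans i2; rewrite addrA lerD2r.
  - exact: le_trans i3 j3.
  - by apply: le_trans i4; rewrite addrA lerD2r.
have cross n m : (u n).1 <= (u m).1 + h / 2 ^+ m /\ (u n).2 <= (u m).2 + k / 2 ^+ m.
  have [nm|/ltnW mn] := leqP n m.
    have := mono n (m - n)%N; rewrite subnKC// => -[m1 _ m3 _].
    by split; [apply: le_trans m1 _|apply: le_trans m3 _]; rewrite lerDl.
  have := mono m (n - m)%N; rewrite subnKC// => -[_ m2 _ m4].
  by split; [apply: le_trans m2|apply: le_trans m4]; rewrite lerDl.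
exists (sup (range (fun n => (u n).1)), sup (range (fun n => (u n).2))) => n /=.
exists (u n); split => //; apply/andP; split.
- by apply: ub_le_sup; [exists ((u 0).1 + h / 2 ^+ 0) => _ [m _ <-]; case: (cross m 0)|
    exists n].
- by apply: ge_sup; [exists (u 0).1; exists 0|move=> _ [m _ <-]; case: (cross m n)].
- by apply: ub_le_sup; [exists ((u 0).2 + k / 2 ^+ 0) => _ [m _ <-]; case: (cross m 0)|
    exists n].
- by apply: ge_sup; [exists (u 0).2; exists 0|move=> _ [m _ <-]; case: (cross m n)].
Qed.

Theorem goursat g x1 x2 y1 y2 : x1 <= x2 -> y1 <= y2 ->
  (forall s, in_rectangle x1 x2 y1 y2 s -> differentiable g s) ->
  rectangle_integral g x1 x2 y1 y2 = 0.
Proof.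
move=> x12 y12 dg; apply: cnorm0_eq0; apply/eqP; rewrite eq_le cnorm_ge0 andbT.
rewrite leNgt; apply/negP => E0.
pose h := x2 - x1; pose k := y2 - y1.
have h0 : 0 <= h by rewrite subr_ge0.
have k0 : 0 <= k by rewrite subr_ge0.
have hn0 n : 0 <= h / 2 ^+ n by rewrite divr_ge0// exprn_ge0.
have kn0 n : 0 <= k / 2 ^+ n by rewrite divr_ge0// exprn_ge0.
have xh : x1 + h = x2 by rewrite /h addrC subrK.
have yk : y1 + k = y2 by rewrite /k addrC subrK.
move: E0; set E := cnorm _ => E0.
pose ri n (p : R * R) := cnorm (rectangle_integral g
  p.1 (p.1 + h / 2 ^+ n) p.2 (p.2 + k / 2 ^+ n)).
pose P n (p : R * R) := [/\ x1 <= p.1, p.1 + h / 2 ^+ n <= x2, y1 <= p.2,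
  p.2 + k / 2 ^+ n <= y2 & E <= 4 ^+ n * ri n p].
have P0 : P 0 (x1, y1).
  by rewrite /P /ri/= expr0 !divr1 xh yk mul1r; split; exact: lexx.
have sub (a b a1 a2 w wS : R) : a1 <= a -> a + w <= a2 -> w = wS + wS ->
    a <= b <= a + wS -> a1 <= b /\ b + wS <= a2 by clear => *; split; lra.
have [|[X Y]/= XY] := nested_quarters h0 k0 P0.
  move=> n [x y] [/= px1 px2 py1 py2 pE].
  have [|q [q1 q2 qE]] := @rectangle_integral_quarter g x y _ _ (hn0 n.+1) (kn0 n.+1).
    move=> s; rewrite -!addrA -!halve_half => -[s1 s2].
    apply: differentiable_continuous; apply: dg.
    by clear -px1 px2 py1 py2 s1 s2; split; apply/andP; split; lra.
  have [a1 a2] := sub _ _ _ _ _ _ px1 px2 (halve_half h n) q1.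
  have [b1 b2] := sub _ _ _ _ _ _ py1 py2 (halve_half k n) q2.
  exists q; split => //; split => //; rewrite (le_trans pE)//.
  rewrite exprSr -mulrA ler_pM2l ?exprn_gt0// /ri/=.
  by rewrite (halve_half h n) (halve_half k n) !addrA.
pose D := h + k.
(* With this [e] the local bound, rescaled by [4 ^+ n], is [E] times a factor below 1/2. The summand
   1 covers the degenerate case [D = 0]. *)
pose e := E / (8 * (D ^+ 2 + 1)).
have D1 : 0 < D ^+ 2 + 1 by rewrite ltr_wpDl// sqr_ge0.
have e0 : 0 < e by rewrite divr_gt0// mulr_gt0.
have dZ : differentiable g (X +i* Y).
  have [p [[a1 a2 a3 a4 _] bX bY]] := XY 0%N.
  by apply: dg; clear -a1 a2 a3 a4 bX bY; split => /=; apply/andP; split; lra.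
have [d d0 dH] := goursat_local e0 dZ.
have [n nd] : exists n, D / 2 ^+ n < d.
  exists (Num.bound (D / d)).
  by rewrite ltr_pdivrMr ?exprn_gt0// mulrC -ltr_pdivrMr// upper_nthrootP.
have [p [[p1 p2 p3 p4 pE] bX bY]] := XY n.
have DE : p.1 + h / 2 ^+ n - p.1 + (p.2 + k / 2 ^+ n - p.2) = D / 2 ^+ n.
  by rewrite /D; ring.
have H : ri n p <= 4 * e * (D / 2 ^+ n) ^+ 2.
  rewrite -DE; apply: dH; rewrite ?lerDl ?DE//.
  move=> s [s1 s2]; apply: differentiable_continuous; apply: dg.
  by clear -s1 s2 p1 p2 p3 p4; split; apply/andP; split; lra.
have : 4 ^+ n * ri n p <= 4 * e * D ^+ 2.
  have -> : 4 * e * D ^+ 2 = 4 ^+ n * (4 * e * (D / 2 ^+ n) ^+ 2).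
    rewrite expr_div_n -exprM mulnC exprM (_ : 2 ^+ 2 = 4 :> R); last by ring.
    by rewrite [RHS]mulrC -[RHS]mulrA divfK ?expf_neq0.
  by rewrite ler_pM2l// exprn_gt0.
move=> /(le_trans pE); rewrite leNgt => /negP; apply.
have -> : 4 * e * D ^+ 2 = E * (D ^+ 2 / (2 * (D ^+ 2 + 1))).
  by rewrite /e; field; rewrite gt_eqF.
rewrite gtr_pMr// ltr_pdivrMr ?mulr_gt0//; have := sqr_ge0 D; clear; lra.
Qed.

End goursat.

(** * The complex exponential, circle means and Cauchy's estimate *)

Section mean_value.
Context {R : realType}.
Local Notation C := R[i].
Implicit Types (f g : C -> C) (r : R).

Definition cis (t : R) : C := cos t +i* sin t.

Lemma cnorm_cis t : cnorm (cis t) = 1.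
Proof. by rewrite /cnorm normc_def/= cos2Dsin2 sqrtr1. Qed.

Definition cexp (s : C) : C := (expR (complex.Re s))%:C * cis (complex.Im s).

Lemma cexpD s t : cexp (s + t) = cexp s * cexp t.
Proof.
rewrite /cexp !raddfD/= expRD /cis sinD cosD.
by simpc; congr (_ +i* _); ring.
Qed.

Lemma cexp0 : cexp 0 = 1.
Proof. by rewrite /cexp /cis /= expR0 cos0 sin0 mul1r. Qed.

Lemma cnorm_cexp s : cnorm (cexp s) = expR (complex.Re s).
Proof. by rewrite cnormM cnorm_cis mulr1 cnorm_real ger0_norm ?expR_ge0. Qed.

Lemma is_derive_dist (f : R -> R) (x c : R) : is_derive x 1 f c ->
  forall e : R, 0 < e -> exists2 d : R, 0 < d & forall h, `|h| < d ->
    `|f (x + h) - f x - h * c| <= e * `|h|.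
Proof.
move=> [df dc] e e0; have /eqaddoP/(_ e e0) := derivable_nbhs df.
rewrite dc => /nbhs_normP[d /= d0 dH]; exists d => // h hd.
have := dH h; rewrite /ball_/= sub0r normrN => /(_ hd).
rewrite -[X in `|X| <= _ -> _]/(f (h *: 1 + x) - (f x + h *: c)).
by rewrite {1}/GRing.scale/= mulr1 [h + x]addrC opprD addrA.
Qed.

Lemma is_diff_cexp0 : is_diff 0 cexp (@idfun C).
Proof.
apply: (@cnorm_diff _ _ _ _ _ (@idfun C) 1) => [h|e e0]; first by rewrite mul1r.
(* The real part of the error costs 4 times [e1] and the imaginary part 5 times; [e1 <= 1] also
   gives [expR a - 1] the bound 2|a| and [sin b] the bound 2|b|. *)
pose e1 := Num.min (e / 9) 1.
have e10 : 0 < e1 by rewrite lt_min divr_gt0//=.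
have e11 : e1 <= 1 by rewrite ge_min lexx orbT.
have e1e : 9 * e1 <= e by rewrite mulrC -ler_pdivlMr// ge_min lexx.
clearbody e1.
have [d1 d10 D1] := is_derive_dist (is_derive_expR 0) e10.
have [d2 d20 D2] := is_derive_dist (is_derive_cos 0) e10.
have [d3 d30 D3] := is_derive_dist (is_derive_sin 0) e10.
exists (Num.min (Num.min d1 d2) (Num.min d3 e1)) => [|h].
  by rewrite !lt_min d10 d20 d30 e10.
rewrite !lt_min => /andP[/andP[h1 h2] /andP[h3 h4]].
have hr := cnorm_Re h; have hi := cnorm_Im h.
set a := complex.Re h in hr *; set b := complex.Im h in hi *.
have := D1 a (le_lt_trans hr h1); have := D2 b (le_lt_trans hi h2).
have := D3 b (le_lt_trans hi h3).
rewrite !add0r expR0 cos0 sin0 oppr0 mulr0 ?addr0 ?subr0 !mulr1 => S3 S2 S1.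
have hE : h = a +i* b by rewrite /a /b; case: (h).
rewrite cexp0 (_ : cexp h - 1 - idfun h =
    (expR a * cos b - 1 - a) +i* (expR a * sin b - b)); last first.
  by rewrite /cexp /cis -/a -/b [idfun h]hE; simpc; congr (_ +i* _); ring.
apply: le_trans (cnorm_ReIm _) _ => /=.
move: (cnorm h) hr hi h4 => N hr hi h4.
have N0 : 0 <= N by exact: le_trans hr.
have ea : `|expR a - 1| <= 2 * `|a|.
  rewrite (_ : expR a - 1 = (expR a - 1 - a) + a); last by ring.
  rewrite (le_trans (ler_normD _ _))// mulr_natl mulr2n lerD//.
  by rewrite (le_trans S1)// ler_piMl.
have sb : `|sin b| <= 2 * `|b|.
  rewrite (_ : sin b = (sin b - b) + b); last by ring.
  rewrite (le_trans (ler_normD _ _))// mulr_natl mulr2n lerD//.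
  by rewrite (le_trans S3)// ler_piMl.
have A1 : `|expR a * cos b - 1 - a| <= 4 * (e1 * N).
  rewrite (_ : _ - a = (expR a - 1 - a) + expR a * (cos b - 1)); last by ring.
  have E2 : expR a <= 3.
    have := ler_norm (expR a - 1); have : `|a| <= 1 by rewrite (le_trans hr)// ltW// (lt_le_trans h4).
    by clear -ea; lra.
  rewrite (le_trans (ler_normD _ _))// normrM.
  have -> : 4 * (e1 * N) = e1 * N + 3 * (e1 * N) by ring.
  apply: lerD; first by rewrite (le_trans S1)// ler_pM2l.
  rewrite (ger0_norm (expR_ge0 _)); apply: ler_pM; rewrite ?expR_ge0//.
  by rewrite (le_trans S2)// ler_pM2l.
have A2 : `|expR a * sin b - b| <= 5 * (e1 * N).
  rewrite (_ : _ - b = (expR a - 1) * sin b + (sin b - b)); last by ring.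
  rewrite (le_trans (ler_normD _ _))// normrM.
  have -> : 5 * (e1 * N) = (2 * e1) * (2 * N) + e1 * N by ring.
  apply: lerD; last by rewrite (le_trans S3)// ler_pM2l.
  apply: ler_pM => //.
    by rewrite (le_trans ea)// ler_pM2l// (le_trans hr)// ltW.
  by rewrite (le_trans sb)// ler_pM2l.
have : 9 * e1 * N <= e * N by rewrite ler_wpM2r.
by clear -A1 A2; lra.
Qed.

(** The functional equation transports differentiability from 0 to [s]. *)
Lemma differentiable_cexp s : differentiable cexp s.
Proof.
have -> : cexp = (fun t => cexp s * cexp (t - s)).
  by apply/funext => t; rewrite -cexpD addrC subrK.
apply: differentiableM; first exact: differentiable_cst.
apply: (@differentiable_comp _ _ _ _ (fun t => t - s) cexp).
  by apply: differentiableB; [exact: ex_diff|exact: differentiable_cst].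
by rewrite subrr; case: is_diff_cexp0.
Qed.

Lemma cexp_ln r t : 0 < r -> cexp (ln r +i* t) = r%:C * cis t.
Proof. by move=> r0; rewrite /cexp /= lnK// posrE. Qed.

Lemma cint_cst (c : C) (a b : R) : a <= b -> cint (fun=> c) a b = (b - a)%:C * c.
Proof.
move=> ab; rewrite (@eq_cint _ _ _ _ (fun t => c + 0 * t%:C)).
  by rewrite cint_affine// mul0r addr0 mulrC.
by move=> t _; rewrite mul0r addr0.
Qed.

Lemma cintegrable_circle g r : 0 < r ->
  (forall z, z != 0 -> cnorm z <= r -> differentiable g z) ->
  cintegrable 0 (2 * pi) (fun t => g (r%:C * cis t)).
Proof.
move=> r0 dg.
have -> : (fun t => g (r%:C * cis t)) = (fun t => (g \o cexp) (ln r +i* t)).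
  by apply/funext => t; rewrite /= cexp_ln.
apply: cintegrable_vertical => t _; apply: differentiable_continuous.
apply: differentiable_comp; first exact: differentiable_cexp.
have E : cnorm (cexp (ln r +i* t)) = r by rewrite cnorm_cexp/= lnK ?posrE.
by apply: dg; rewrite ?E// -cnorm_gt0 E.
Qed.

(** [cexp] maps a rectangle of height 2 pi onto the annulus. The horizontal sides cancel by
    periodicity, and what Goursat's theorem leaves are the two vertical sides, which are the circle
    integrals. The disc centre is never reached. *)
Lemma circle_integral_const g r r' : 0 < r' -> r' <= r ->
  (forall z, z != 0 -> cnorm z <= r -> differentiable g z) ->
  cint (fun t => g (r%:C * cis t)) 0 (2 * pi) =
  cint (fun t => g (r'%:C * cis t)) 0 (2 * pi).
Proof.
move=> r'0 r'r dg; have r0 : 0 < r by exact: lt_le_trans r'r.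
have pi0 : 0 <= 2 * pi :> R by rewrite mulr_ge0// pi_ge0.
have lr : ln r' <= ln r by rewrite ler_ln// posrE.
have gs : rectangle_integral (g \o cexp) (ln r') (ln r) 0 (2 * pi) = 0.
  apply: goursat => // s [/andP[_ s1] _].
  apply: differentiable_comp; first exact: differentiable_cexp.
  have E : cnorm (cexp s) <= r by rewrite cnorm_cexp -[leRHS]lnK ?posrE// ler_expR.
  by apply: dg; rewrite // -cnorm_gt0 cnorm_cexp expR_gt0.
move: gs; rewrite /rectangle_integral.
have -> : cint (fun t => (g \o cexp) (t +i* (2 * pi))) (ln r') (ln r) =
          cint (fun t => (g \o cexp) (t +i* 0)) (ln r') (ln r).
  apply: eq_cint => t _ /=; rewrite /cexp /cis /= mulr_natl.
  by rewrite cos2pi sin2pi cos0 sin0.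
rewrite subrr add0r => /eqP; rewrite mulf_eq0 => /orP[/eqP i0|].
  by move: (@cnormi R); rewrite i0 cnorm0 => /esym/eqP; rewrite oner_eq0.
rewrite subr_eq0 => /eqP E.
transitivity (cint (fun t => (g \o cexp) (ln r +i* t)) 0 (2 * pi)).
  by apply: eq_cint => t _; rewrite /= cexp_ln.
by rewrite E; apply: eq_cint => t _; rewrite /= cexp_ln.
Qed.

Theorem mean_value g r : 0 < r -> {for 0, continuous g} ->
  (forall z, z != 0 -> cnorm z <= r -> differentiable g z) ->
  cint (fun t => g (r%:C * cis t)) 0 (2 * pi) = (2 * pi)%:C * g 0.
Proof.
move=> r0 gc dg; apply/eqP; rewrite -subr_eq0; apply/eqP/cnorm0_eq0/eqP.
have pi0 : 0 < 2 * pi :> R by rewrite mulr_gt0// pi_gt0.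
rewrite eq_le cnorm_ge0 andbT; apply/ler_addgt0Pl => e e0; rewrite addr0.
(* The factor 2 of [cint_bound] times the length 2 pi of the interval; the radius is then shrunk
   until [g] is within [e'] of [g 0] on the circle. *)
pose e' := e / (4 * pi).
have e'0 : 0 < e' by rewrite divr_gt0// mulr_gt0// pi_gt0.
have [d d0 dH] := (cnorm_continuous _ _).1 gc _ e'0.
pose r' := Num.min r (d / 2).
have r'0 : 0 < r' by rewrite lt_min r0 divr_gt0.
have r'r : r' <= r by rewrite ge_min lexx.
rewrite (circle_integral_const r'0 r'r dg).
have -> : (2 * pi)%:C * g 0 = cint (fun=> g 0) 0 (2 * pi).
  by rewrite cint_cst ?subr0// ltW.
have i1 := @cintegrable_circle g r' r'0 (fun z z0 zr => dg z z0 (le_trans zr r'r)).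
have i2 : cintegrable 0 (2 * pi) (fun=> g 0).
  apply: (@cintegrable_lipschitz _ _ _ _ 0) => s t.
  by rewrite subrr cnorm0 mul0r.
rewrite -cintB//.
have -> : e = 2 * (e' * (2 * pi - 0)).
  have E (q : R) : q != 0 -> e = 2 * (e / (4 * q) * (2 * q - 0)) by move=> q0; field.
  by apply: E; rewrite gt_eqF// pi_gt0.
apply: cint_bound; [exact: ltW|exact: cintegrableB|].
move=> t _; apply/ltW/dH; rewrite subr0 cnormM cnorm_cis mulr1 cnorm_real.
rewrite gtr0_norm// (@le_lt_trans _ _ (d / 2))//; first by rewrite ge_min lexx orbT.
by rewrite ltr_pdivrMr// ltr_pMr//; lra.
Qed.

Lemma mean_value_bound g r M : 0 < r -> {for 0, continuous g} ->
  (forall z, z != 0 -> cnorm z <= r -> differentiable g z) ->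
  (forall z, cnorm z = r -> cnorm (g z) <= M) ->
  cnorm (g 0) <= 2 * M.
Proof.
move=> r0 gc dg gM; have pi0 : 0 < 2 * pi :> R by rewrite mulr_gt0// pi_gt0.
have := congr1 cnorm (mean_value r0 gc dg); rewrite cnormM cnorm_real gtr0_norm// => E.
rewrite -(ler_pM2l pi0) -E.
have -> : 2 * pi * (2 * M) = 2 * (M * (2 * pi - 0)) by ring.
apply: cint_bound; [exact: ltW|exact: cintegrable_circle|].
by move=> t _; apply: gM; rewrite cnormM cnorm_cis mulr1 cnorm_real gtr0_norm.
Qed.

(* The slope function [(f z - f 0) / z] is only needed to be continuous at 0,
   which is why the mean value property allows an exceptional centre. *)
Theorem cauchy_estimate f r M : 0 < r ->
  (forall z, cnorm z <= r -> differentiable f z) ->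
  (forall z, cnorm z <= r -> cnorm (f z) <= M) ->
  cnorm ('d f 0 1) <= 4 * M / r.
Proof.
move=> r0 df fM; set c := 'd f 0 1.
pose g z : C := if z == 0 then c else (f z - f 0) * z^-1.
have g0 : g 0 = c by rewrite /g eqxx.
have gE z : z != 0 -> g z = (f z - f 0) * z^-1 by rewrite /g => /negPf ->.
have d0 : differentiable f 0 by apply: df; rewrite cnorm0 ltW.
rewrite -g0 (_ : 4 * M / r = 2 * (2 * M / r)); last by ring.
apply: (mean_value_bound r0).
- apply/cnorm_continuous => e e0.
  have e20 : 0 < e / 2 by rewrite divr_gt0.
  have [d dd0 dH] := diff_cnorm d0 e20; exists d => // z; rewrite subr0 => zd.
  have [->|z0] := eqVneq z 0; first by rewrite subrr cnorm0.
  have := dH _ zd; rewrite add0r diff_scalar -/c g0 gE// => H.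
  have -> : (f z - f 0) * z^-1 - c = (f z - f 0 - c * z) * z^-1.
    by rewrite [RHS]mulrBl mulfK.
  rewrite cnormM cnormV (@le_lt_trans _ _ (e / 2))//.
    by rewrite ler_pdivrMr// cnorm_gt0.
  by rewrite ltr_pdivrMr// ltr_pMr//; lra.
- move=> z z0 zr; apply: (@nbhs_diff _ _ _ (fun z => (f z - f 0) * z^-1)).
    apply/cnorm_nbhs; exists (cnorm z) => [|y yz]; first by rewrite cnorm_gt0.
    rewrite gE//; apply/eqP => y0; move: yz.
    by rewrite y0 sub0r cnormN ltxx.
  apply: differentiableM.
    by apply: differentiableB; [exact: df|exact: differentiable_cst].
  exact: differentiable_Rinv.
- move=> z zr; have z0 : z != 0 by rewrite -cnorm_gt0 zr.
  rewrite gE// cnormM cnormV zr ler_pM2r ?invr_gt0// mulr_natl mulr2n.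
  rewrite (le_trans (cnormB _ _))// lerD//; apply: fM; first by rewrite zr.
  by rewrite cnorm0 ltW.
Qed.

End mean_value.

(** * Cauchy estimates in normed spaces *)

Section cauchy_estimates.
Context {R : realType} {V : normedModType R[i]}.
Local Notation C := R[i].
Implicit Types (f : V -> C) (x y z : V).

Lemma scaler_is_linear (W : lmodType C) (x : W) : linear ( *:%R^~ x : C -> W).
Proof. by move=> u y z; rewrite scalerDl scalerA. Qed.

Lemma is_diff_line z x (l : C) : is_diff l (fun l => z + l *: x) ( *:%R^~ x).
Proof.
pose L : {linear C -> V} := HB.pack ( *:%R^~ x : C -> V)
  (GRing.isLinear.Build _ _ _ _ _ (scaler_is_linear x)).
apply: (@cnorm_diff _ _ _ _ _ L (cnorm x)) => [h|e e0].
  by rewrite /= cnormZ mulrC.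
exists 1 => // h _; rewrite /= (_ : _ - _ = 0) ?cnorm0 ?mulr_ge0 ?cnorm_ge0 ?ltW//.
by rewrite scalerDl addrA [z + _ + _]addrC addrK subrr.
Qed.

Lemma is_diff_translate x y : is_diff y (fun y => y + x) (@idfun V).
Proof.
apply: (@cnorm_diff _ _ _ _ _ (@idfun V) 1) => [h|e e0]; first by rewrite mul1r.
exists 1 => // h _; rewrite /= (_ : _ - _ = 0) ?cnorm0 ?mulr_ge0 ?cnorm_ge0 ?ltW//.
by rewrite (addrAC y) [y + x + h]addrC addrK subrr.
Qed.

Lemma is_diff_comp_line f z x (l : C) : differentiable f (z + l *: x) ->
  is_diff l (fun l => f (z + l *: x)) (fun k => k * 'd f (z + l *: x) x).
Proof.
move=> df; have [dl dlE] := is_diff_line z x l.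
apply: DiffDef; first exact: (@differentiable_comp _ _ _ _ _ f l dl df).
rewrite (@diff_comp _ _ _ _ _ f l dl df) dlE; apply/funext => k /=.
by rewrite linearZ.
Qed.

Lemma is_diff_sub (f g df dg : V -> C) z : is_diff z f df -> is_diff z g dg ->
  is_diff z (fun y => f y - g y) (fun x => df x - dg x).
Proof. by move=> f' g'; exact: (is_diffB f' g'). Qed.

Lemma is_diff_unique (f df : V -> C) z x : is_diff z f df -> 'd f z x = df x.
Proof. by case=> _ E; exact: (congr1 (@^~ x) E). Qed.

Lemma is_diff_comp_translate f x z : differentiable f (z + x) ->
  is_diff z (fun y => f (y + x)) ('d f (z + x)).
Proof.
move=> df; have [dl dlE] := is_diff_translate x z.
apply: DiffDef; first exact: (@differentiable_comp _ _ _ _ _ f z dl df).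
by rewrite (@diff_comp _ _ _ _ _ f z dl df) dlE.
Qed.

(** Cauchy's estimate on the complex line through [z] in the direction [x]. The parameter disc of
    radius [r / (2 * cnorm x)] keeps the line inside the ball and doubles the constant 4. *)
Lemma is_diff_bound f df z r M : 0 < r -> is_diff z f df ->
  (forall y, cnorm (y - z) < r -> differentiable f y) ->
  (forall y, cnorm (y - z) < r -> cnorm (f y) <= M) ->
  forall x, cnorm (df x) <= 8 * M / r * cnorm x.
Proof.
move=> r0 fz df' fM x; rewrite -(is_diff_unique x fz) => {df fz}; rename df' into df.
have [->|x0] := eqVneq x 0.
  by rewrite linear0 !cnorm0 mulr0.
have nx0 : 0 < cnorm x by rewrite cnorm_gt0.
pose s := r / (2 * cnorm x); have s0 : 0 < s by rewrite divr_gt0// mulr_gt0.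
have small (l : C) : cnorm l <= s -> cnorm (z + l *: x - z) < r.
  rewrite addrC addKr cnormZ => ls; have h : cnorm l * cnorm x <= r / 2.
    rewrite -ler_pdivlMr// (le_trans ls)// /s le_eqVlt; apply/orP; left; apply/eqP.
    by field; rewrite gt_eqF.
  by rewrite (le_lt_trans h)// ltr_pdivrMr// ltr_pMr// ltr1n.
have dl (l : C) : cnorm l <= s -> is_diff l (fun l => f (z + l *: x))
    (fun k => k * 'd f (z + l *: x) x).
  by move=> /small/df; exact: is_diff_comp_line.
have := @cauchy_estimate _ (fun l => f (z + l *: x)) s M s0.
have d0 := dl 0; rewrite cnorm0 (ltW s0) in d0; have {}d0 := d0 erefl.
rewrite diff_val mul1r scale0r addr0.
have -> : 4 * M / s = 8 * M / r * cnorm x.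
  by rewrite /s; field; rewrite !gt_eqF.
by apply => l /[dup] /dl [? _] /small // /fM.
Qed.

Lemma dist_is_derive (g : R -> R) (x c : R) :
  (forall e, 0 < e -> exists2 d, 0 < d & forall h, `|h| < d ->
    `|g (x + h) - g x - h * c| <= e * `|h|) -> is_derive x (1 : R) g c.
Proof.
move=> gc.
have cv : h^-1 *: ((g \o shift x) (h *: (1 : R)) - g x) @[h --> 0^'] --> c.
  apply/cvgrPdist_le => e e0; have [d d0 dH] := gc _ e0.
  rewrite near_withinE; apply/nbhs_normP; exists d => //= h; rewrite /ball_/= sub0r normrN.
  move=> /dH hd h0; rewrite /GRing.scale/= mulr1 [h + x]addrC distrC.
  have -> : h^-1 * (g (x + h) - g x) - c = h^-1 * (g (x + h) - g x - h * c).
    by rewrite [RHS]mulrBr mulKf.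
  by rewrite normrM normfV mulrC ler_pdivrMr ?normr_gt0.
by apply: DeriveDef; [apply: cvgP cv|exact: cvg_lim cv].
Qed.

(** The mean value theorem applied separately to the real and imaginary parts along the segment,
    whence the 2. [D] is a parameter so that an explicit expression for the derivative can be
    used. *)
Lemma segment_bound f (D : V -> V -> C) z x K :
  (forall s : R, 0 <= s <= 1 -> is_diff (z + s%:C *: x) f (D (z + s%:C *: x))) ->
  (forall s : R, 0 <= s <= 1 -> cnorm (D (z + s%:C *: x) x) <= K) ->
  cnorm (f (z + x) - f z) <= 2 * K.
Proof.
move=> df dK; pose u (s : R) := f (z + s%:C *: x); pose v s := D (z + s%:C *: x) x.
have uE (s : R) : 0 <= s <= 1 -> forall e, 0 < e -> exists2 d, 0 < d &
    forall h, `|h| < d -> cnorm (u (s + h) - u s - h%:C * v s) <= e * `|h|.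
  move=> s01 e e0; have [dfs _] := df _ s01.
  have vE := is_diff_unique x (df _ s01).
  have [dl dE] := is_diff_comp_line dfs.
  have [d d0 dH] := diff_cnorm dl e0; exists d => // h hd.
  have := dH h%:C; rewrite cnorm_real => /(_ hd).
  by rewrite dE vE -rmorphD.
have der (P : {additive C -> R}) : (forall w, `|P w| <= cnorm w) ->
    (forall (a : R) w, P (a%:C * w) = a * P w) ->
    forall s, 0 <= s <= 1 -> is_derive (s : R) (1 : R) (fun t => P (u t) : R) (P (v s)).
  move=> Pn Ps s s01; apply: dist_is_derive => e e0.
  have [d d0 dH] := uE _ s01 _ e0; exists d => // h /dH.
  by apply: le_trans; rewrite -Ps -!raddfB; exact: Pn.
have bnd (P : {additive C -> R}) : (forall w, `|P w| <= cnorm w) ->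
    (forall (a : R) w, P (a%:C * w) = a * P w) -> `|P (f (z + x) - f z)| <= K.
  move=> Pn Ps; have dP := der P Pn Ps.
  have [||c] := @MVT_segment R (fun t => P (u t)) (fun s => P (v s)) 0 1 ler01.
  - by move=> s; rewrite in_itv/= => /andP[? ?]; apply: dP; rewrite !ltW.
  - apply: continuous_in_subspaceT => s /set_mem; rewrite /= in_itv/= => /dP[ds _].
    by apply: differentiable_continuous; exact/derivable1_diffP.
  rewrite in_itv/= => c01; rewrite subr0 mulr1 /u/= scale1r scale0r addr0 -raddfB => ->.
  by rewrite (le_trans (Pn _))// dK.
rewrite (le_trans (cnorm_ReIm _))// mulr_natl mulr2n lerD//.
  apply: (bnd (@complex.Re R)) => [w|a w]; first exact: cnorm_Re.
  by case: w => ? ? /=; rewrite mul0r subr0.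
apply: (bnd (@complex.Im R)) => [w|a w]; first exact: cnorm_Im.
by case: w => ? ? /=; rewrite mul0r addr0.
Qed.

Lemma ball_segment z a b r (s : R) : cnorm (a - z) < r -> cnorm (b - z) < r ->
  0 <= s <= 1 -> cnorm (a + s%:C *: (b - a) - z) < r.
Proof.
move=> ar br /andP[s0 s1].
rewrite (_ : _ - z = (1 - s)%:C *: (a - z) + s%:C *: (b - z)); last first.
  rewrite rmorphB/= rmorph1 scalerBl scale1r -[RHS]addrA [- (_ *: _) + _]addrC.
  by rewrite -scalerBr opprB addrA subrK addrAC.
rewrite (le_lt_trans (cnormD _ _))// !cnormZ !cnorm_real !ger0_norm ?subr_ge0//.
have [s00|s00] := eqVneq s 0; first by rewrite s00 subr0 mul1r mul0r addr0.
have sp : 0 < s by rewrite lt_neqAle eq_sym s00.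
have h1 : (1 - s) * cnorm (a - z) <= (1 - s) * r.
  by rewrite ler_wpM2l ?subr_ge0// ltW.
have h2 : s * cnorm (b - z) < s * r by rewrite ltr_pM2l.
by clear -h1 h2; lra.
Qed.

Section bounded_on_ball.
Variables (f : V -> C) (z : V) (r M : R).
Hypothesis (r0 : 0 < r) (df : forall y, cnorm (y - z) < r -> differentiable f y).
Hypothesis fM : forall y, cnorm (y - z) < r -> cnorm (f y) <= M.

Lemma ball_bound_ge0 : 0 <= M.
Proof. by apply: le_trans (fM (y := z) _); rewrite ?cnorm_ge0// subrr cnorm0. Qed.

(** Each point of the segment is the centre of a ball of radius [r / 2] on which [f] is bounded by
    [M]; the derivative bound 16 M / r is doubled by [segment_bound]. *)
Lemma cauchy_lipschitz a b : cnorm (a - z) < r / 2 -> cnorm (b - z) < r / 2 ->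
  cnorm (f b - f a) <= 32 * M / r * cnorm (b - a).
Proof.
move=> ar br; have rr : 0 < r / 2 by rewrite divr_gt0.
have far y w : cnorm (w - z) < r / 2 -> cnorm (y - w) < r / 2 -> cnorm (y - z) < r.
  move=> wz yw; rewrite (le_lt_trans (cnorm_dist _ _ w))// [ltRHS]splitr addrC.
  by rewrite ltrD.
have -> : 32 * M / r * cnorm (b - a) = 2 * (8 * M / (r / 2) * cnorm (b - a)).
  by move: (cnorm _) => N; field; rewrite gt_eqF.
have dfs (s : R) : 0 <= s <= 1 -> is_diff (a + s%:C *: (b - a)) f ('d f (a + s%:C *: (b - a))).
  move=> s01; apply: DiffDef => //; apply: df; apply: (@far _ (a + s%:C *: (b - a))).
    exact: ball_segment.
  by rewrite subrr cnorm0.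
rewrite -[in f b](subrK a b) [b - a + a]addrC.
apply: (@segment_bound f (fun y => 'd f y)) => // s s01.
apply: (is_diff_bound rr (dfs _ s01)) => y ys; [apply: df|apply: fM]; apply: far ys;
  exact: ball_segment.
Qed.

(** The difference of the two differentials is the differential at [z] of the increment
    [f (y + (a - z)) - f y], which [cauchy_lipschitz] makes small on a ball of radius [r / 4]; hence
    1024 = 8 * 32 * 4. *)
Lemma cauchy_diff_lipschitz a x : cnorm (a - z) < r / 4 ->
  cnorm ('d f a x - 'd f z x) <= 1024 * M / r ^+ 2 * cnorm (a - z) * cnorm x.
Proof.
move=> ar; have rr : 0 < r / 4 by rewrite divr_gt0.
have r42 : r / 4 + r / 4 = r / 2 by field.
have rr2 : r / 4 < r / 2 by rewrite -r42 ltrDl.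
have r2r : r / 2 < r by rewrite ltr_pdivrMr// ltr_pMr//; lra.
have near1 y : cnorm (y - z) < r / 4 -> cnorm (y + (a - z) - z) < r / 2.
  by move=> yz; rewrite addrAC (le_lt_trans (cnormD _ _))// -r42 ltrD.
have d1 y : cnorm (y - z) < r / 4 -> is_diff y (fun y => f (y + (a - z)))
    ('d f (y + (a - z))).
  move=> yz; apply: is_diff_comp_translate; apply: df.
  exact: lt_trans (near1 _ yz) r2r.
have d2 y : cnorm (y - z) < r / 4 -> differentiable f y.
  by move=> yz; apply: df; rewrite (lt_trans yz)// (lt_trans rr2).
have zz : cnorm (z - z) < r / 4 by rewrite subrr cnorm0.
have E := is_diff_sub (d1 _ zz) (differentiableP (d2 _ zz)).
have az : z + (a - z) = a by rewrite addrC subrK.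
rewrite az in E.
have -> : 1024 * M / r ^+ 2 * cnorm (a - z) * cnorm x =
    8 * (32 * M / r * cnorm (a - z)) / (r / 4) * cnorm x.
  by move: (cnorm _) (cnorm _) => N N'; field; rewrite gt_eqF.
apply: (is_diff_bound rr E) => y yz.
  by apply: differentiableB; [case: (d1 _ yz)|exact: d2].
rewrite (le_trans (@cauchy_lipschitz y (y + (a - z)) _ _))//.
- exact: lt_trans rr2.
- exact: near1.
- by rewrite (addrC y) addrK.
Qed.

(** The mean value bound for [f] minus its differential at [z], whose derivative is controlled by
    [cauchy_diff_lipschitz]. The constant depends only on [M] and [r], so the bound survives limits
    of sequences. *)
Lemma cauchy_taylor h : cnorm h < r / 4 ->
  cnorm (f (z + h) - f z - 'd f z h) <= 2048 * M / r ^+ 2 * cnorm h ^+ 2.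
Proof.
move=> hr; have M0 := ball_bound_ge0.
have d0 : differentiable f z by apply: df; rewrite subrr cnorm0.
have cL : continuous ('d f z) by exact: diff_continuous.
have dL y : is_diff y ('d f z) ('d f z).
  by apply: DiffDef; [exact: linear_differentiable|exact: diff_lin].
pose g y := f y - 'd f z y.
have -> : f (z + h) - f z - 'd f z h = g (z + h) - g z.
  by rewrite /g linearD/=; ring.
have -> : 2048 * M / r ^+ 2 * cnorm h ^+ 2 =
  2 * (1024 * M / r ^+ 2 * cnorm h * cnorm h) by ring.
have r4 : r / 4 < r by rewrite ltr_pdivrMr// ltr_pMr//; lra.
have near1 (s : R) : 0 <= s <= 1 -> cnorm (z + s%:C *: h - z) <= cnorm h.
  by move=> /andP[s0 s1]; rewrite addrC addKr cnormZ cnorm_real ger0_norm// ler_piMl ?cnorm_ge0.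
have dfs (s : R) : 0 <= s <= 1 -> differentiable f (z + s%:C *: h).
  by move=> s01; apply: df; rewrite (le_lt_trans (near1 _ s01))// (lt_trans hr).
apply: (@segment_bound g (fun y x => 'd f y x - 'd f z x)) => s s01.
  exact: is_diff_sub (differentiableP (dfs _ s01)) (dL _).
apply: le_trans (cauchy_diff_lipschitz _ _) _.
  exact: le_lt_trans (near1 _ s01) hr.
apply: ler_wpM2r; first exact: cnorm_ge0.
apply: ler_wpM2l; last exact: near1.
exact: divr_ge0 (mulr_ge0 (ler0n _ _) M0) (exprn_ge0 _ (ltW r0)).
Qed.

End bounded_on_ball.

End cauchy_estimates.

(** * Montel's theorem and the identity theorem *)

Section ultrafilter_limits.
Context {R : realType} (U : set_system nat).
Hypothesis UU : UltraFilter U.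
Local Notation C := R[i].

(* Along an ultrafilter every bounded sequence converges, so a limit function is
   defined at all points at once, before any subsequence has been extracted. *)
Definition ultra_lim {V : normedModType C} (a : nat -> V) (l : V) :=
  forall e : R, 0 < e -> U [set k | cnorm (a k - l) < e].

Lemma ultra_nonempty (A : set nat) : U A -> exists k, A k.
Proof. by move=> UA; have [k Ak] := filter_ex UA; exists k. Qed.

(** The limit is the supremum of the numbers that bound the sequence from below on a set of [U]; the
    ultrafilter dichotomy gives the upper estimate. *)
Lemma ultra_real_lim (a : nat -> R) M : (forall k, `|a k| <= M) ->
  exists l, forall e, 0 < e -> U [set k | `|a k - l| < e].
Proof.
move=> aM; pose S := [set x | U [set k | x <= a k]].
have S0 : S (- M).
  apply: filterS filterT => k _ /=.
  by have := aM k; rewrite ler_norml => /andP[].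
have Sub : ubound S M.
  move=> x /ultra_nonempty[k /= xk]; apply: (le_trans xk).
  by rewrite (le_trans (ler_norm _)).
exists (sup S) => e e0.
have h1 : U [set k | sup S - e < a k].
  have [x Sx xe] : exists2 x, S x & sup S - e < x.
    by apply: sup_adherent => //; split; [exists (- M)|exists M].
  by apply: filterS Sx => k /=; exact: lt_le_trans.
have h2 : U [set k | a k < sup S + e].
  have [|h] := in_ultra_setVsetC [set k | sup S + e <= a k] UU.
    move=> h; have : sup S + e <= sup S.
      by apply: ub_le_sup => //; exists M.
    by rewrite gerDl leNgt e0.
  by apply: filterS h => k /= /negP; rewrite -ltNge.
have h : U ([set k | sup S - e < a k] `&` [set k | a k < sup S + e]).
  exact: filterI.
apply: filterS h => k /= [a1 a2]; rewrite ltr_norml; apply/andP.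
by clear -a1 a2; split; lra.
Qed.

Lemma ultra_lim_ex (a : nat -> C) M : (forall k, cnorm (a k) <= M) ->
  exists l, ultra_lim a l.
Proof.
move=> aM.
have [|u uP] := @ultra_real_lim (fun k => complex.Re (a k)) M.
  by move=> k; exact: le_trans (cnorm_Re _) (aM k).
have [|v vP] := @ultra_real_lim (fun k => complex.Im (a k)) M.
  by move=> k; exact: le_trans (cnorm_Im _) (aM k).
exists (u +i* v) => e e0; have e20 : 0 < e / 2 by rewrite divr_gt0.
apply: filterS (filterI (uP _ e20) (vP _ e20)) => k /= [ku kv].
rewrite (le_lt_trans (cnorm_ReIm _))// [ltRHS]splitr.
by move: ku kv; case: (a k) => p q /=; exact: ltrD.
Qed.

Lemma ultra_limD (V : normedModType C) (a b : nat -> V) (l m : V) :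
  ultra_lim a l -> ultra_lim b m -> ultra_lim (fun k => a k + b k) (l + m).
Proof.
move=> al bm e e0; have e20 : 0 < e / 2 by rewrite divr_gt0.
apply: filterS (filterI (al _ e20) (bm _ e20)) => k /= [ka kb].
by rewrite opprD addrACA (le_lt_trans (cnormD _ _))// [ltRHS]splitr ltrD.
Qed.

Lemma ultra_limZ (V : normedModType C) (c : C) (a : nat -> V) (l : V) :
  ultra_lim a l -> ultra_lim (fun k => c *: a k) (c *: l).
Proof.
move=> al e e0; have c0 : 0 < cnorm c + 1 by rewrite ltr_wpDl ?cnorm_ge0.
have e20 : 0 < e / (cnorm c + 1) by rewrite divr_gt0.
apply: filterS (al _ e20) => k /=; rewrite ltr_pdivlMr// => h.
rewrite -scalerBr cnormZ (le_lt_trans _ h)// mulrC ler_wpM2l ?cnorm_ge0//.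
by rewrite lerDl.
Qed.

Lemma ultra_limB (V : normedModType C) (a b : nat -> V) (l m : V) :
  ultra_lim a l -> ultra_lim b m -> ultra_lim (fun k => a k - b k) (l - m).
Proof.
move=> al bm; have := ultra_limD al (ultra_limZ (-1) bm).
by rewrite scaleN1r; under [X in ultra_lim X]eq_fun do rewrite scaleN1r.
Qed.

Lemma ultra_lim_norm (V : normedModType C) (a : nat -> V) (l : V) M :
  (forall k, cnorm (a k) <= M) -> ultra_lim a l -> cnorm l <= M.
Proof.
move=> aM al; apply/ler_addgt0Pl => e /al/ultra_nonempty[k /= h].
have := cnorm_dist l 0 (a k); rewrite !subr0 => /le_trans; apply.
by rewrite cnorm_distC lerD// ltW.
Qed.

Lemma ultra_lim_unique (V : normedModType C) (a : nat -> V) (l m : V) :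
  ultra_lim a l -> ultra_lim a m -> l = m.
Proof.
move=> al am; apply/eqP; rewrite -subr_eq0; apply/eqP/cnorm0_eq0/eqP.
rewrite eq_le cnorm_ge0 andbT; apply: (@ultra_lim_norm _ (fun=> 0 : V)) => [k|].
  by rewrite cnorm0.
by have := ultra_limB al am; under [X in ultra_lim X]eq_fun do rewrite subrr.
Qed.

Lemma ultra_lim_eq (V : normedModType C) (a b : nat -> V) l :
  a =1 b -> ultra_lim a l -> ultra_lim b l.
Proof. by move=> /funext ->. Qed.

(** The differentials at [z] are uniformly bounded, so they too converge along [U], to a linear map;
    the uniform second-order bound of [cauchy_taylor] passes to the limit. Pointwise convergence
    thus suffices. *)
Lemma ultra_lim_diff (V : normedModType C) (f : nat -> V -> C) (F : V -> C)
    (z : V) (r M : R) : 0 < r ->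
  (forall k y, cnorm (y - z) < r -> differentiable (f k) y) ->
  (forall k y, cnorm (y - z) < r -> cnorm (f k y) <= M) ->
  (forall y, cnorm (y - z) < r -> ultra_lim (f ^~ y) (F y)) ->
  differentiable F z.
Proof.
move=> r0 df fM fF; have zz : cnorm (z - z) < r by rewrite subrr cnorm0.
have bnd k x : cnorm ('d (f k) z x) <= 8 * M / r * cnorm x.
  exact: (is_diff_bound r0 (differentiableP (df k z zz)) (df k) (fM k)).
have [L LP] := choice (fun x => ultra_lim_ex (bnd^~ x)).
have Llin : linear L.
  move=> c x y; have := ultra_limD (ultra_limZ c (LP x)) (LP y).
  apply: ultra_lim_unique; apply: ultra_lim_eq (LP _) => k.
  exact: linearP.
pose L' : {linear V -> C} := HB.pack L (GRing.isLinear.Build _ _ _ _ _ Llin).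
suff [] : is_diff z F L' by [].
apply: (@cnorm_diff _ _ _ _ _ _ (8 * M / r)) => [h|e e0].
  exact: (ultra_lim_norm (bnd^~ h) (LP h)).
have M0 : 0 <= M by exact: ball_bound_ge0 r0 (fM 0%N).
set K := 2048 * M / r ^+ 2.
have K0 : 0 <= K by exact: divr_ge0 (mulr_ge0 (ler0n _ _) M0) (exprn_ge0 _ (ltW r0)).
have r40 : 0 < r / 4 by rewrite divr_gt0.
have r4 : r / 4 < r by rewrite ltr_pdivrMr// ltr_pMr//; lra.
exists (Num.min (r / 4) (e / (K + 1))).
  by rewrite lt_min r40 divr_gt0// ltr_wpDl.
move=> h; rewrite lt_min => /andP[hr].
rewrite ltr_pdivlMr ?ltr_wpDl// => hK.
have T k : cnorm (f k (z + h) - f k z - 'd (f k) z h) <= K * cnorm h ^+ 2.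
  exact: (cauchy_taylor r0 (df k) (fM k) hr).
have zh : cnorm (z + h - z) < r by rewrite addrC addKr (lt_trans hr).
apply: (le_trans (ultra_lim_norm T (ultra_limB (ultra_limB (fF _ zh) (fF _ zz)) (LP h)))).
rewrite expr2 mulrA; apply: ler_wpM2r; first exact: cnorm_ge0.
apply: le_trans (ltW hK); rewrite mulrC; apply: ler_wpM2l; first exact: cnorm_ge0.
by rewrite lerDl.
Qed.

End ultrafilter_limits.

(** * Extraction of convergent subsequences *)

Section montel.
Context {R : realType} {V : normedModType R[i]}.
Local Notation C := R[i].

Theorem montel (Omega : set V) (D : nat -> V) (f : nat -> V -> C) :
  (forall z (e : R), 0 < e -> exists i, cnorm (D i - z) < e) ->
  (forall k z, Omega z -> differentiable (f k) z) ->
  (forall z, Omega z -> exists r M, [/\ 0 < r,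
     forall y, cnorm (y - z) < r -> Omega y &
     forall k y, cnorm (y - z) < r -> cnorm (f k y) <= M]) ->
  exists (phi : nat -> nat) (F : V -> C), [/\ forall j, (j <= phi j)%N,
    forall z, Omega z -> differentiable F z &
    forall z, Omega z -> forall e : R, 0 < e ->
      exists N, forall j, (N <= j)%N -> cnorm (f (phi j) z - F z) < e].
Proof.
move=> Dd df fb.
have [U [UU sU]] := ultraFilterLemma (eventually_filter : ProperFilter \oo).
have [F FP] : exists F : V -> C, forall z, Omega z -> ultra_lim U (f ^~ z) (F z).
  have h z : exists l, Omega z -> ultra_lim U (f ^~ z) l.
    have [/fb[r [M [r0 _ fM]]]|nz] := pselect (Omega z); last by exists 0.
    have [|l lP] := @ultra_lim_ex R U UU (f ^~ z) M.
      by move=> k; apply: fM; rewrite subrr cnorm0.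
    by exists l.
  by have [F FP] := choice h; exists F.
have dF z : Omega z -> differentiable F z.
  move=> /fb[r [M [r0 rO fM]]]; apply: (ultra_lim_diff UU r0 _ fM).
    by move=> k y /rO; exact: df.
  by move=> y /rO; exact: FP.
(* A finite intersection of sets of [U] is nonempty, so some index [k >= j] is good at the first
   [j + 1] dense points simultaneously. This replaces a diagonal argument. *)
have sel j : exists k, (j <= k)%N /\ forall i, (i <= j)%N -> Omega (D i) ->
    cnorm (f k (D i) - F (D i)) < j.+1%:R^-1.
  have h m : U [set k | forall i, (i < m)%N -> Omega (D i) ->
      cnorm (f k (D i) - F (D i)) < j.+1%:R^-1].
    elim: m => [|m ih]; first by apply: filterS filterT.
    have Um : U [set k | Omega (D m) -> cnorm (f k (D m) - F (D m)) < j.+1%:R^-1].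
      have [/FP FD|nO] := pselect (Omega (D m)).
        have j0 : 0 < j.+1%:R^-1 :> R by rewrite invr_gt0 ltr0Sn.
        by apply: filterS (FD _ j0) => k /= ? _.
      by apply: filterS filterT => k _ /nO.
    apply: filterS (filterI ih Um) => k /= [hk hm] i.
    by rewrite ltnS leq_eqVlt => /predU1P[->|/hk].
  have Uj : U [set k | (j <= k)%N] by apply: sU; exact: nbhs_infty_ge.
  by have [k [/= jk hk]] := ultra_nonempty UU (filterI Uj (h j.+1)); exists k.
have [phi phiP] := choice sel.
exists phi, F; split => //; first by move=> j; have [] := phiP j.
move=> z Oz e e0; have [r [M [r0 rO fM]]] := fb _ Oz.
have e30 : 0 < e / 3 by rewrite divr_gt0.
have [d d0 dF'] := (cnorm_continuous _ _).1 (differentiable_continuous (dF _ Oz)) _ e30.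
(* Three thirds of [e]: the common Lipschitz bound between [z] and a nearby dense point, convergence
   at that point, and continuity of [F]. *)
pose K := 32 * M / r; pose s := Num.min (Num.min (r / 2) d) (e / 3 / (`|K| + 1)).
have r20 : 0 < r / 2 by rewrite divr_gt0.
have s0 : 0 < s by rewrite !lt_min r20 d0 divr_gt0// ltr_wpDl.
have [j0 j0s] := Dd z _ s0; move: j0s; rewrite !lt_min => /andP[/andP[ir id]].
rewrite ltr_pdivlMr ?ltr_wpDl// => iK.
have [m me] := ltr_add_invr e30; rewrite add0r in me.
have OD : Omega (D j0).
  by apply: rO; apply: lt_trans ir _; rewrite ltr_pdivrMr// ltr_pMr//; lra.
exists (maxn j0 m) => j; rewrite geq_max => /andP[ij mj].
have h1 : cnorm (f (phi j) z - f (phi j) (D j0)) < e / 3.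
  have dfz k y : cnorm (y - z) < r -> differentiable (f k) y by move=> /rO; exact: df.
  have := cauchy_lipschitz r0 (@dfz (phi j)) (fM (phi j)) ir.
  move=> /(_ z); rewrite subrr cnorm0 => /(_ r20) => /le_lt_trans; apply.
  apply: le_lt_trans iK; rewrite cnorm_distC mulrC; apply: ler_wpM2l.
    exact: cnorm_ge0.
  by apply: le_trans (ler_norm _) _; rewrite lerDl.
have h2 : cnorm (f (phi j) (D j0) - F (D j0)) < e / 3.
  have [_ /(_ j0 ij OD) h] := phiP j; apply: (lt_trans h); apply: le_lt_trans me.
  by rewrite lef_pV2 ?posrE// ler_nat ltnS.
have h3 := dF' _ id.
have t1 := cnorm_dist (f (phi j) z) (F z) (f (phi j) (D j0)).
have t2 := cnorm_dist (f (phi j) (D j0)) (F z) (F (D j0)).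
move: (cnorm _) (cnorm _) (cnorm _) (cnorm _) (cnorm _) h1 h2 h3 t1 t2.
by clear => x1 x2 x3 x4 x5; lra.
Qed.

End montel.

(** * Propagation of zeros and functions with real values *)

Section identity_theorem.
Context {R : realType}.
Local Notation C := R[i].

Lemma cnorm_sqr (z : C) : cnorm z ^+ 2 = complex.Re z ^+ 2 + complex.Im z ^+ 2.
Proof. by rewrite /cnorm normc_def/= sqr_sqrtr// addr_ge0 ?sqr_ge0. Qed.

(** For [|a| < 1] the right-hand side is nonnegative on the closed disc and zero on the circle, so
    the map z |-> (z + a) / (1 + a z) preserves both. *)
Lemma moebius_norm (a : R) (z : C) :
  cnorm (1 + a%:C * z) ^+ 2 - cnorm (z + a%:C) ^+ 2 =
  (1 - a ^+ 2) * (1 - cnorm z ^+ 2).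
Proof. by rewrite !cnorm_sqr; case: z => u v /=; ring. Qed.

Lemma moebius_denom_neq0 (a : R) (z : C) : 0 <= a < 1 -> cnorm z <= 1 ->
  1 + a%:C * z != 0.
Proof.
move=> /andP[a0 a1] z1; apply/eqP => h.
have : cnorm (1 : C) <= cnorm (a%:C * z).
  by rewrite -[1](addrK (a%:C * z)) h sub0r cnormN.
rewrite cnorm1 cnormM cnorm_real ger0_norm// leNgt => /negP; apply.
by apply: le_lt_trans a1; rewrite ler_piMr.
Qed.

(* Pulling back by the disc automorphism [z |-> (z + a) / (1 + a z)] moves the
   mean value property from the centre to the point [a]. *)
Lemma moebius_bound (g : C -> C) (a M : R) : 0 <= a < 1 ->
  (forall z, cnorm z <= 1 -> differentiable g z) ->
  (forall z, cnorm z = 1 -> cnorm (g z) <= M) ->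
  cnorm (g a%:C) <= 2 * M.
Proof.
move=> a01 dg gM; pose p z : C := (z + a%:C) * (1 + a%:C * z)^-1.
have /andP[a0 a1] := a01.
have a2 : 0 <= 1 - a ^+ 2 by rewrite subr_ge0 exprn_ile1// ltW.
have den z : cnorm z <= 1 -> 0 < cnorm (1 + a%:C * z).
  by move=> z1; rewrite cnorm_gt0; exact: moebius_denom_neq0.
have pE z : cnorm (p z) = cnorm (z + a%:C) / cnorm (1 + a%:C * z).
  by rewrite /p cnormM cnormV.
have p1 z : cnorm z <= 1 -> cnorm (p z) <= 1.
  move=> z1; rewrite pE ler_pdivrMr ?den// mul1r.
  rewrite -(@ler_pXn2r _ 2)// ?nnegrE ?cnorm_ge0// -subr_ge0 moebius_norm//.
  by rewrite mulr_ge0// subr_ge0 expr_le1 ?cnorm_ge0.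
have p2 z : cnorm z = 1 -> cnorm (p z) = 1.
  move=> z1; have d0 : 0 < cnorm (1 + a%:C * z) by apply: den; rewrite z1.
  rewrite pE; suff -> : cnorm (z + a%:C) = cnorm (1 + a%:C * z) by rewrite divff ?gt_eqF.
  apply/eqP; rewrite -(@eqrXn2 _ 2)// ?cnorm_ge0// eq_sym -subr_eq0 moebius_norm//.
  by rewrite z1 expr1n subrr mulr0.
have dp z : cnorm z <= 1 -> differentiable p z.
  move=> z1; apply: differentiableM.
    by apply: differentiableD; [exact: ex_diff|exact: differentiable_cst].
  apply: differentiableV; last exact: moebius_denom_neq0.
  apply: differentiableD; first exact: differentiable_cst.
  by apply: differentiableM; [exact: differentiable_cst|exact: ex_diff].
have dgp z : cnorm z <= 1 -> differentiable (g \o p) z.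
  move=> z1; apply: (@differentiable_comp _ _ _ _ p g z (dp _ z1)).
  by apply: dg; exact: p1.
have -> : a%:C = p 0 by rewrite /p add0r mulr0 addr0 invr1 mulr1.
apply: (@mean_value_bound _ (g \o p) 1 M ltr01).
- by apply: differentiable_continuous; apply: dgp; rewrite cnorm0.
- by move=> z _; exact: dgp.
- by move=> z z1; apply: gM; exact: p2.
Qed.

(** Division by [z ^+ k] does not change the modulus on the unit circle and creates no singularity,
    as [h] vanishes near 0. The bound at [a] becomes [2 * M * a ^+ k], which tends to 0; no power
    series is involved. *)
Lemma disc_vanish (h : C -> C) (a M d : R) : 0 < d -> 0 < a < 1 ->
  (forall z, cnorm z <= 1 -> differentiable h z) ->
  (forall z, cnorm z <= 1 -> cnorm (h z) <= M) ->
  (forall z, cnorm z < d -> h z = 0) -> h a%:C = 0.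
Proof.
move=> d0 /andP[a0 a1] dh hM h0.
have bnd k : cnorm (h a%:C) <= 2 * M * a ^+ k.
  pose g z := h z * (z ^+ k)^-1.
  have aC0 : cnorm (a%:C : C) = a by rewrite cnorm_real gtr0_norm.
  have : cnorm (g a%:C) <= 2 * M.
    apply: moebius_bound; first by rewrite ltW.
    - move=> z z1; have [->|z0] := eqVneq z 0.
        apply: (@nbhs_diff _ _ _ (cst 0)); last exact: differentiable_cst.
        apply/cnorm_nbhs; exists d => // y; rewrite subr0 => /h0 hy.
        by rewrite /g hy mul0r.
      apply: differentiableM; first exact: dh.
      apply: differentiableV; last by rewrite expf_neq0.
      elim: (k) => [|m ih]; first exact: differentiable_cst.
      rewrite (_ : (fun z => z ^+ m.+1) = (fun z => z * z ^+ m)).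
        by apply: differentiableM; [exact: ex_diff|exact: ih].
      by apply/funext => w; rewrite exprS.
    - move=> z z1; rewrite /g cnormM cnormV cnormX z1 expr1n invr1 mulr1.
      by apply: hM; rewrite z1.
  by rewrite /g cnormM cnormV cnormX aC0 ler_pdivrMr// exprn_gt0.
apply: cnorm0_eq0; apply/eqP; rewrite eq_le cnorm_ge0 andbT.
have cv : (2 * M * a ^+ k) @[k --> \oo] --> 2 * M * 0.
  by apply: cvgMr; apply: cvg_expr; rewrite gtr0_norm.
rewrite -(mulr0 (2 * M)) -(cvg_lim _ cv)//; apply: limr_ge; first by apply: cvgP cv.
by near=> k; exact: bnd.
Unshelve. all: by end_near. Qed.

Context {V : normedModType C}.

Lemma diff_locally_bounded (h : V -> C) (c : V) : differentiable h c ->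
  exists r M : R, 0 < r /\ forall y, cnorm (y - c) < r -> cnorm (h y) <= M.
Proof.
move=> /differentiable_continuous/cnorm_continuous/(_ _ ltr01)[r r0 rP].
exists r, (cnorm (h c) + 1); split => // y /rP hy.
have := cnorm_dist (h y) 0 (h c); rewrite !subr0 => /le_trans; apply.
by rewrite addrC lerD2l ltW.
Qed.

Theorem identity_theorem (Omega : set V) (f g : V -> C) (z0 : V) (e0 : R) :
  open Omega -> connected Omega ->
  (forall z, Omega z -> differentiable f z) ->
  (forall z, Omega z -> differentiable g z) ->
  Omega z0 -> 0 < e0 -> (forall y, cnorm (y - z0) < e0 -> f y = g y) ->
  forall z, Omega z -> f z = g z.
Proof.
move=> oO cO df dg Oz0 e00 fg0.
pose h y := f y - g y.
have dh y : Omega y -> differentiable h y.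
  by move=> Oy; apply: differentiableB; [exact: df|exact: dg].
(* The interior of the zero set: nonempty and open by construction; its relative closedness is where
   [disc_vanish] is used. *)
pose B := [set z | Omega z /\ exists2 e : R, 0 < e &
  forall y, cnorm (y - z) < e -> h y = 0].
suff -> : Omega = B.
  move=> z [_ [e e0' eh]]; apply/eqP; rewrite -subr_eq0; apply/eqP.
  by apply: eh; rewrite subrr cnorm0.
apply/esym/cO.
- by exists z0; split => //; exists e0 => // y /fg0; rewrite /h => ->; rewrite subrr.
- exists B; last by apply/seteqP; split => z; [case=> Oz hz; split|case].
  rewrite openE => z [Oz [e e0' eh]].
  have [d d0 dO] := cnorm_open oO Oz.
  apply/cnorm_nbhs; exists (Num.min d (e / 2)).
    by rewrite lt_min d0 divr_gt0.
  move=> y; rewrite lt_min => /andP[yd ye]; split; first exact: dO.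
  exists (e / 2) => [|w wy]; first by rewrite divr_gt0.
  apply: eh; apply: le_lt_trans (cnorm_dist _ _ y) _.
  by rewrite [ltRHS]splitr ltrD.
- exists (closure B); first exact: closed_closure.
  apply/seteqP; split => [z Bz|c [Oc cB]].
    by split; [case: Bz|exact: subset_closure].
  split => //.
  have [r1 r10 r1O] := cnorm_open oO Oc.
  have [r2 [M [r20 hM]]] := diff_locally_bounded (dh _ Oc).
  pose r := Num.min r1 r2.
  have r0 : 0 < r by rewrite lt_min r10.
  have rO y : cnorm (y - c) < r -> Omega y.
    by rewrite lt_min => /andP[yr _]; exact: r1O.
  have rM y : cnorm (y - c) < r -> cnorm (h y) <= M.
    by rewrite lt_min => /andP[_ yr]; exact: hM.
  have r40 : 0 < r / 4 by rewrite divr_gt0.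
  have [|a [[Oa [e e0' eh]] /= ac]] := cB [set y | cnorm (y - c) < r / 4].
    by apply/cnorm_nbhs; exists (r / 4).
  exists (r / 4) => // y yc.
  (* Scaled so that [y] has parameter 3/4 on the line from [a], inside the unit disc as
     [disc_vanish] demands. The disc stays in the ball about [c], since 1/4 + 2/3 < 1. *)
  pose X := ((4 / 3 : R)%:C) *: (y - a).
  have nX : cnorm X < 2 / 3 * r.
    rewrite cnormZ cnorm_real ger0_norm; last by rewrite divr_ge0.
    have := cnorm_dist y a c; rewrite (cnorm_distC c) => h1.
    by move: (cnorm (y - a)) (cnorm (y - c)) (cnorm (a - c)) h1 yc ac; clear => *; lra.
  have line (l : C) : cnorm l <= 1 -> cnorm (a + l *: X - c) < r.
    move=> l1; rewrite addrAC; apply: le_lt_trans (cnormD _ _) _; rewrite cnormZ.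
    have : cnorm l * cnorm X <= cnorm X by rewrite ler_piMl ?cnorm_ge0.
    move: (cnorm l * cnorm X) (cnorm X) (cnorm (a - c)) nX ac => x1 x2 x3.
    by move: r0; clear => *; lra.
  have yE : y = a + ((3 / 4 : R)%:C) *: X.
    rewrite /X scalerA -rmorphM (_ : 3 / 4 * (4 / 3) = 1 :> R); last by field.
    by rewrite rmorph1 scale1r addrC subrK.
  rewrite yE; pose n := cnorm X + 1.
  have n0 : 0 < n by rewrite ltr_wpDl ?cnorm_ge0.
  apply: (@disc_vanish (fun l => h (a + l *: X)) (3 / 4) M (e / n)).
  + by rewrite divr_gt0.
  + by apply/andP; split; lra.
  + by move=> l /line/rO/dh dl; case: (is_diff_comp_line dl).
  + by move=> l /line/rM.
  + move=> l; rewrite ltr_pdivlMr// => ln; apply: eh.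
    rewrite addrC addKr cnormZ; apply: le_lt_trans ln.
    by rewrite ler_wpM2l ?cnorm_ge0// lerDl.
Qed.

(** Difference quotients along real multiples of [x] are real, hence so is the differential at [x];
    applied to ['i%C *: x], complex linearity makes it vanish. *)
Lemma real_diff_cst (q : V -> C) (z : V) (r : R) :
  (forall y, cnorm (y - z) < r -> differentiable q y) ->
  (forall y, cnorm (y - z) < r -> complex.Im (q y) = 0) ->
  forall y, cnorm (y - z) < r -> q y = q z.
Proof.
move=> dq q0.
have im0 y x : cnorm (y - z) < r -> complex.Im ('d q y x) = 0.
  move=> yr; apply/eqP; rewrite -normr_eq0 eq_le normr_ge0 andbT.
  apply/ler_addgt0Pl => e e0; rewrite addr0.
  have n0 : 0 < cnorm x + 1 by rewrite ltr_wpDl ?cnorm_ge0.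
  have e'0 : 0 < e / (cnorm x + 1) by rewrite divr_gt0.
  have [d d0 dH] := diff_cnorm (dq _ yr) e'0.
  pose s := Num.min d (r - cnorm (y - z)) / (2 * (cnorm x + 1)).
  have m0 : 0 < Num.min d (r - cnorm (y - z)) by rewrite lt_min d0 subr_gt0.
  have s0 : 0 < s by rewrite divr_gt0// mulr_gt0.
  have sx : cnorm (s%:C *: x) < Num.min d (r - cnorm (y - z)).
    rewrite cnormZ cnorm_real gtr0_norm//.
    have -> : Num.min d (r - cnorm (y - z)) = s * (2 * (cnorm x + 1)).
      by rewrite /s divfK// gt_eqF// mulr_gt0.
    rewrite ltr_pM2l//; have := cnorm_ge0 x; move: (cnorm x) => N; clear; lra.
  have [sd sr] : cnorm (s%:C *: x) < d /\ cnorm (s%:C *: x) < r - cnorm (y - z).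
    by move: sx; rewrite lt_min => /andP[].
  have := dH _ sd; move=> /(le_trans (cnorm_Im _)).
  have yr' : cnorm (y + s%:C *: x - z) < r.
    rewrite addrAC; apply: le_lt_trans (cnormD _ _) _.
    by rewrite -ltrBrDl.
  rewrite !raddfB/= q0// q0// subrr sub0r normrN linearZ/=.
  have -> : complex.Im (s%:C * 'd q y x) = s * complex.Im ('d q y x).
    by case: ('d q y x) => u v /=; rewrite mul0r addr0.
  rewrite normrM cnormZ cnorm_real gtr0_norm// mulrCA ler_pM2l// => /le_trans; apply.
  by rewrite mulrAC ler_pdivrMr// ler_pM2l// lerDl.
have d0 y x : cnorm (y - z) < r -> 'd q y x = 0.
  move=> yr; have h1 := im0 _ x yr; have h2 := im0 _ ('i%C *: x) yr.
  move: h2; rewrite linearZ/= -[_ *: _]/('i%C * 'd q y x) mulrC ImiRe => h2.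
  by apply/eqP; rewrite eq_complex h1 h2 !eqxx.
move=> y yr; apply/eqP; rewrite -subr_eq0; apply/eqP/cnorm0_eq0/eqP.
rewrite eq_le cnorm_ge0 andbT.
have near1 (s : R) : 0 <= s <= 1 -> cnorm (z + s%:C *: (y - z) - z) < r.
  move=> s01; apply: ball_segment => //; rewrite subrr cnorm0.
  exact: le_lt_trans (cnorm_ge0 _) yr.
have := @segment_bound _ _ q (fun y => 'd q y) z (y - z) 0; rewrite mulr0.
rewrite [z + (y - z)]addrC subrK; apply => s /near1 sr.
  exact/differentiableP/dq.
by rewrite d0// cnorm0.
Qed.

Theorem norm_additive_eq (Omega : set V) (f g : V -> C) (z0 : V) :
  open Omega -> connected Omega ->
  (forall z, Omega z -> differentiable f z) ->
  (forall z, Omega z -> differentiable g z) ->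
  (forall z, Omega z -> cnorm (f z + g z) = cnorm (f z) + cnorm (g z)) ->
  Omega z0 -> f z0 = 1 -> g z0 = 1 -> forall z, Omega z -> f z = g z.
Proof.
move=> oO cO df dg fg Oz0 f1 g1.
have [r1 r10 r1O] := cnorm_open oO Oz0.
have [r2 r20 r2g] :=
  (cnorm_continuous _ _).1 (differentiable_continuous (dg _ Oz0)) _ ltr01.
pose r := Num.min r1 r2.
have r0 : 0 < r by rewrite lt_min r10.
have rO y : cnorm (y - z0) < r -> Omega y.
  by rewrite lt_min => /andP[yr _]; exact: r1O.
(* The quotient is formed only on a ball where [g] stays within 1 of its value 1; the identity
   theorem carries the equality to all of [Omega]. *)
have rg y : cnorm (y - z0) < r -> g y != 0.
  rewrite lt_min => /andP[_ /r2g]; rewrite g1 => h; apply/eqP => gy0.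
  by move: h; rewrite gy0 sub0r cnormN cnorm1 ltxx.
apply: (identity_theorem oO cO df dg Oz0 r0) => y yr.
pose q y := f y * (g y)^-1.
have dq y' : cnorm (y' - z0) < r -> differentiable q y'.
  move=> y'r; apply: differentiableM; first exact/df/rO.
  by apply: differentiableV; [exact/dg/rO|exact: rg].
have q0 y' : cnorm (y' - z0) < r -> complex.Im (q y') = 0.
  move=> y'r; have g0 := rg _ y'r; have ng : 0 < cnorm (g y') by rewrite cnorm_gt0.
  have E : cnorm (q y' + 1) = cnorm (q y') + 1.
    have -> : q y' + 1 = (f y' + g y') * (g y')^-1 by rewrite mulrDl divff.
    by rewrite /q !cnormM !cnormV fg ?mulrDl ?divff ?gt_eqF//; exact: rO.
  have E2 := cnorm_sqr (q y' + 1); have E1 := cnorm_sqr (q y').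
  rewrite E !raddfD/= addr0 in E2.
  (* Comparing the squares of |q + 1| and |q| + 1 leaves Re q = |q|, so the imaginary part is 0. *)
  have uq : complex.Re (q y') = cnorm (q y').
    move: (complex.Re _) (complex.Im _) (cnorm _) E1 E2; clear => u v n E1 E2.
    have h1 : (n + 1) ^+ 2 = n ^+ 2 + 2 * n + 1 by ring.
    have h2 : (u + 1) ^+ 2 + v ^+ 2 = (u ^+ 2 + v ^+ 2) + 2 * u + 1 by ring.
    by move: E2; rewrite h1 h2 -E1; lra.
  move: E1; rewrite uq => /eqP; rewrite -subr_eq0 opprD addrA subrr add0r oppr_eq0.
  by rewrite expf_eq0/= => /eqP.
have := real_diff_cst dq q0 yr; rewrite /q f1 g1 divr1 => E.
by rewrite -[LHS](divfK (rg _ yr)) E mul1r.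
Qed.

End identity_theorem.

(** * Lebesgue measure on C^n and the L^p norm *)

Section power_measure_boxes.
Context d (T : measurableType d) (R : realType).

Lemma measurable_box n (A : 'I_n -> set T) : (forall i, measurable (A i)) ->
  measurable [set t : n.-tuple T | forall i, A i (tnth t i)].
Proof.
move=> mA; rewrite (_ : mkset _ = \bigcap_(i in [set: 'I_n]) ((fun t => tnth t i) @^-1` A i)).
  apply: fin_bigcap_measurable => // i _; rewrite -[X in measurable X]setTI.
  exact: measurable_tnth.
by apply/seteqP; split => t /= tA i; [move=> _; exact: tA|exact: (tA i I)].
Qed.

Lemma power_measure_box (mu : {sigma_finite_measure set T -> \bar R}) n
    (A : 'I_n -> set T) (v : R) :
  (forall i, measurable (A i)) -> (forall i, mu (A i) = v%:E) ->
  power_measure mu n [set t | forall i, A i (tnth t i)] = (v ^+ n)%:E.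
Proof.
elim: n A => [|n ih] A mA Av.
  by rewrite /= diracE mem_set//= => -[].
rewrite /= /cons_measure /pushforward.
have -> : @tcons d T n @^-1` [set t | forall i, A i (tnth t i)] =
    A ord0 `*` [set t | forall i, A (lift ord0 i) (tnth t i)].
  apply/seteqP; split => [[x t]/= xt|[x t]/= [x0 xt] i].
    split => [|i]; first by have := xt ord0; rewrite tnth0.
    by have := xt (lift ord0 i); rewrite tnthS.
  by have [j ->|->] := unliftP ord0 i; [rewrite tnthS|rewrite tnth0].
rewrite /prod_measure product_measure1E//; last first.
  exact: (measurable_box (fun i => mA (lift ord0 i))).
rewrite (ih (fun i => A (lift ord0 i)))//.
by rewrite -[LHS]/(mu (A ord0) * _)%E Av -EFinM exprS.
Qed.

End power_measure_boxes.

Section complex_boxes.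
Context (R : realType) (n : nat).
Local Notation C := R[i].
Local Notation V := 'rV[C]_n.
Local Notation M := (measurableTypeR R).
Local Notation Re := (@complex.Re R).
Local Notation Im := (@complex.Im R).
Local Notation orc := (@of_real_coord R n).
Local Notation mu := (@lebesgue_Cn R n).
Implicit Types (c z : V) (s : R).

(** The norm of a row is the largest modulus of its entries: balls are polydiscs. *)
Lemma cnorm_row_lt (x : V) s : 0 < s ->
  cnorm x < s <-> forall j, cnorm (x ord0 j) < s.
Proof.
move=> s0; have sC0 : (0 : C) < s%:C by rewrite ltcR.
have B : ball (0 : V) s%:C x <-> cnorm x < s.
  by rewrite mx_norm_ball /ball_/= sub0r normrN -cnormE ltcR.
split=> [/B[_ h] j|h]; last apply/B.
  by have := h ord0 j; rewrite /ball/= mxE sub0r normrN -cnormE ltcR.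
by split => // i j; rewrite ord1 /ball/= mxE sub0r normrN -cnormE ltcR.
Qed.

(** Products of squares in real coordinates have an explicit volume and lie between the polydiscs of
    radius [s] and [2 * s]; they stand in for balls in all integral estimates. *)
Definition box c s : set (n.-tuple (M * M)) :=
  [set t | forall j, `|(tnth t j).1 - Re (c ord0 j)| < s /\
                     `|(tnth t j).2 - Im (c ord0 j)| < s].

Lemma boxE c s : box c s = [set t | forall j,
  (`](Re (c ord0 j) - s), (Re (c ord0 j) + s)[ `*`
   `](Im (c ord0 j) - s), (Im (c ord0 j) + s)[)%classic (tnth t j)].
Proof.
apply/seteqP; split => t /= h j; have := h j.
  by rewrite !in_itv/= !ltr_distl.
by rewrite !in_itv/= !ltr_distl.
Qed.

Lemma measurable_box_Cn c s : measurable (box c s).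
Proof.
rewrite boxE; apply: (@measurable_box _ (M * M)%type n (fun j =>
  (`](Re (c ord0 j) - s), (Re (c ord0 j) + s)[ `*`
   `](Im (c ord0 j) - s), (Im (c ord0 j) + s)[)%classic)) => j.
by apply: measurableX; exact: measurable_itv.
Qed.

Lemma lebesgue_Cn_box c s : 0 < s -> mu (box c s) = ((4 * s ^+ 2) ^+ n)%:E.
Proof.
move=> s0; rewrite boxE; apply: (@power_measure_box _ (M * M)%type R _ n (fun j =>
  (`](Re (c ord0 j) - s), (Re (c ord0 j) + s)[ `*`
   `](Im (c ord0 j) - s), (Im (c ord0 j) + s)[)%classic)) => j.
  by apply: measurableX; exact: measurable_itv.
rewrite -[LHS]/((lebesgue_measure \x lebesgue_measure)%E _).
rewrite product_measure1E; [|exact: measurable_itv..].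
have I a : lebesgue_measure (`](a - s), (a + s)[%classic : set M) = (2 * s)%:E.
  rewrite lebesgue_measure_itv/= lte_fin ifT; last by clear -s0; lra.
  by rewrite -EFinB; congr EFin; ring.
transitivity ((2 * s)%:E * (2 * s)%:E)%E.
  by congr (_ * _)%E; exact: I.
by rewrite -EFinM; congr EFin; ring.
Qed.

Lemma box_ball c s t : 0 < s -> box c s t -> cnorm (orc t - c) < 2 * s.
Proof.
move=> s0 tb; apply/cnorm_row_lt; first by rewrite mulr_gt0.
move=> j; have [h1 h2] := tb j; rewrite !mxE.
rewrite (le_lt_trans (cnorm_ReIm _))// mulr_natl mulr2n.
by move: h1 h2; case: (c ord0 j) => u v /= h1 h2; rewrite ltrD.
Qed.

Lemma ball_box c s t : cnorm (orc t - c) < s -> box c s t.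
Proof.
move=> h; have s0 : 0 < s by exact: le_lt_trans (cnorm_ge0 _) h.
move=> j; have := (cnorm_row_lt _ s0).1 h j; rewrite !mxE => hj.
split; apply: le_lt_trans hj.
  by apply: le_trans (cnorm_Re _); rewrite raddfB.
by apply: le_trans (cnorm_Im _); rewrite raddfB.
Qed.

Definition ratpt (q : n.-tuple (rat * rat)) : V :=
  \row_j (ratr (tnth q j).1 +i* ratr (tnth q j).2).

Lemma ratpt_dense z s : 0 < s -> exists q, cnorm (ratpt q - z) < s.
Proof.
move=> s0; have s20 : 0 < s / 2 by rewrite divr_gt0.
have h (x : R) : exists q : rat, `|ratr q - x| < s / 2.
  have [|q] := @rat_in_itvoo R (x - s / 2) (x + s / 2); first by clear -s20; lra.
  by rewrite in_itv/= => qx; exists q; rewrite ltr_distl.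
have [F FP] := choice h.
exists [tuple (F (Re (z ord0 j)), F (Im (z ord0 j))) | j < n].
apply/cnorm_row_lt => // j; rewrite !mxE tnth_mktuple/=.
rewrite (le_lt_trans (cnorm_ReIm _))// [ltRHS]splitr.
by have := FP (Re (z ord0 j)); have := FP (Im (z ord0 j));
  case: (z ord0 j) => u v /= ? ?; rewrite ltrD.
Qed.

Definition dense_seq (k : nat) : V :=
  if unpickle k is Some q then ratpt q else 0.

Lemma dense_seqP z s : 0 < s -> exists k, cnorm (dense_seq k - z) < s.
Proof.
by move=> /(ratpt_dense z)[q qz]; exists (pickle q); rewrite /dense_seq pickleK.
Qed.

(** An open set is the union of the countably many boxes with rational centre and side parameter
    1/(m+1) that it contains. *)
Lemma measurable_open (Omega : set V) : open Omega -> measurable (orc @^-1` Omega).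
Proof.
move=> oO; pose s (m : nat) : R := m.+1%:R^-1.
have s0 m : 0 < s m by rewrite invr_gt0.
pose F (k : nat) : set (n.-tuple (M * M)) :=
  if unpickle k is Some (q, m) then
    if `[< box (ratpt q) (s m) `<=` orc @^-1` Omega >] then box (ratpt q) (s m)
    else set0
  else set0.
have -> : orc @^-1` Omega = \bigcup_k F k.
  apply/seteqP; split => [t /= Ot|t [k _]]; last first.
    by rewrite /F; case: unpickle => [[q m]|//]; case: asboolP => // h /h.
  have [e e0 eO] := cnorm_open oO Ot.
  have [m] := ltr_add_invr (divr_gt0 e0 (ltr0Sn R 3)); rewrite add0r => me.
  have [q qz] := ratpt_dense (orc t) (s0 m).
  exists (pickle (q, m)) => //; rewrite /F pickleK; case: asboolP => [_|].
    by apply: ball_box; rewrite cnorm_distC.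
  case; move=> t' tb /=; apply: eO.
  have h1 := box_ball (s0 m) tb; have h2 := cnorm_dist (orc t') (orc t) (ratpt q).
  rewrite -/(s m) in me.
  move: (cnorm (orc t' - orc t)) (cnorm (orc t' - ratpt q)) (cnorm (ratpt q - orc t)) (s m) h1 h2 qz me.
  by clear -e0 => x1 x2 x3 x4; lra.
apply: bigcupT_measurable => k; rewrite /F; case: unpickle => [[q m]|//].
by case: asboolP => _ //; exact: measurable_box_Cn.
Qed.

Lemma lebesgue_Cn_finite (Omega : set V) : open Omega -> bounded_set Omega ->
  (mu (orc @^-1` Omega) < +oo)%E.
Proof.
move=> oO bO.
have [K K0 OK] : exists2 K : R, 0 < K & forall z, Omega z -> cnorm z < K.
  have [K0 [K0r OK]] := bO; exists (`|complex.Re K0| + 2).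
    by rewrite ltr_wpDl.
  move=> z Oz; have := OK (`|complex.Re K0| + 1)%:C.
  have -> : K0 < (`|complex.Re K0| + 1)%:C.
    rewrite -(RRe_real K0r) ltcR /=.
    by rewrite (le_lt_trans (ler_norm _))// ltrDl.
  move=> /(_ erefl z Oz); rewrite /= -cnormE lecR => /le_lt_trans; apply.
  by rewrite ltrD2l ltr1n.
apply: (@le_lt_trans _ _ (mu (box 0 K))).
  apply: le_measure; rewrite ?inE; [exact: measurable_open|exact: measurable_box_Cn|].
  by move=> t /OK tK; apply: ball_box; rewrite subr0.
by rewrite lebesgue_Cn_box// ltry.
Qed.

End complex_boxes.

(** * Estimates for real powers *)

Section powR_extra.
Context {R : realType}.
Implicit Types a b p : R.

Lemma powR_continuous_nneg p a (e : R) : 1 <= p -> 0 <= a -> 0 < e ->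
  exists2 d : R, 0 < d & forall b, 0 <= b -> `|b - a| < d -> `|b `^ p - a `^ p| < e.
Proof.
move=> p1 a0 e0; have p0 : p != 0 by rewrite gt_eqF// (lt_le_trans ltr01).
have [->|an0] := eqVneq a 0.
  exists (Num.min 1 e) => [|b b0]; first by rewrite lt_min ltr01.
  rewrite subr0 powR0// subr0 !ger0_norm ?powR_ge0// lt_min => /andP[b1 be].
  apply: le_lt_trans be; have [->|bn0] := eqVneq b 0; first by rewrite powR0.
  by apply: ge1r_powR => //; rewrite lt_neqAle eq_sym bn0 b0 ltW.
have ap : 0 < a by rewrite lt_neqAle eq_sym an0.
have ca : {for a, continuous (fun x : R => x `^ p)}.
  apply: differentiable_continuous; apply/derivable1_diffP.
  by apply: derivable_powR; rewrite in_itv/= ap.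
move/cvgrPdist_lt : ca => /(_ _ e0) /nbhs_normP[d /= d0 dH].
by exists d => // b _ bd; rewrite distrC; apply: dH; rewrite /= distrC.
Qed.

Lemma powR_cvg_nneg p (u : nat -> R) a : 1 <= p -> 0 <= a -> (forall k, 0 <= u k) ->
  u @ \oo --> a -> (fun k => u k `^ p) @ \oo --> a `^ p.
Proof.
move=> p1 a0 u0 ua; apply/cvgrPdist_lt => e e0.
have [d d0 dH] := powR_continuous_nneg p1 a0 e0.
move/cvgrPdist_lt : ua => /(_ _ d0); apply: filterS => k kd.
by rewrite distrC; apply: dH => //; rewrite distrC.
Qed.

Lemma powR_lt p a b : 0 < p -> 0 <= a -> a < b -> a `^ p < b `^ p.
Proof.
by move=> p0 a0 ab; apply: gt0_ltr_powR => //; rewrite nnegrE// ltW// (le_lt_trans a0).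
Qed.

Lemma powR_le p a b : 0 < p -> 0 <= a -> a <= b -> a `^ p <= b `^ p.
Proof.
by move=> p0 a0 ab; apply: ge0_ler_powR; rewrite ?nnegrE ?(ltW p0)// (le_trans a0).
Qed.

Lemma powR_le_inv p a b : 0 < p -> 0 <= b -> a `^ p <= b `^ p -> a <= b.
Proof.
by move=> p0 b0 h; rewrite leNgt; apply/negP => /(powR_lt p0 b0); rewrite ltNge h.
Qed.

Lemma powR_add_le p a b : 0 < p -> 0 <= a -> 0 <= b ->
  (a + b) `^ p <= 2 `^ p * (a `^ p + b `^ p).
Proof.
move=> p0; wlog ab : a b / a <= b => [H a0 b0|a0 b0].
  have [ab|/ltW ba] := leP a b; first exact: H.
  by rewrite addrC [X in _ * X]addrC; exact: H.
apply: (@le_trans _ _ ((2 * b) `^ p)).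
  by apply: powR_le; rewrite ?addr_ge0// mulr_natl mulr2n lerD2r.
by rewrite powRM// ler_wpM2l ?powR_ge0// lerDr powR_ge0.
Qed.

Lemma cnorm_lip (a b : R[i]) : `|cnorm a - cnorm b| <= cnorm (a - b).
Proof.
rewrite ler_norml; have h1 := cnorm_dist a 0 b; have h2 := cnorm_dist b 0 a.
rewrite !subr0 in h1 h2; rewrite (cnorm_distC b a) in h2; apply/andP.
by move: (cnorm a) (cnorm b) (cnorm (a - b)) h1 h2; clear => *; split; lra.
Qed.

End powR_extra.

(** * Minkowski, Fatou and Riesz for functions on an open set *)

Section Lp_theory.
Context (R : realType) (n : nat) (p : R) (Omega : set 'rV[R[i]]_n).
Hypotheses (p1 : 1 <= p) (oO : open Omega).
Local Notation C := R[i].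
Local Notation V := 'rV[C]_n.
Local Notation M := (measurableTypeR R).
Local Notation Re := (@complex.Re R).
Local Notation Im := (@complex.Im R).
Local Notation orc := (@of_real_coord R n).
Local Notation mu := (@lebesgue_Cn R n).
Local Notation U := (orc @^-1` Omega).
Implicit Types f g h : V -> C.

Let p0 : 0 < p. Proof. exact: lt_le_trans p1. Qed.
Let pn0 : p != 0. Proof. by rewrite gt_eqF. Qed.
Let mU : measurable U. Proof. exact: measurable_open. Qed.

Definition cmeasurable f :=
  measurable_fun U (Re \o f \o orc : _ -> M) /\ measurable_fun U (Im \o f \o orc : _ -> M).

(** The p-th power of the norm, as an integral over [U] itself: integral theorems apply without the
    root and without extension by zero. *)
Definition ipow f : \bar R := (\int[mu]_(t in U) ((cnorm (f (orc t))) `^ p)%:E)%E.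

Lemma cmeasurable_norm f : cmeasurable f ->
  measurable_fun U (fun t => cnorm (f (orc t)) : M).
Proof.
move=> [mr mi].
rewrite (_ : (fun t => _) = (fun x : R => x `^ 2^-1) \o
   (fun t => Re (f (orc t)) ^+ 2 + Im (f (orc t)) ^+ 2)).
  apply: (@measurableT_comp _ _ _ _ _ _ (fun x : R => x `^ 2^-1)).
    exact: measurable_powR.
  by apply: measurable_funD; apply: measurable_funX.
apply/funext => t /=; rewrite powR12_sqrt ?addr_ge0 ?sqr_ge0//.
by rewrite /cnorm normc_def.
Qed.

Lemma cmeasurable_powR f : cmeasurable f ->
  measurable_fun U (fun t => cnorm (f (orc t)) `^ p : M).
Proof.
move=> /cmeasurable_norm mf.
apply: (@measurableT_comp _ _ _ _ _ _ (fun x : R => x `^ p)) => //.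
Qed.

Lemma cmeasurable_epowR f : cmeasurable f ->
  measurable_fun U (fun t => (cnorm (f (orc t)) `^ p)%:E).
Proof. by move=> /cmeasurable_powR mf; exact/measurable_EFinP. Qed.

Lemma ipow_ge0 f : (0 <= ipow f)%E.
Proof. by apply: integral_ge0 => t _; rewrite lee_fin powR_ge0. Qed.

Lemma Lp_norm_ipow f : Lp_norm p Omega f = (ipow f `^ p^-1)%E.
Proof.
rewrite /Lp_norm unlock /ipow [in RHS]integral_mkcond; congr (_ `^ _)%E.
apply: eq_integral => t _; rewrite /= /patch.
case: ifP => _; last by rewrite /= normr0 powR0.
by rewrite ger0_norm// -[X in _ <= X]/(cnorm (f (orc t))) cnorm_ge0.
Qed.

Lemma Lp_norm_ge0 f : (0 <= Lp_norm p Omega f)%E.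
Proof. exact: Lnorm_ge0. Qed.

Lemma ipow_Lp_norm f : ipow f = (Lp_norm p Omega f `^ p)%E.
Proof. by rewrite Lp_norm_ipow -poweRrM mulVf// poweRe1// ipow_ge0. Qed.

Lemma bergman_norm_ge0 f : 0 <= bergman_norm p Omega f.
Proof. by rewrite fine_ge0// Lp_norm_ge0. Qed.

Lemma LpE f : Lp p Omega f <-> cmeasurable f /\ (ipow f < +oo)%E.
Proof.
split=> [[mr mi Nf]|[[mr mi] If]].
  by split => //; rewrite ipow_Lp_norm poweR_lty.
by split => //; rewrite Lp_norm_ipow poweR_lty.
Qed.

Lemma Lp_cmeasurable f : Lp p Omega f -> cmeasurable f.
Proof. by case/LpE. Qed.

Lemma bergman_normE f : Lp p Omega f -> Lp_norm p Omega f = (bergman_norm p Omega f)%:E.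
Proof.
by move=> [_ _ Nf]; rewrite /bergman_norm fineK// ge0_fin_numE ?Lp_norm_ge0.
Qed.

Lemma ipow_normE f : Lp p Omega f -> ipow f = ((bergman_norm p Omega f) `^ p)%:E.
Proof. by move=> Lf; rewrite ipow_Lp_norm bergman_normE. Qed.

(** [bergman_norm] is 0 when the integral is infinite, so a norm bound means something only together
    with membership in [Lp]; one bound on the integral gives both. *)
Lemma ipow_le f c : cmeasurable f -> 0 <= c -> (ipow f <= (c `^ p)%:E)%E ->
  Lp p Omega f /\ bergman_norm p Omega f <= c.
Proof.
move=> mf c0 If; have Lf : Lp p Omega f.
  by apply/LpE; split => //; exact: le_lt_trans If (ltry _).
by split => //; move: If; rewrite ipow_normE// lee_fin; exact: powR_le_inv.
Qed.

(** Allowing any [h] dominated by |f| + |g| covers sums, differences and the triangle inequality for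
    distances at once. *)
Lemma Lp_minkowski f g h : Lp p Omega f -> Lp p Omega g -> cmeasurable h ->
  (forall z, Omega z -> cnorm (h z) <= cnorm (f z) + cnorm (g z)) ->
  Lp p Omega h /\
  bergman_norm p Omega h <= bergman_norm p Omega f + bergman_norm p Omega g.
Proof.
move=> Lf Lg mh hfg.
have mr k : cmeasurable k ->
    measurable_fun [set: _] ((@Normc.normc R \o k \o orc) \_ U : _ -> M).
  by move=> /cmeasurable_norm mk; apply/(measurable_restrictT _ mU).
have mf := mr _ (Lp_cmeasurable Lf); have mg := mr _ (Lp_cmeasurable Lg).
have := @minkowski_EFin _ _ _ mu _ _ _ mf mg p1.
rewrite -/(Lp_norm p Omega f) -/(Lp_norm p Omega g) !bergman_normE// -EFinD.
set c := (X in (_ <= X%:E)%E).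
have c0 : 0 <= c by rewrite addr_ge0 ?bergman_norm_ge0.
move: mf mg; set A := (_ \_ U); set B := (_ \_ U) => mA mB.
have -> : Lnorm mu p%:E (EFin \o (A \+ B)) =
    ((\int[mu]_t (`|A t + B t| `^ p)%:E) `^ p^-1)%E by rewrite unlock.
move=> Mk; apply: ipow_le => //.
have I0 : (0 <= \int[mu]_t (`|A t + B t| `^ p)%:E)%E.
  by apply: integral_ge0 => t _; rewrite lee_fin powR_ge0.
apply: (@le_trans _ _ (\int[mu]_t (`|A t + B t| `^ p)%:E)%E).
  rewrite /ipow integral_mkcond; apply: ge0_le_integral => //.
  - by move=> t _; rewrite /patch; case: ifP => _ //; rewrite lee_fin powR_ge0.
  - by apply/(measurable_restrictT _ mU); exact: cmeasurable_epowR.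
  - apply/measurable_EFinP; apply: (@measurableT_comp _ _ _ _ _ _ (fun x : R => x `^ p)) => //.
    apply: (@measurableT_comp _ _ _ _ _ _ (fun x : R => `|x|)) => //.
    exact: measurable_funD.
  - move=> t _; rewrite /= /A /B /patch; case: ifPn => [/set_mem Ut|_]; last first.
      by rewrite lee_fin powR_ge0.
    rewrite lee_fin powR_le ?cnorm_ge0//; apply: le_trans (ler_norm _).
    exact: hfg.
rewrite -poweR_EFin -(@poweRe1 _ (integral _ _ _))// -(mulVf pn0) poweRrM.
by apply: gt0_ler_poweR; rewrite ?(ltW p0)// in_itv/= leey andbT ?poweR_ge0 ?lee_fin.
Qed.

Lemma cmeasurable_cst (c : C) : cmeasurable (cst c).
Proof. by split; exact: measurable_cst. Qed.

Lemma cmeasurableB f g : cmeasurable f -> cmeasurable g ->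
  cmeasurable (fun z => f z - g z).
Proof.
move=> [rf jf] [rg jg]; split.
  rewrite (_ : _ \o _ = (Re \o f \o orc) \- (Re \o g \o orc)).
    exact: measurable_funB.
  by apply/funext => t /=; rewrite raddfB.
rewrite (_ : _ \o _ = (Im \o f \o orc) \- (Im \o g \o orc)).
  exact: measurable_funB.
by apply/funext => t /=; rewrite raddfB.
Qed.

Lemma cmeasurableD f g : cmeasurable f -> cmeasurable g ->
  cmeasurable (fun z => f z + g z).
Proof.
move=> [rf jf] [rg jg]; split.
  rewrite (_ : _ \o _ = (Re \o f \o orc) \+ (Re \o g \o orc)).
    exact: measurable_funD.
  by apply/funext => t /=; rewrite raddfD.
rewrite (_ : _ \o _ = (Im \o f \o orc) \+ (Im \o g \o orc)).
  exact: measurable_funD.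
by apply/funext => t /=; rewrite raddfD.
Qed.

Lemma cmeasurableZ (c : C) f : cmeasurable f -> cmeasurable (fun z => c * f z).
Proof.
move=> [rf jf]; split.
  rewrite (_ : _ \o _ = (cst (Re c) \* (Re \o f \o orc)) \- (cst (Im c) \* (Im \o f \o orc))).
    by apply: measurable_funB; apply: measurable_funM.
  by apply/funext => t /=; case: c (f _) => [a b] [u v].
rewrite (_ : _ \o _ = (cst (Re c) \* (Im \o f \o orc)) \+ (cst (Im c) \* (Re \o f \o orc))).
  by apply: measurable_funD; apply: measurable_funM.
by apply/funext => t /=; case: c (f _) => [a b] [u v].
Qed.

Lemma LpZ (c : C) f : Lp p Omega f -> Lp p Omega (fun z => c * f z) /\
  bergman_norm p Omega (fun z => c * f z) = cnorm c * bergman_norm p Omega f.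
Proof.
move=> Lf; have mf := Lp_cmeasurable Lf; have mcf := cmeasurableZ c mf.
have E : ipow (fun z => c * f z) = ((cnorm c * bergman_norm p Omega f) `^ p)%:E.
  rewrite powRM ?cnorm_ge0 ?bergman_norm_ge0// EFinM -ipow_normE// /ipow.
  rewrite -ge0_integralZl//; [|exact: cmeasurable_epowR|by move=> t _; rewrite lee_fin powR_ge0
    |by rewrite lee_fin powR_ge0].
  by apply: eq_integral => t _; rewrite cnormM powRM ?cnorm_ge0.
have cf0 : 0 <= cnorm c * bergman_norm p Omega f.
  by rewrite mulr_ge0 ?cnorm_ge0 ?bergman_norm_ge0.
have [|Lcf le1] := ipow_le mcf cf0; first by rewrite E.
split => //; apply/eqP; rewrite eq_le le1/=; apply: (powR_le_inv p0).
  exact: bergman_norm_ge0.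
by have := ipow_normE Lcf; rewrite E => -[->].
Qed.

Lemma fatou_bound (g : nat -> n.-tuple (M * M) -> R) (G : n.-tuple (M * M) -> R) (c : \bar R) :
  (forall k, measurable_fun U (g k : _ -> M)) -> (forall k t, U t -> 0 <= g k t) ->
  (forall t, U t -> (fun k => g k t) @ \oo --> G t) ->
  (forall k, (\int[mu]_(t in U) (g k t)%:E <= c)%E) ->
  (\int[mu]_(t in U) (G t)%:E <= c)%E.
Proof.
move=> mg g0 gG gc.
have mg' k : measurable_fun U (fun t => (g k t)%:E) by apply/measurable_EFinP; exact: mg.
have g0' k t : U t -> (0 <= (g k t)%:E)%E by move=> Ut; rewrite lee_fin g0.
have F := @fatou _ _ _ mu U mU (fun k t => (g k t)%:E) mg' g0'.
have E : (\int[mu]_(t in U) (G t)%:E = \int[mu]_(t in U) limn_einf (fun k => (g k t)%:E))%E.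
  apply: eq_integral => t /set_mem Ut; apply/esym.
  have Gt : (fun k => (g k t)%:E) @ \oo --> (G t)%:E.
    by apply: cvg_EFin; [exact: nearW|exact: gG].
  by have [] := cvg_limn_einf_sup Gt.
rewrite E; apply: le_trans F _; rewrite limn_einf_lim; apply: lime_le.
  exact: is_cvg_einfs.
apply: nearW => k; apply: le_trans (gc k).
by apply: ereal_inf_lbound; exists k => /=.
Qed.

Definition cvg_on (f : nat -> V -> C) (F : V -> C) :=
  forall z, Omega z -> forall e : R, 0 < e ->
    exists N, forall j, (N <= j)%N -> cnorm (f j z - F z) < e.

Lemma cvg_on_norm (f : nat -> V -> C) (F : V -> C) z (P : C -> R) :
  (forall a b, `|P a - P b| <= cnorm (a - b)) ->
  cvg_on f F -> Omega z -> (fun k => P (f k z)) @ \oo --> P (F z).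
Proof.
move=> Pl fF Oz; apply/cvgrPdist_lt => e e0; have [N NP] := fF _ Oz _ e0.
exists N => // k /= Nk; rewrite distrC; apply: le_lt_trans (Pl _ _) _; exact: NP.
Qed.

Lemma cmeasurable_lim (f : nat -> V -> C) F :
  (forall k, cmeasurable (f k)) -> cvg_on f F -> cmeasurable F.
Proof.
move=> mf fF; split.
  apply: (@measurable_fun_cvg _ _ _ U (fun k => Re \o f k \o orc)) => [k|t Ut].
    by case: (mf k).
  apply: (@cvg_on_norm f F (orc t) Re) => // a b.
  by rewrite -raddfB cnorm_Re.
apply: (@measurable_fun_cvg _ _ _ U (fun k => Im \o f k \o orc)) => [k|t Ut].
  by case: (mf k).
apply: (@cvg_on_norm f F (orc t) Im) => // a b.
by rewrite -raddfB cnorm_Im.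
Qed.

Lemma Lp_fatou (f : nat -> V -> C) F c : 0 <= c ->
  (forall k, Lp p Omega (f k)) -> cvg_on f F ->
  (forall k, bergman_norm p Omega (f k) <= c) ->
  Lp p Omega F /\ bergman_norm p Omega F <= c.
Proof.
move=> c0 Lf fF fc.
have mf k := Lp_cmeasurable (Lf k).
apply: ipow_le => //; first exact: cmeasurable_lim fF.
apply: (@fatou_bound (fun k t => cnorm (f k (orc t)) `^ p)).
- by move=> k; exact: cmeasurable_powR.
- by move=> k t _; exact: powR_ge0.
- move=> t Ut; apply: powR_cvg_nneg => //; [exact: cnorm_ge0|by move=> k; exact: cnorm_ge0|].
  by apply: (@cvg_on_norm f F (orc t) (@cnorm R C)) => //; exact: cnorm_lip.
- by move=> k; rewrite -/(ipow (f k)) ipow_normE// lee_fin powR_le// bergman_norm_ge0.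
Qed.

(** Otherwise the distances stay above [e] along some indices. The functions K (|f|^p + |F|^p) - |f
    - F|^p are nonnegative for K = 2^p and converge to 2 K |F|^p, so Fatou's lemma yields 2 K a^p <=
    2 K a^p - e^p. *)
Lemma Lp_riesz (f : nat -> V -> C) F a : Lp p Omega F ->
  (forall k, Lp p Omega (f k)) -> cvg_on f F ->
  (forall k, bergman_norm p Omega (f k) = a) -> bergman_norm p Omega F = a ->
  forall e, 0 < e -> exists N, forall k, (N <= k)%N ->
    bergman_norm p Omega (fun z => f k z - F z) < e.
Proof.
move=> LF Lf fF fa Fa e e0; apply: contrapT => /forallNP H.
have a0 : 0 <= a by rewrite -Fa bergman_norm_ge0.
have H' j : exists k, (j <= k)%N /\ e <= bergman_norm p Omega (fun z => f k z - F z).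
  have /existsNP[k /not_implyP[jk /negP]] := H j; rewrite -leNgt => ek.
  by exists k.
have [phi phiP] := choice H'.
pose f' j := f (phi j).
have mF := Lp_cmeasurable LF; have mf j := Lp_cmeasurable (Lf (phi j)).
have f'F : cvg_on f' F.
  move=> z Oz d d0; have [N NP] := fF _ Oz _ d0; exists N => j Nj.
  by apply: NP; rewrite (leq_trans Nj)//; case: (phiP j).
have mD j : cmeasurable (fun z => f' j z - F z) by exact: cmeasurableB (mf j) mF.
have LD j : Lp p Omega (fun z => f' j z - F z).
  have [] := Lp_minkowski (Lf (phi j)) LF (mD j); last by [].
  by move=> z _; exact: cnormB.
pose K := 2 `^ p : R; have K0 : 0 < K by exact: powR_gt0.
pose g j t := K * (cnorm (f' j (orc t)) `^ p + cnorm (F (orc t)) `^ p) -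
  cnorm (f' j (orc t) - F (orc t)) `^ p.
pose G t := K * (cnorm (F (orc t)) `^ p + cnorm (F (orc t)) `^ p) - 0 `^ p.
have IS k : Lp p Omega k ->
    (\int[mu]_(t in U) (K * (cnorm (k (orc t)) `^ p + cnorm (F (orc t)) `^ p))%:E =
    (K * ((bergman_norm p Omega k) `^ p + a `^ p))%:E)%E.
  move=> Lk; under eq_integral do rewrite EFinM EFinD.
  have mk := cmeasurable_epowR (Lp_cmeasurable Lk); have mF' := cmeasurable_epowR mF.
  rewrite ge0_integralZl//; last 3 first.
  - by apply: emeasurable_funD.
  - by move=> t _; rewrite adde_ge0 ?lee_fin ?powR_ge0.
  - by rewrite lee_fin ltW.
  rewrite ge0_integralD//; try by move=> t _; rewrite lee_fin powR_ge0.
  by rewrite -/(ipow k) -/(ipow F) !ipow_normE// Fa -EFinD -EFinM.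
have mg j : measurable_fun U (g j : _ -> M).
  apply: measurable_funB; last by apply: (cmeasurable_powR (mD j)).
  apply: measurable_funM => //; apply: measurable_funD.
    exact: cmeasurable_powR (mf j).
  exact: cmeasurable_powR mF.
have g0 j t : 0 <= g j t.
  rewrite subr_ge0 (le_trans _ (powR_add_le p0 (cnorm_ge0 _) (cnorm_ge0 _)))//.
  by rewrite powR_le ?cnorm_ge0// cnormB.
have Ig j : (\int[mu]_(t in U) (g j t)%:E <= (K * (a `^ p + a `^ p) - e `^ p)%:E)%E.
  have E : (\int[mu]_(t in U) (g j t)%:E + ipow (fun z => f' j z - F z)%R =
      (K * (a `^ p + a `^ p))%:E)%E.
    rewrite -ge0_integralD//; last 4 first.
    - by move=> t _; rewrite lee_fin.
    - by apply/measurable_EFinP; exact: mg.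
    - by move=> t _; rewrite lee_fin powR_ge0.
    - exact: cmeasurable_epowR (mD j).
    have := IS _ (Lf (phi j)); rewrite fa => <-.
    by apply: eq_integral => t _; rewrite -EFinD /g subrK.
  have h : (ipow (fun z => f' j z - F z)%R >= (e `^ p)%:E)%E.
    rewrite ipow_normE// lee_fin; apply: powR_le => //; first exact: ltW.
    by case: (phiP j).
  rewrite EFinB -E leeBrDr//.
  exact: leeD2l.
have GE : (\int[mu]_(t in U) (G t)%:E = (K * (a `^ p + a `^ p))%:E)%E.
  have := IS _ LF; rewrite Fa => <-; apply: eq_integral => t _.
  by rewrite /G powR0// subr0.
suff gG : forall t, U t -> (fun j => g j t) @ \oo --> G t.
  have := @fatou_bound g G _ mg (fun k t _ => g0 k t) gG Ig.
  rewrite GE lee_fin leNgt => /negP; apply.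
  by rewrite gtrBl powR_gt0.
move=> t Ut.
apply: cvgB.
  apply: cvgMr; apply: cvgD; last exact: cvg_cst.
  apply: powR_cvg_nneg => //; [exact: cnorm_ge0|by move=> k; exact: cnorm_ge0|].
  by apply: (@cvg_on_norm f' F (orc t) (@cnorm R C)) => //; exact: cnorm_lip.
apply: powR_cvg_nneg => //; first by move=> k; exact: cnorm_ge0.
apply/cvgrPdist_lt => d d0; have [N NP] := f'F _ Ut _ d0.
by exists N => // k /= Nk; rewrite sub0r normrN ger0_norm ?cnorm_ge0// NP.
Qed.

End Lp_theory.

(** * Bergman spaces and minimizers *)

Section local_bound.
Context (R : realType) (n : nat).
Local Notation C := R[i].
Local Notation V := 'rV[C]_n.
Local Notation M := (measurableTypeR R).
Local Notation orc := (@of_real_coord R n).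
Local Notation mu := (@lebesgue_Cn R n).

Lemma cnorm_coord (x : V) j : cnorm (x ord0 j) <= cnorm x.
Proof.
apply/ler_addgt0Pl => e e0; have x0 := cnorm_ge0 x.
have h : 0 < e + cnorm x by rewrite ltr_pwDl.
by apply/ltW; apply: (cnorm_row_lt x h).1; rewrite ltrDr.
Qed.

(** Compactness in finite dimension: points where |f| exceeds every bound have coordinates
    converging along an ultrafilter, and continuity at the limit is violated. *)
Lemma closed_ball_bounded (f : V -> C) (w : V) (s : R) :
  (forall x, cnorm (x - w) <= s -> {for x, continuous f}) ->
  exists K, forall x, cnorm (x - w) <= s -> cnorm (f x) <= K.
Proof.
move=> fc; apply: contrapT => /forallNP H.
have H' (k : nat) : exists x, cnorm (x - w) <= s /\ k%:R < cnorm (f x).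
  have /existsNP[x /not_implyP[xs /negP]] := H k%:R; rewrite -ltNge => kx.
  by exists x.
have [x xP] := choice H'.
have [U [UU sU]] := ultraFilterLemma (eventually_filter : ProperFilter \oo).
have xb k : cnorm (x k) <= s + cnorm w.
  have [h _] := xP k; have := cnorm_dist (x k) 0 w; rewrite !subr0 => /le_trans; apply.
  by rewrite lerD2r.
have co j : exists l, ultra_lim U (fun k => x k ord0 j) l.
  by apply: (@ultra_lim_ex _ _ UU _ (s + cnorm w)) => k; exact: le_trans (cnorm_coord _ _) (xb k).
have [l lP] := choice co.
pose y : V := \row_j l j.
have xy : ultra_lim U x y.
  move=> e e0.
  have : U [set k | forall j, cnorm (x k ord0 j - l j) < e].
    by apply: filter_forall => j; exact: lP.
  by apply: filterS => k /= h; apply/cnorm_row_lt => // j; rewrite !mxE.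
have yw : cnorm (y - w) <= s.
  have cw : ultra_lim U (fun=> w) w.
    by move=> e e0; apply: filterS filterT => k _ /=; rewrite subrr cnorm0.
  by apply: (ultra_lim_norm UU _ (ultra_limB UU xy cw)) => k; case: (xP k).
have [d d0 dP] := (cnorm_continuous _ _).1 (fc _ yw) _ ltr01.
have Ux := xy _ d0.
have Uk : U [set k | (Num.bound (cnorm (f y) + 1) <= k)%N].
  by apply: sU; exact: nbhs_infty_ge.
have [k [/= kd kb]] := ultra_nonempty UU (filterI Ux Uk).
have := dP _ kd; rewrite ltNge => /negP; apply.
have [_ fk] := xP k.
have bk : cnorm (f y) + 1 < k%:R.
  apply: lt_le_trans (archi_boundP _) _; first by rewrite addr_ge0 ?cnorm_ge0.
  by rewrite ler_nat.
have := cnorm_dist (f (x k)) 0 (f y); rewrite !subr0.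
move: (cnorm (f y)) (cnorm (f (x k))) (cnorm _) (k%:R : R) fk bk.
by clear => *; lra.
Qed.

Variables (p : R) (Omega : set V).
Hypotheses (p1 : 1 <= p) (oO : open Omega).
Let p0 : 0 < p. Proof. exact: lt_le_trans p1. Qed.

Lemma ipow_ge_box (f : V -> C) (c : V) (s a : R) : cmeasurable Omega f -> 0 < s -> 0 <= a ->
  (forall t, box c s t -> Omega (orc t) /\ a <= cnorm (f (orc t))) ->
  ((a `^ p * (4 * s ^+ 2) ^+ n)%:E <= ipow p Omega f)%E.
Proof.
move=> mf s0 a0 H; have mU := measurable_open oO; have mB := measurable_box_Cn c s.
apply: (@le_trans _ _ (\int[mu]_(t in box c s) (cnorm (f (orc t)) `^ p)%:E)%E); last first.
  apply: ge0_subset_integral => //.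
  - exact: cmeasurable_epowR mf.
  - by move=> t _; rewrite lee_fin powR_ge0.
  - by move=> t /H[].
rewrite EFinM -(lebesgue_Cn_box c s0) -integral_cst//.
apply: ge0_le_integral => //.
- by move=> t _; rewrite lee_fin powR_ge0.
- apply: (@measurable_funS _ _ _ _ (orc @^-1` Omega)) => //.
    by move=> t /H[].
  exact: cmeasurable_epowR mf.
- by move=> t /H[_ h]; rewrite lee_fin; exact: powR_le.
Qed.

(* Maximising [|f x| ^ p (s - |x - w|) ^ (2 n)] approximately yields a point [x1]
   around which |f| is at most a constant multiple of [|f x1|], hence, by the
   Cauchy estimates, at least half of it on a box of comparable size. *)
Lemma point_bound : exists2 k : R, 0 < k & forall (f : V -> C) (w : V) (s : R),
  bergman p Omega f -> 0 < s -> (forall x, cnorm (x - w) < 2 * s -> Omega x) ->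
  cnorm (f w) `^ p * (s ^+ 2) ^+ n <= k * bergman_norm p Omega f `^ p.
Proof.
pose B : R := 2 * 4 ^+ n.
have B1 : 1 <= B.
  rewrite /B; have : 1 <= 4 ^+ n :> R by rewrite exprn_ege1// ler1n.
  by move: (_ ^+ n) => x; lra.
have B0 : 0 < B by exact: lt_le_trans B1.
pose q : R := (4 / (256 * B) ^+ 2) ^+ n.
have b256 : 0 < 256 * B by apply: mulr_gt0 => //; rewrite ltr0n.
have q0 : 0 < q by rewrite exprn_gt0// divr_gt0// exprn_gt0.
exists (2 * 2 `^ p / q) => [|f w s [Lf hf] s0 wO].
  by rewrite divr_gt0// mulr_gt0// powR_gt0.
have dfc x : cnorm (x - w) <= s -> {for x, continuous f}.
  move=> xs; apply: differentiable_continuous; apply: hf; apply: wO.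
  by apply: le_lt_trans xs _; rewrite ltr_pMl// ltr1n.
have [K fK] := closed_ball_bounded dfc.
have K0 : 0 <= K by apply: le_trans (cnorm_ge0 (f w)) (fK _ _); rewrite subrr cnorm0 ltW.
pose W x := cnorm (f x) `^ p * ((s - cnorm (x - w)) ^+ 2) ^+ n.
have WwE : cnorm (f w) `^ p * (s ^+ 2) ^+ n = W w by rewrite /W subrr cnorm0 subr0.
rewrite WwE.
(* Outside this trivial case the supremum is positive, so half of it is an admissible margin. *)
have [->|Ww0] := eqVneq (W w) 0.
  by rewrite mulr_ge0 ?powR_ge0// divr_ge0 ?(ltW q0)// mulr_ge0// powR_ge0.
have Ww : 0 < W w.
  rewrite lt_neqAle eq_sym Ww0 mulr_ge0 ?powR_ge0// exprn_ge0// sqr_ge0//.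
pose E := [set W x | x in [set x | cnorm (x - w) < s]].
have Ew : E (W w) by exists w => //=; rewrite subrr cnorm0.
have Eub : ubound E (K `^ p * (s ^+ 2) ^+ n).
  move=> _ [x /= xs <-]; apply: ler_pM.
  - exact: powR_ge0.
  - exact: exprn_ge0 (sqr_ge0 _).
  - by apply: powR_le => //; [exact: cnorm_ge0|exact/fK/ltW].
  - apply: lerXn2r; rewrite ?nnegrE ?sqr_ge0//.
    apply: lerXn2r; rewrite ?nnegrE ?subr_ge0 ?(ltW xs) ?(ltW s0)//.
    by rewrite gerBl cnorm_ge0.
have supE : has_sup E by split; [exists (W w)|exists (K `^ p * (s ^+ 2) ^+ n)].
have WS : W w <= sup E by apply: ub_le_sup => //; exists (K `^ p * (s ^+ 2) ^+ n).
have S0 : 0 < sup E by exact: lt_le_trans WS.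
have [_ [x1 /= x1s <-] x1S] : exists2 y, E y & sup E - sup E / 2 < y.
  by apply: sup_adherent => //; rewrite divr_gt0.
pose A := cnorm (f x1); pose d := s - cnorm (x1 - w).
have d0 : 0 < d by rewrite subr_gt0.
have A0 : 0 <= A by exact: cnorm_ge0.
have SW : sup E < 2 * (A `^ p * (d ^+ 2) ^+ n).
  by move: x1S; rewrite -/A -/d /W -/A -/d; move: (_ * _) (sup E) => *; lra.
have d20 : 0 < d / 2 by rewrite divr_gt0.
have near1 x : cnorm (x - x1) < d / 2 -> cnorm (x - w) + d / 2 < s.
  move=> xd; have := cnorm_dist x w x1.
  move: xd; rewrite /d; move: (cnorm (x - x1)) (cnorm (x1 - w)) (cnorm (x - w)) => *; lra.
have inb x : cnorm (x - x1) < d / 2 -> cnorm (x - w) < s.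
  by move=> /near1; apply: le_lt_trans; rewrite lerDl ltW.
have inO x : cnorm (x - x1) < d / 2 -> Omega x.
  by move=> /inb xs; apply: wO; apply: lt_trans xs _; rewrite ltr_pMl// ltr1n.
have fBA x : cnorm (x - x1) < d / 2 -> cnorm (f x) <= B * A.
  move=> xd; have Wx : W x <= sup E.
    by apply: ub_le_sup; [exists (K `^ p * (s ^+ 2) ^+ n)|exists x => //=; exact: inb].
  apply: (@powR_le_inv _ p) => //; first by rewrite mulr_ge0// ltW.
  have dn : 0 < (d ^+ 2) ^+ n by rewrite !exprn_gt0.
  have h1 : cnorm (f x) `^ p * (((d / 2) ^+ 2) ^+ n) <= W x.
    rewrite /W; apply: ler_wpM2l; first exact: powR_ge0.
    have ds : d / 2 <= s - cnorm (x - w) by rewrite lerBrDl ltW// near1.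
    apply: lerXn2r; rewrite ?nnegrE ?sqr_ge0//.
    by apply: lerXn2r; rewrite ?nnegrE ?(ltW d20)//; apply: le_trans ds; exact: ltW.
  have h2 : ((d / 2) ^+ 2) ^+ n * 4 ^+ n = (d ^+ 2) ^+ n.
    by rewrite -exprMn; congr (_ ^+ n); field.
  have h3 : cnorm (f x) `^ p <= B * A `^ p.
    rewrite -(ler_pM2r dn) -h2 /B.
    have n4 : 0 < 4 ^+ n :> R by rewrite exprn_gt0// ltr0n.
    rewrite mulrA.
    have -> : 2 * 4 ^+ n * A `^ p * (((d / 2) ^+ 2) ^+ n * 4 ^+ n) =
      2 * (A `^ p * (((d / 2) ^+ 2) ^+ n * 4 ^+ n)) * 4 ^+ n by ring.
    rewrite ler_pM2r//; apply: ltW.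
    by apply: le_lt_trans (le_trans h1 Wx) _; rewrite h2.
  apply: le_trans h3 _; rewrite powRM ?(ltW B0)//.
  by apply: ler_wpM2r; [exact: powR_ge0|exact: le1r_powR].
(* Chosen so that the Lipschitz bound 32 (B A) / (d / 2) over the distance 2 s2 is exactly A / 2. *)
pose s2 := d / (256 * B).
have s20 : 0 < s2 by rewrite divr_gt0.
have s2d : 2 * s2 < d / 2 / 2.
  have -> : 2 * s2 = d / (128 * B) by rewrite /s2; field; rewrite gt_eqF.
  have -> : d / 2 / 2 = d / 4 by field.
  rewrite ltr_pM2l// ltf_pV2 ?posrE; last 2 first.
  - by rewrite mulr_gt0// ltr0n.
  - by rewrite ltr0n.
  by apply: lt_le_trans (ler_peMr _ B1); rewrite ?ler0n// ltr_nat.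
have low t : box x1 s2 t -> Omega (orc t) /\ A / 2 <= cnorm (f (orc t)).
  move=> tb; have h := box_ball s20 tb.
  have h' : cnorm (orc t - x1) < d / 2 / 2 by exact: lt_trans h s2d.
  have h2 : cnorm (orc t - x1) < d / 2.
    by apply: lt_trans h' _; rewrite ltr_pdivrMr// ltr_pMr// ltr1n.
  split; first exact: inO.
  have x11 : cnorm (x1 - x1) < d / 2 / 2 by rewrite subrr cnorm0 divr_gt0.
  have hfx y : cnorm (y - x1) < d / 2 -> differentiable f y by move=> /inO; exact: hf.
  have := cauchy_lipschitz d20 hfx fBA x11 h'.
  have hb : 32 * (B * A) / (d / 2) * cnorm (orc t - x1) <= A / 2.
    have -> : A / 2 = 32 * (B * A) / (d / 2) * (2 * s2).
      by rewrite /s2; field; rewrite !gt_eqF.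
    apply: ler_wpM2l; last exact: ltW.
    exact: divr_ge0 (mulr_ge0 (ler0n _ _) (mulr_ge0 (ltW B0) A0)) (ltW d20).
  move=> /le_trans/(_ hb); have := cnorm_dist (f x1) 0 (f (orc t)).
  rewrite !subr0 (cnorm_distC (f x1)) -/A.
  by move: (cnorm (f (orc t))) (cnorm _) => u v; lra.
have A20 : 0 <= A / 2 by rewrite divr_ge0.
have := ipow_ge_box (Lp_cmeasurable p1 Lf) s20 A20 low.
rewrite ipow_normE// lee_fin => I.
apply: le_trans WS _; apply: le_trans (ltW SW) _.
have -> : 2 * 2 `^ p / q * bergman_norm p Omega f `^ p =
  2 * 2 `^ p * (bergman_norm p Omega f `^ p / q) by rewrite mulrAC -!mulrA.
have qE : (4 * s2 ^+ 2) ^+ n = (d ^+ 2) ^+ n * q.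
  rewrite /q -exprMn; congr (_ ^+ n); rewrite /s2 expr_div_n.
  by rewrite mulrCA.
rewrite qE mulrA -ler_pdivlMr// in I.
apply: le_trans (ler_wpM2l _ I); last by rewrite mulr_ge0// powR_ge0.
rewrite -mulrA ler_pM2l// powRM// ?invr_ge0// mulrA mulrA.
by rewrite (mulrAC (2 `^ p)) -powRM ?invr_ge0// divff// powR1 mul1r.
Qed.

Theorem bergman_local_bound (z : V) : Omega z -> exists r K : R,
  [/\ 0 < r, 0 < K, forall y, cnorm (y - z) < r -> Omega y &
   forall f, bergman p Omega f -> forall y, cnorm (y - z) < r ->
    cnorm (f y) <= K * bergman_norm p Omega f].
Proof.
move=> Oz; have [e e0 eO] := cnorm_open oO Oz; have [k k0 kP] := point_bound.
(* Each [y] within [s] of [z] has its ball of radius [2 * s] inside [Omega], so one [s] serves all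
   of them. *)
pose s := e / 3; have s0 : 0 < s by rewrite divr_gt0.
have se : e = 2 * s + s by rewrite /s; field.
exists s, ((k / (s ^+ 2) ^+ n) `^ p^-1); split => //.
- by rewrite powR_gt0// divr_gt0// !exprn_gt0.
- move=> y ys; apply: eO; apply: lt_trans ys _; rewrite se ltrDr mulr_gt0//.
- move=> f bf y ys; have sn : 0 < (s ^+ 2) ^+ n by rewrite !exprn_gt0.
  have N0 := bergman_norm_ge0 p Omega f.
  have := kP f y s bf s0; rewrite -ler_pdivlMr// => H.
  apply: (@powR_le_inv _ p) => //; first by rewrite mulr_ge0 ?powR_ge0.
  rewrite powRM ?powR_ge0// -powRrM mulVf ?gt_eqF// powRr1; last first.
    by rewrite divr_ge0// ltW.
  rewrite mulrAC; apply: H => x xy; apply: eO.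
  by apply: le_lt_trans (cnorm_dist _ _ y) _; rewrite se ltrD.
Qed.

End local_bound.

(** * Extremal functions and their dependence on the point *)

Section minimizers.
Context (R : realType) (n : nat) (p : R) (Omega : set 'rV[R[i]]_n).
Hypotheses (p1 : 1 <= p) (Omega_bd : bounded_domain Omega).
Local Notation C := R[i].
Local Notation V := 'rV[C]_n.
Local Notation M := (measurableTypeR R).
Local Notation orc := (@of_real_coord R n).
Local Notation mu := (@lebesgue_Cn R n).
Local Notation norm := (bergman_norm p Omega).
Local Notation m := (min_norm p Omega).
Implicit Types (f g : V -> C) (z w : V).

Let p0 : 0 < p. Proof. exact: lt_le_trans p1. Qed.
Let oO : open Omega. Proof. by case: Omega_bd. Qed.
Let cO : connected Omega. Proof. by case: Omega_bd. Qed.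

Lemma powR_mid (a b : R) : 0 <= a -> 0 <= b ->
  ((a + b) / 2) `^ p <= (a `^ p + b `^ p) / 2.
Proof.
move=> a0 b0; rewrite ![_ / 2]mulrC !mulrDr.
rewrite {2 4}(_ : 2^-1 = 1 - 2^-1); last by rewrite {2}(splitr 1) div1r addrK.
by apply: (convex_powR p1 (Itv01 _ _)) => //=;
  rewrite ?inE/= ?in_itv/= ?a0 ?b0// ?invr_ge0// invf_le1 ?ler1n.
Qed.

Lemma bergmanZ (c : C) f : bergman p Omega f -> bergman p Omega (fun z => c * f z) /\
  norm (fun z => c * f z) = cnorm c * norm f.
Proof.
move=> [Lf hf]; have [Lcf E] := LpZ p1 oO c Lf; split => //; split => // z Oz.
by apply: differentiableM; [exact: differentiable_cst|exact: hf].
Qed.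

Lemma bergmanB f g : bergman p Omega f -> bergman p Omega g ->
  bergman p Omega (fun z => f z - g z) /\ norm (fun z => f z - g z) <= norm f + norm g.
Proof.
move=> [Lf hf] [Lg hg].
have [] := Lp_minkowski p1 oO Lf Lg
  (cmeasurableB (Lp_cmeasurable p1 Lf) (Lp_cmeasurable p1 Lg)).
  by move=> z _; exact: cnormB.
move=> Lh le; split => //; split => // z Oz.
by apply: differentiableB; [exact: hf|exact: hg].
Qed.

Lemma bergmanD f g : bergman p Omega f -> bergman p Omega g ->
  bergman p Omega (fun z => f z + g z).
Proof.
move=> [Lf hf] [Lg hg].
have [] := Lp_minkowski p1 oO Lf Lg
  (cmeasurableD (Lp_cmeasurable p1 Lf) (Lp_cmeasurable p1 Lg)).
  by move=> z _; exact: cnormD.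
move=> Lh _; split => // z Oz.
by apply: differentiableD; [exact: hf|exact: hg].
Qed.

Lemma bergman_cst (c : C) : bergman p Omega (cst c).
Proof.
split; last by move=> z _; exact: differentiable_cst.
apply/LpE => //; split; first exact: cmeasurable_cst.
have -> : ipow p Omega (cst c) = ((cnorm c `^ p)%:E * mu (orc @^-1` Omega))%E.
  by rewrite -integral_cst//; exact: measurable_open.
apply: lte_mul_pinfty; rewrite ?lee_fin ?powR_ge0//.
by apply: lebesgue_Cn_finite => //; case: Omega_bd.
Qed.

Lemma min_norm_lbound z :
  lbound [set norm f | f in bergman p Omega `&` [set f : V -> C | f z = 1]] 0.
Proof. by move=> _ [f _ <-]; exact: bergman_norm_ge0. Qed.

Lemma min_norm_le f z : bergman p Omega f -> f z = 1 -> m z <= norm f.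
Proof.
move=> bf f1; apply: ge_inf; first by exists 0; exact: min_norm_lbound.
by exists f.
Qed.

Lemma min_norm_approx z (e : R) : 0 < e ->
  exists f, [/\ bergman p Omega f, f z = 1 & norm f < m z + e].
Proof.
move=> e0; have [|_ [f [bf f1] <-] fe] := @inf_adherent R
    [set norm f | f in bergman p Omega `&` [set f : V -> C | f z = 1]] e e0.
  split; last by exists 0; exact: min_norm_lbound.
  by exists (norm (cst 1)), (cst 1) => //; split => //; exact: bergman_cst.
by exists f.
Qed.

Lemma min_norm_gt0 z : Omega z -> 0 < m z.
Proof.
move=> Oz; have [r [K [r0 K0 _ KP]]] := bergman_local_bound p1 oO Oz.
apply: (@lt_le_trans _ _ K^-1); first by rewrite invr_gt0.
apply: lb_le_inf.
  by exists (norm (cst 1)), (cst 1) => //; split => //; exact: bergman_cst.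
move=> _ [f [bf /= f1] <-].
rewrite -[leLHS]mul1r ler_pdivrMr// mulrC.
have := KP f bf z; rewrite subrr cnorm0 f1 cnorm1; exact.
Qed.

Lemma bergman_montel (f : nat -> V -> C) (K : R) :
  (forall k, bergman p Omega (f k)) -> (forall k, norm (f k) <= K) ->
  exists (phi : nat -> nat) (F : V -> C),
    [/\ forall j, (j <= phi j)%N, holomorphic Omega F &
        cvg_on Omega (fun j => f (phi j)) F].
Proof.
move=> bf fK; apply: (montel (@dense_seqP R n)) => [k z|z Oz].
  by case: (bf k) => _; exact.
have [r [K' [r0 K'0 rO KP]]] := bergman_local_bound p1 oO Oz.
exists r, (K' * K); split => // k y yr.
by apply: le_trans (KP _ (bf k) _ yr) _; rewrite ler_pM2l.
Qed.

Lemma cvg_on_at (f : nat -> V -> C) F z : cvg_on Omega f F -> Omega z ->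
  (forall k, f k z = 1) -> F z = 1.
Proof.
move=> fF Oz f1; apply/eqP; rewrite -subr_eq0; apply/eqP/cnorm0_eq0/eqP.
rewrite eq_le cnorm_ge0 andbT; apply/ler_addgt0Pl => e e0.
have [N NP] := fF _ Oz _ e0; have := NP N (leqnn _).
by rewrite f1 cnorm_distC addr0 => /ltW.
Qed.

Lemma minimizer_exists z : Omega z ->
  exists f, [/\ bergman p Omega f, f z = 1 & norm f = m z].
Proof.
move=> Oz.
have ap (k : nat) : exists f, [/\ bergman p Omega f, f z = 1 & norm f < m z + k.+1%:R^-1].
  by apply: min_norm_approx; rewrite invr_gt0.
have [f fP] := choice ap.
have bf k : bergman p Omega (f k) by case: (fP k).
have fK k : norm (f k) <= m z + 1.
  have [_ _ /ltW h] := fP k; apply: (le_trans h).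
  by rewrite lerD2l invf_le1 ?ler1n.
have [phi [F [phiP hF fF]]] := bergman_montel bf fK.
have m0 := ltW (min_norm_gt0 Oz).
(* The norms only approach [m z], so Fatou's lemma is applied to a tail of the sequence for each
   [e]. *)
have LF (e : R) : 0 < e -> Lp p Omega F /\ norm F <= m z + e.
  move=> e0; have [N] := ltr_add_invr e0; rewrite add0r => Ne.
  apply: (@Lp_fatou _ _ _ _ p1 oO (fun j => f (phi (N + j)%N)) F).
  - by rewrite addr_ge0// ltW.
  - by move=> k; case: (bf (phi (N + k)%N)).
  - move=> x Ox d d0; have [N' N'P] := fF _ Ox _ d0; exists N' => j N'j.
    by apply: N'P; rewrite (leq_trans N'j)// leq_addl.
  - move=> k; have [_ _ /ltW h] := fP (phi (N + k)%N); apply: (le_trans h).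
    rewrite lerD2l; apply: le_trans (ltW Ne); rewrite lef_pV2 ?posrE// ler_nat ltnS.
    by apply: leq_trans (phiP _); exact: leq_addr.
have F1 : F z = 1 by apply: (cvg_on_at fF Oz) => k; case: (fP (phi k)).
have bF : bergman p Omega F by split => //; have [] := LF 1 ltr01.
exists F; split => //; apply/eqP; rewrite eq_le min_norm_le// andbT.
by apply/ler_addgt0Pr => e /LF[].
Qed.

Lemma minimizerP z : Omega z -> [/\ bergman p Omega (minimizer p Omega z),
  minimizer p Omega z z = 1 & norm (minimizer p Omega z) = m z].
Proof.
move=> Oz; exact: (@xgetPex (V -> C) (fun=> 0) [set f | [/\ bergman p Omega f,
  f z = 1 & norm f = m z]] (minimizer_exists Oz)).
Qed.

(* Convexity of the p-th power of the norm forces the equality case of the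
   triangle inequality at every point, as all functions are continuous. *)
Lemma minimizer_norm_additive f g z : bergman p Omega f -> bergman p Omega g ->
  f z = 1 -> g z = 1 -> norm f = m z -> norm g = m z ->
  forall x, Omega x -> cnorm (f x + g x) = cnorm (f x) + cnorm (g x).
Proof.
move=> bf bg f1 g1 Nf Ng x0 Ox0; apply/eqP; rewrite eq_le cnormD/= leNgt.
apply/negP => lt0; have [[Lf hf] [Lg hg]] := (bf, bg).
pose h x : C := 2^-1 * (f x + g x).
have n2 : cnorm (2^-1 : C) = 2^-1.
  by rewrite (_ : 2^-1 = (2^-1 : R)%:C) ?cnorm_real ?ger0_norm// rmorphV ?unitfE// rmorph_nat.
have [bh _] := bergmanZ 2^-1 (bergmanD bf bg).
have h1 : h z = 1 by rewrite /h f1 g1 mulVf// pnatr_eq0.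
have hE x : cnorm (h x) = cnorm (f x + g x) / 2 by rewrite cnormM n2 mulrC.
pose a0 := cnorm (f x0 + g x0) / 2; pose b0 := (cnorm (f x0) + cnorm (g x0)) / 2.
have ab0 : a0 < b0 by rewrite /a0 /b0 ltr_pM2r.
(* A third of the strict gap at [x0]: after both sides move by at most [d] on a small box, the
   levels [al] and [be] are still apart. *)
pose d := (b0 - a0) / 3.
have d0 : 0 < d by rewrite divr_gt0// subr_gt0.
have [r1 r10 r1f] := (cnorm_continuous _ _).1 (differentiable_continuous (hf _ Ox0)) _ d0.
have [r2 r20 r2g] := (cnorm_continuous _ _).1 (differentiable_continuous (hg _ Ox0)) _ d0.
have [r3 r30 r3O] := cnorm_open oO Ox0.
pose r := Num.min r1 (Num.min r2 r3); pose s := r / 2.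
have r0 : 0 < r by rewrite !lt_min r10 r20.
have s0 : 0 < s by rewrite divr_gt0.
pose al := a0 + d; pose be := b0 - d.
have ale : al < be by move: ab0; rewrite /al /be /d => ?; lra.
have al0 : 0 <= al.
  by apply: addr_ge0 (ltW d0); apply: divr_ge0 => //; exact: cnorm_ge0.
(* On the box the half-sum [h] loses at least [c0] against the mean of |f|^p and |g|^p. Integration
   puts the norm of [h] strictly below [m z], although [h] is admissible. *)
pose c0 := be `^ p - al `^ p.
have c00 : 0 < c0 by rewrite subr_gt0; exact: powR_lt.
have boxP t : box x0 s t -> [/\ Omega (orc t), cnorm (h (orc t)) <= al &
    be <= (cnorm (f (orc t)) + cnorm (g (orc t))) / 2].
  move=> /(box_ball s0); rewrite (_ : 2 * s = r); last by rewrite /s; field.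
  rewrite !lt_min => /and3P[/r1f tf /r2g tg /r3O tO]; split => //.
  - rewrite hE; have := cnormD (f x0 + g x0) ((f (orc t) - f x0) + (g (orc t) - g x0)).
    rewrite addrACA (subrKC (f x0)) (subrKC (g x0)).
    have := cnormD (f (orc t) - f x0) (g (orc t) - g x0).
    rewrite /al /a0; move: tf tg.
    move: (cnorm (f (orc t) - f x0)) (cnorm (g (orc t) - g x0)).
    move: (cnorm (f (orc t) - f x0 + (g (orc t) - g x0))).
    move: (cnorm (f (orc t) + g (orc t))) (cnorm (f x0 + g x0)).
    by move=> *; lra.
  - have hf0 := cnorm_dist (f x0) 0 (f (orc t)); have hg0 := cnorm_dist (g x0) 0 (g (orc t)).
    move: hf0 hg0; rewrite !subr0 (cnorm_distC (f x0)) (cnorm_distC (g x0)) /be /b0.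
    move: tf tg; move: (cnorm (f (orc t) - f x0)) (cnorm (g (orc t) - g x0)).
    move: (cnorm (f (orc t))) (cnorm (g (orc t))) (cnorm (f x0)) (cnorm (g x0)).
    by move=> *; lra.
have mU := measurable_open oO; have mB := measurable_box_Cn x0 s.
have mh := Lp_cmeasurable p1 bh.1.
have mf := Lp_cmeasurable p1 Lf; have mg := Lp_cmeasurable p1 Lg.
have BU : box x0 s `<=` orc @^-1` Omega by move=> t /boxP[].
pose v : R := (4 * s ^+ 2) ^+ n.
have v0 : 0 < v by rewrite exprn_gt0// mulr_gt0// exprn_gt0.
have mI : measurable_fun (orc @^-1` Omega) (fun t => (c0 * \1_(box x0 s) t)%:E).
  apply/measurable_EFinP; apply: measurable_funM; first exact: measurable_cst.
  exact: measurable_indic.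
have I1 : (\int[mu]_(t in orc @^-1` Omega) ((cnorm (h (orc t)) `^ p)%:E +
    (c0 * \1_(box x0 s) t)%:E) = (norm h `^ p + c0 * v)%:E)%E.
  rewrite ge0_integralD//; last 3 first.
  - by move=> t _; rewrite lee_fin powR_ge0.
  - exact: cmeasurable_epowR mh.
  - by move=> t _; rewrite lee_fin mulr_ge0// ltW.
  rewrite -/(ipow p Omega h) (ipow_normE p1 bh.1).
  under eq_integral do rewrite EFinM.
  rewrite ge0_integralZl//; last 2 first.
  - by apply/measurable_EFinP; exact: measurable_indic.
  - by rewrite lee_fin ltW.
  rewrite integral_indic// setIidl// [X in (_ + _ * X)%E](lebesgue_Cn_box x0 s0).
  by rewrite -EFinM -EFinD.
have I2 : (\int[mu]_(t in orc @^-1` Omega)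
    (2^-1 * (cnorm (f (orc t)) `^ p + cnorm (g (orc t)) `^ p))%:E = (m z `^ p)%:E)%E.
  under eq_integral do rewrite EFinM EFinD.
  have mf' := cmeasurable_epowR p mf; have mg' := cmeasurable_epowR p mg.
  rewrite ge0_integralZl//; last 2 first.
  - exact: emeasurable_funD.
  - by move=> t _; rewrite adde_ge0 ?lee_fin ?powR_ge0.
  rewrite ge0_integralD//; try by move=> t _; rewrite lee_fin powR_ge0.
  rewrite -/(ipow p Omega f) -/(ipow p Omega g) !ipow_normE// Nf Ng -EFinD -EFinM.
  by congr EFin; lra.
have : ((norm h `^ p + c0 * v)%:E <= (m z `^ p)%:E)%E.
  rewrite -I1 -I2; apply: ge0_le_integral => //.
  - by move=> t _; rewrite adde_ge0 ?lee_fin ?powR_ge0// mulr_ge0// ltW.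
  - by apply: emeasurable_funD => //; exact: cmeasurable_epowR mh.
  - apply/measurable_EFinP; apply: measurable_funM; first exact: measurable_cst.
    by apply: measurable_funD; exact: cmeasurable_powR.
  - move=> t Ut; rewrite -EFinD lee_fin.
    have mid := powR_mid (cnorm_ge0 (f (orc t))) (cnorm_ge0 (g (orc t))).
    rewrite [2^-1 * _]mulrC; apply: le_trans mid; rewrite indicE.
    have [/set_mem/boxP[_ hal hbe]|_] := boolP (t \in box x0 s).
      have e1 : cnorm (h (orc t)) `^ p <= al `^ p by apply: powR_le => //; exact: cnorm_ge0.
      have be0 : 0 <= be by rewrite (le_trans al0)// ltW.
      have e2 := powR_le p0 be0 hbe.
      rewrite mulr1 /c0; move: e1 e2.
      move: (_ `^ p) (cnorm (h (orc t)) `^ p) (al `^ p) (be `^ p).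
      by move=> *; lra.
    by rewrite mulr0 addr0; apply: powR_le; rewrite ?cnorm_ge0// hE ler_pM2r// cnormD.
rewrite lee_fin leNgt => /negP; apply.
have : m z `^ p <= norm h `^ p.
  apply: powR_le => //; last exact: min_norm_le.
  by rewrite -Nf; exact: bergman_norm_ge0.
by have := mulr_gt0 c00 v0; move: (c0 * v) (m z `^ p) (norm h `^ p) => *; lra.
Qed.

Lemma minimizer_unique f g z : Omega z -> bergman p Omega f -> bergman p Omega g ->
  f z = 1 -> g z = 1 -> norm f = m z -> norm g = m z ->
  forall x, Omega x -> f x = g x.
Proof.
move=> Oz bf bg f1 g1 Nf Ng; apply: (norm_additive_eq oO cO bf.2 bg.2 _ Oz f1 g1).
exact: minimizer_norm_additive f1 g1 Nf Ng.
Qed.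

Local Notation nmin := (normalized_minimizer p Omega).

Lemma nminE w : nmin w = (fun x => ((m w)^-1)%:C * minimizer p Omega w x).
Proof. by apply/funext => x; rewrite /normalized_minimizer mulrC fmorphV. Qed.

Lemma normalized_minimizerP w : Omega w -> [/\ bergman p Omega (nmin w),
  norm (nmin w) = 1 & nmin w w = ((m w)^-1)%:C].
Proof.
move=> Ow; have [bf f1 Nf] := minimizerP Ow; have m0 := min_norm_gt0 Ow.
have [bn nE] := bergmanZ ((m w)^-1)%:C bf.
rewrite nminE; split => //; last by rewrite f1 mulr1.
by rewrite nE Nf cnorm_real gtr0_norm ?invr_gt0// mulVf// gt_eqF.
Qed.

(** Only inequalities are required because the division of [g] by [c] yields an admissible function
    of norm at most 1/c <= m w; minimality turns every inequality into an equality. *)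
Lemma normalized_minimizer_unique g w (c : R) : Omega w -> bergman p Omega g ->
  norm g <= 1 -> g w = c%:C -> (m w)^-1 <= c ->
  norm g = 1 /\ forall x, Omega x -> g x = nmin w x.
Proof.
move=> Ow bg Ng gw mc; have m0 := min_norm_gt0 Ow.
have c0 : 0 < c by apply: lt_le_trans mc; rewrite invr_gt0.
have cC : c%:C != 0 :> C by rewrite -cnorm_gt0 cnorm_real gtr0_norm.
have [bf Nf] := bergmanZ (c^-1)%:C bg.
have f1 : (c^-1)%:C * g w = 1 by rewrite gw fmorphV mulVf.
have mf := min_norm_le bf f1.
rewrite cnorm_real gtr0_norm ?invr_gt0// in Nf; rewrite Nf in mf.
have cm : c^-1 <= m w by rewrite -[m w]invrK lef_pV2 ?posrE ?invr_gt0.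
have N1 : norm g = 1.
  apply/eqP; rewrite eq_le Ng/=; have := le_trans cm mf.
  by rewrite -{1}[c^-1]mulr1 ler_pM2l ?invr_gt0.
have cE : m w = c^-1 by apply/eqP; rewrite eq_le cm andbT (le_trans mf)// N1 mulr1.
split => // x Ox; have [bm m1 Nm] := minimizerP Ow.
rewrite nminE cE invrK -(@minimizer_unique _ _ w Ow bf bm f1 m1 _ Nm)//.
  by rewrite mulrA fmorphV mulfV ?mul1r.
by rewrite Nf N1 mulr1 cE.
Qed.

(** Equicontinuity of the unit ball at [w]: it allows the value of a minimizer at its own moving
    point to be compared with its value at [w]. *)
Lemma bergman_local_lipschitz w : Omega w -> exists r L : R, [/\ 0 < r, 0 <= L &
  forall f, bergman p Omega f -> norm f <= 1 ->
    forall x, cnorm (x - w) < r -> cnorm (f x - f w) <= L * cnorm (x - w)].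
Proof.
move=> Ow; have [r [K [r0 K0 rO KP]]] := bergman_local_bound p1 oO Ow.
have r20 : 0 < r / 2 by rewrite divr_gt0.
exists (r / 2), (32 * K / r); split => //.
  exact: divr_ge0 (mulr_ge0 (ler0n _ _) (ltW K0)) (ltW r0).
move=> f bf Nf x xr.
have df y : cnorm (y - w) < r -> differentiable f y by move=> /rO; exact: bf.2.
have fK y : cnorm (y - w) < r -> cnorm (f y) <= K.
  by move=> /(KP f bf) /le_trans; apply; rewrite ler_piMr// ltW.
by apply: (cauchy_lipschitz r0 df fK); rewrite ?subrr ?cnorm0.
Qed.

(** One good index beyond any [N0] is what the completeness argument consumes: in a Cauchy sequence
    a single late member near the limit controls the others. *)
Lemma normalized_minimizer_continuous (v : nat -> V) w : Omega w ->
  (forall k, Omega (v k)) ->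
  (forall e : R, 0 < e -> exists N, forall k, (N <= k)%N -> cnorm (v k - w) < e) ->
  forall (e : R) N0, 0 < e -> exists2 k, (N0 <= k)%N &
    norm (fun x => nmin (v k) x - nmin w x) < e.
Proof.
move=> Ow Ov vw e N0 e0.
have bf k : bergman p Omega (nmin (v k)) by case: (normalized_minimizerP (Ov k)).
have Nf k : norm (nmin (v k)) = 1 by case: (normalized_minimizerP (Ov k)).
have Nf1 k : norm (nmin (v k)) <= 1 by rewrite Nf.
have [phi [G [phiP hG fG]]] := bergman_montel bf Nf1.
have [LG NG] := Lp_fatou p1 oO ler01 (fun k => (bf (phi k)).1) fG (fun k => Nf1 (phi k)).
have bG : bergman p Omega G by split.
have [r [L [r0 L0 LP]]] := bergman_local_lipschitz Ow.
have [bF F1 NF] := minimizerP Ow; set F := minimizer p Omega w in bF F1 NF.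
have m0 := min_norm_gt0 Ow.
(* The number 1 / m(v) is the value of the normalized minimizer at [v]; half of [d] moves the
   evaluation point to [w], the other half is convergence to [G] there. *)
have cj (d : R) : 0 < d -> exists j, cnorm (((m (v (phi j)))^-1)%:C - G w) < d /\
    1 - d < cnorm (F (v (phi j))).
  move=> d0; have d20 : 0 < d / 2 by rewrite divr_gt0.
  have L10 : 0 < L + 1 by rewrite ltr_wpDl.
  have [r' r'0 r'F] :=
    (cnorm_continuous _ _).1 (differentiable_continuous (bF.2 _ Ow)) _ d0.
  pose s := Num.min (Num.min r r') (d / 2 / (L + 1)).
  have s0 : 0 < s by rewrite !lt_min r0 r'0 divr_gt0.
  have [N1 N1P] := vw _ s0; have [N2 N2P] := fG _ Ow _ d20.
  pose j := maxn N1 N2; exists j.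
  have vj : cnorm (v (phi j) - w) < s.
    by apply: N1P; apply: leq_trans (phiP j); exact: leq_maxl.
  move: vj; rewrite !lt_min => /andP[/andP[vr vr']]; rewrite ltr_pdivlMr// => vL.
  split.
    have [_ _ <-] := normalized_minimizerP (Ov (phi j)).
    apply: le_lt_trans (cnorm_dist _ _ (nmin (v (phi j)) w)) _.
    rewrite [ltRHS]splitr; apply: ltrD; last exact: N2P (leq_maxr _ _).
    apply: le_lt_trans (LP _ (bf (phi j)) (Nf1 (phi j)) _ vr) _.
    apply: le_lt_trans vL; rewrite mulrC; apply: ler_wpM2l; first exact: cnorm_ge0.
    by rewrite lerDl.
  have := r'F _ vr'; rewrite F1 => h; have := cnorm_dist (1 : C) 0 (F (v (phi j))).
  rewrite !subr0 cnorm1 cnorm_distC.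
  by move: (cnorm _) (cnorm _) h => *; lra.
have cF j : cnorm (F (v (phi j))) / m w <= (m (v (phi j)))^-1.
  have mv := min_norm_gt0 (Ov (phi j)).
  have [F0|F0] := eqVneq (F (v (phi j))) 0.
    by rewrite F0 cnorm0 mul0r invr_ge0 ltW.
  have nF : 0 < cnorm (F (v (phi j))) by rewrite cnorm_gt0.
  have [bF' NF'] := bergmanZ (F (v (phi j)))^-1 bF.
  have := min_norm_le bF' (mulVf F0); rewrite NF' NF cnormV => h.
  rewrite -[_ / _]invrK lef_pV2 ?posrE ?invr_gt0 ?divr_gt0//.
  by rewrite invf_div mulrC.
(* [G w] is a limit of the positive reals 1 / m(v). *)
have GR : G w = (complex.Re (G w))%:C.
  suff im0 : complex.Im (G w) = 0 by case: (G w) im0 => a b /= ->.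
  apply/eqP; rewrite -normr_eq0 eq_le normr_ge0 andbT; apply/ler_addgt0Pl => d d0.
  have [j [jG _]] := cj _ d0; rewrite addr0; apply: le_trans (ltW jG).
  by apply: le_trans (cnorm_Im _); rewrite raddfB/= sub0r normrN.
have Gge : (m w)^-1 <= complex.Re (G w).
  apply/ler_addgt0Pl => d d0; have mi0 : 0 < (m w)^-1 by rewrite invr_gt0.
  (* So that [d = d' / m w + d']: the first term pays for replacing |F(v)| by 1, the second for
     replacing 1 / m(v) by [G w]. *)
  pose d' := d / ((m w)^-1 + 1); have D0 : 0 < (m w)^-1 + 1 by rewrite addr_gt0.
  have d'0 : 0 < d' by rewrite divr_gt0.
  have [j [jG jF]] := cj _ d'0; have := cF j.
  have jR : `|(m (v (phi j)))^-1 - complex.Re (G w)| < d'.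
    apply: le_lt_trans jG; apply: le_trans (cnorm_Re _).
    by rewrite raddfB/=.
  have dE : d = d' * (m w)^-1 + d' by rewrite -[X in _ + X]mulr1 -mulrDr divfK// gt_eqF.
  have jF' : (1 - d') * (m w)^-1 < cnorm (F (v (phi j))) * (m w)^-1 by rewrite ltr_pM2r.
  move: jR; rewrite ltr_norml => /andP[_ jR].
  rewrite dE; move: jR jF'; rewrite mulrBl mul1r.
  move: ((m w)^-1) ((m (v _))^-1) (complex.Re _) (d' / m w) (cnorm _ / m w).
  by move=> *; lra.
have [G1 GE] := normalized_minimizer_unique Ow bG NG GR Gge.
have [bw Nw _] := normalized_minimizerP Ow.
have fw : cvg_on Omega (fun j => nmin (v (phi j))) (nmin w).
  by move=> x Ox; rewrite -GE//; exact: fG.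
have [N NP] := Lp_riesz p1 oO bw.1 (fun j => (bf (phi j)).1) fw (fun j => Nf (phi j)) Nw e0.
exists (phi (maxn N N0)); first by apply: leq_trans (phiP _); exact: leq_maxr.
exact: NP (leq_maxl _ _).
Qed.

Lemma skwarczynski_dist_le z w (t : R) : t \in `[0, 2 * pi]%R ->
  skwarczynski_dist p Omega z w <= norm (fun x => cis t * nmin z x - nmin w x).
Proof.
move=> tI; apply: ge_inf; last by exists t.
by exists 0 => _ [s _ <-]; exact: bergman_norm_ge0.
Qed.

Lemma skwarczynski_dist_ge0 z w : 0 <= skwarczynski_dist p Omega z w.
Proof.
apply: lb_le_inf => [|_ [s _ <-]]; last exact: bergman_norm_ge0.
have z0 : (0 : R) \in `[0, 2 * pi]%R by rewrite in_itv/= lexx mulr_ge0// pi_ge0.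
by exists (norm (fun x => cis 0 * nmin z x - nmin w x)), 0.
Qed.

Lemma skwarczynski_dist_lt z w (e : R) : skwarczynski_dist p Omega z w < e ->
  exists2 t : R, t \in `[0, 2 * pi]%R & norm (fun x => cis t * nmin z x - nmin w x) < e.
Proof.
rewrite -subr_gt0 => e0.
have [|_ [t tI <-]] := @inf_adherent R [set norm (fun x => cis t * nmin z x - nmin w x)
    | t in [set` `[0, 2 * pi]%R]] _ e0.
  split; last by exists 0 => _ [s _ <-]; exact: bergman_norm_ge0.
  have z0 : (0 : R) \in `[0, 2 * pi]%R by rewrite in_itv/= lexx mulr_ge0// pi_ge0.
  by exists (norm (fun x => cis 0 * nmin z x - nmin w x)), 0.
by rewrite -/(skwarczynski_dist p Omega z w) addrC subrK => te; exists t.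
Qed.

End minimizers.

(** * Completeness *)

Theorem theorem4p1 (R : realType) (n : nat) (p : R) (Omega : set 'rV[R[i]]_n)
    (n_gt0 : (0 < n)%N) (p_ge1 : 1 <= p) (Omega_bd : bounded_domain Omega)
    (Omega_lim : forall w : nat -> 'rV[R[i]]_n,
      (forall k, Omega (w k)) ->
      (forall z, Omega z -> ~ cluster (w @ \oo) z) ->
      forall z, Omega z ->
        minimizer p Omega (w k) z / (min_norm p Omega (w k))%:C
          @[k --> \oo] --> (0 : R[i])) :
  skwarczynski_complete p Omega.
Proof.
move=> u Ou uc; have [_ oO _ _] := Omega_bd.
have nP k := normalized_minimizerP p_ge1 Omega_bd (Ou k).
have b k : bergman p Omega (normalized_minimizer p Omega (u k)) by case: (nP k).
have N1 k : bergman_norm p Omega (normalized_minimizer p Omega (u k)) = 1 by case: (nP k).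
have [[w [Ow wu]]|noc] := pselect (exists w, Omega w /\ cluster (u @ \oo) w).
  (* The chosen indices need not increase; the bound [j <= k] alone sends them to infinity. *)
  have sub j : exists k, (j <= k)%N /\ cnorm (u k - w) < j.+1%:R^-1.
    have [||_ [[k /= jk <-] kw]] := wu (u @` [set k | (j <= k)%N])
        [set y | cnorm (y - w) < j.+1%:R^-1]; last by exists k.
      by exists j => // k jk; exists k.
    by apply/cnorm_nbhs; exists j.+1%:R^-1; rewrite ?invr_gt0.
  have [s sP] := choice sub.
  have vw (e : R) : 0 < e -> exists N, forall j, (N <= j)%N -> cnorm (u (s j) - w) < e.
    move=> e0; have [N] := ltr_add_invr e0; rewrite add0r => Ne; exists N => j Nj.
    apply: lt_trans (sP j).2 _; apply: le_lt_trans Ne.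
    by rewrite lef_pV2 ?posrE// ler_nat ltnS.
  exists w => //; apply/cvgrPdist_lt => e e0.
  have e20 : 0 < e / 2 by rewrite divr_gt0.
  have [N NP] := uc _ e20.
  have [j Nj jw] := normalized_minimizer_continuous p_ge1 Omega_bd Ow (fun j => Ou (s j))
    vw N e20.
  exists N => // k Nk; rewrite /= sub0r normrN ger0_norm ?skwarczynski_dist_ge0//.
  (* The phase found for the pair [u k], [u (s j)] also serves for [u k], [w], since the passage
     from [u (s j)] to [w] is close in norm without any phase. *)
  have [t tI tlt] := skwarczynski_dist_lt (NP k (s j) Nk (leq_trans Nj (sP j).1)).
  apply: le_lt_trans (skwarczynski_dist_le p Omega _ _ tI) _.
  have [bw _ _] := normalized_minimizerP p_ge1 Omega_bd Ow.
  have [bt _] := bergmanZ p_ge1 Omega_bd (cis t) (b k).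
  have [b1 _] := bergmanB p_ge1 Omega_bd bt (b (s j)).
  have [b2 _] := bergmanB p_ge1 Omega_bd (b (s j)) bw.
  have [b3 _] := bergmanB p_ge1 Omega_bd bt bw.
  have [|_ le] := Lp_minkowski p_ge1 oO b1.1 b2.1 (Lp_cmeasurable p_ge1 b3.1).
    by move=> x _; exact: cnorm_dist.
  by apply: le_lt_trans le _; rewrite [ltRHS]splitr; exact: ltrD.
have lim0 z : Omega z -> forall e : R, 0 < e -> exists N, forall k, (N <= k)%N ->
    cnorm (normalized_minimizer p Omega (u k) z) < e.
  move=> Oz e e0; have uz : forall z, Omega z -> ~ cluster (u @ \oo) z.
    by move=> y Oy cy; apply: noc; exists y.
  have [|N _ NP] := Omega_lim u Ou uz z Oz [set y | cnorm y < e].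
    by apply/cnorm_nbhs; exists e => // y; rewrite subr0.
  by exists N.
have h0 : (0 : R) < 2^-1 by [].
have [N NP] := uc _ h0.
have tP k : exists t : R, bergman_norm p Omega (fun x =>
    cis t * normalized_minimizer p Omega (u (N + k)%N) x - normalized_minimizer p Omega (u N) x)
    < 2^-1.
  by have [t _ tlt] := skwarczynski_dist_lt (NP _ _ (leq_addr k N) (leqnn N)); exists t.
have [t tlt] := choice tP.
pose g k x := cis (t k) * normalized_minimizer p Omega (u (N + k)%N) x
  - normalized_minimizer p Omega (u N) x.
have bg k : bergman p Omega (g k).
  exact: (bergmanB p_ge1 Omega_bd (bergmanZ p_ge1 Omega_bd (cis (t k)) (b (N + k)%N)).1 (b N)).1.
(* The phases [t k] need not converge: they have modulus 1 and multiply a quantity tending to 0. The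
   limit is written as a scalar multiple so that [bergmanZ] gives its norm, 1, against the bound
   1/2. *)
have gG : cvg_on Omega g (fun x => - 1 * normalized_minimizer p Omega (u N) x).
  move=> x Ox e e0; have [K KP] := lim0 x Ox e e0; exists K => k Kk.
  rewrite /g mulN1r opprK subrK cnormM cnorm_cis mul1r; apply: KP.
  by rewrite (leq_trans Kk)// leq_addl.
have [_] := Lp_fatou p_ge1 oO (ltW h0) (fun k => (bg k).1) gG (fun k => ltW (tlt k)).
have [_ ->] := bergmanZ p_ge1 Omega_bd (- 1) (b N).
by rewrite cnormN cnorm1 N1 mul1r => h; lra.
Qed.
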